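(* Let $C\subset\mathbb{C}^2$ be an irreducible curve, viewed as a smooth projective curve, and consider the escape-rate function $G^+$ restricted to $C\setminus S^+$. Then: (i) $G^+$ extends to a continuous subharmonic function on $C\setminus S_0^+$, and this extension satisfies $G^+(t_0)=0$ at every $t_0\in S^+\setminus S_0^+$; (ii) for any $t_0\in S_0^+$ and any uniformizer $u$ at $t_0$, the function $G^++\frac{\gamma_n}{3^n}\log|u|$ extends to a harmonic function in a neighbourhood of $t_0$ for every sufficiently large $n$.
   Context: $f_{a,b}(z)=z^3-3a^2z+b$. We also denote by $C$ the normalization of the Zariski closure of $C$ in $\mathbb{P}^2$; $a,b$ are rational functions on it, and $c_n:=f^n_{a,b}(a)$ ($n$-th iterate). For $t_0\in C$: $\gamma_a=-\mathrm{ord}_{t_0}a$, $\gamma_b=-\mathrm{ord}_{t_0}b$, $\gamma_{\max}=\max\{3\gamma_a,\gamma_b\}$, $\gamma_n=-\mathrm{ord}_{t_0}c_n$. $S^+=\{t_0\in C:\gamma_{\max}>0\}$ (the poles of $a$ or $b$), $S_0^+=\{t_0\in C:\lim_n\gamma_n=\infty\}\subset S^+$. $G^+(a,b)=\lim_{n\to\infty}3^{-n}\log^+|f^n_{a,b}(a)|$, defined on $C\setminus S^+$. A uniformizer at $t_0$ is a rational function $u$ on $C$ with $\mathrm{ord}_{t_0}u=1$. *)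

(* Defs.v *)
From HB Require Import structures.
From mathcomp Require Import all_boot all_order all_algebra.
From mathcomp Require Import all_classical all_reals all_analysis.
From mathcomp Require Import complex.
From mathcomp.multinomials Require Import (canonicals, coercions) mpoly.

Set Implicit Arguments.
Unset Strict Implicit.
Unset Printing Implicit Defensive.

Import Order.TTheory GRing.Theory Num.Theory.
Import numFieldNormedType.Exports.

Local Open Scope classical_set_scope.
Local Open Scope ring_scope.
Local Open Scope complex_scope.

(* The topology and norm of R[i] as a normed module over itself, copied from
   R[i]^o exactly as the library does for its abstract field types. *)
HB.instance Definition _ (R : realType) := PseudoPointedMetric.copy R[i] R[i]^o.
HB.instance Definition _ (R : realType) := GRing.ComAlgebra.copy R[i] R[i]^o.
HB.instance Definition _ (R : realType) := Vector.copy R[i] R[i]^o.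
HB.instance Definition _ (R : realType) := NormedModule.copy R[i] R[i]^o.

Section RealFunctionsOfAComplexVariable.
Context {R : realType}.
Implicit Types (U : set R[i]) (h : R[i] -> R) (z : R[i]).

Definition slice_x h z : R -> R := fun s => h (s +i* complex.Im z).
Definition slice_y h z : R -> R := fun s => h (complex.Re z +i* s).
Definition dx h : R[i] -> R := fun z => 'D_1 (slice_x h z) (complex.Re z).
Definition dy h : R[i] -> R := fun z => 'D_1 (slice_y h z) (complex.Im z).

Definition C1_on U h :=
  (forall z, U z ->
     derivable (slice_x h z) (complex.Re z) 1 /\
     derivable (slice_y h z) (complex.Im z) 1) /\
  (forall z, U z -> continuous_at z (dx h) /\ continuous_at z (dy h)).

Definition C2_on U h := [/\ C1_on U h, C1_on U (dx h) & C1_on U (dy h)].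

Definition harmonic_on U h :=
  [/\ open U, C2_on U h & forall z, U z -> dx (dx h) z + dy (dy h) z = 0].

Definition circle z (r t : R) : R[i] := z + r%:C * (cos t +i* sin t).

(* Upper semicontinuous, [-oo, +oo)-valued, with the local submean inequality. *)
Definition subharmonic_on U (h : R[i] -> \bar R) :=
  [/\ open U,
      forall z, U z -> (h z < +oo)%E,
      forall z (m : R), U z -> (h z < m%:E)%E ->
        \forall w \near z, (h w < m%:E)%E &
      forall z, U z -> exists2 rho : R, 0 < rho &
        forall r : R, 0 <= r < rho ->
          (h z <= ((2 * pi)^-1)%:E *
             \int[lebesgue_measure]_(t in `[0%R, (2 * pi)%R]) h (circle z r t))%E].

End RealFunctionsOfAComplexVariable.

(* [chart_param] is the inverse of [chart_coord] on [chart_dom]; both are total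
   functions whose values outside [chart_dom] and its image are irrelevant. *)
Record chart (R : realType) (X : topologicalType) := Chart {
  chart_dom : set X;
  chart_coord : X -> R[i];
  chart_param : R[i] -> X }.

Definition is_chart (R : realType) (X : topologicalType) (c : chart R X) :=
  [/\ open (chart_dom c), open (chart_coord c @` chart_dom c),
      forall p, chart_dom c p -> chart_param c (chart_coord c p) = p,
      forall p, chart_dom c p -> continuous_at p (chart_coord c) &
      forall p, chart_dom c p -> continuous_at (chart_coord c p) (chart_param c)].

Section RiemannSurface.
Context {R : realType} {X : topologicalType}.
Implicit Types (A : set (chart R X)) (f g : X -> R[i]) (U : set X) (p q : X).

Definition is_atlas A :=
  [/\ forall c, A c -> is_chart c,
      forall p, exists2 c, A c & chart_dom c p &
      forall c1 c2 p, A c1 -> A c2 -> chart_dom c1 p -> chart_dom c2 p ->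
        derivable (chart_coord c2 \o chart_param c1) (chart_coord c1 p) 1].

Definition compact_riemann_surface A :=
  [/\ hausdorff_space X, compact [set: X], connected [set: X] & is_atlas A].

Definition holomorphic_at A f p :=
  exists c, [/\ A c, chart_dom c p &
    \forall z \near chart_coord c p, derivable (f \o chart_param c) z 1].

(* A meromorphic function is represented by a total function whose values at
   its poles are irrelevant: the order at p only depends on f near p, p excluded.
   The order of a function vanishing identically near p is +oo. *)
Definition has_ord A f p (m : \bar int) : Prop :=
  match m with
  | EFin k => exists c g, [/\ A c, chart_dom c p, holomorphic_at A g p, g p != 0 &
      \forall q \near p^', f q = (chart_coord c q - chart_coord c p) ^ k * g q]
  | EPInf => \forall q \near p^', f q = 0
  | ENInf => False
  end.

Definition ord A f p : \bar int := xget 0%:E%E (has_ord A f p).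

Definition surface_harmonic_on A U (h : X -> R) :=
  open U /\ forall c, A c ->
    harmonic_on (chart_coord c @` (U `&` chart_dom c)) (h \o chart_param c).

Definition surface_subharmonic_on A U (h : X -> \bar R) :=
  open U /\ forall c, A c ->
    subharmonic_on (chart_coord c @` (U `&` chart_dom c)) (h \o chart_param c).

End RiemannSurface.

Section PlaneCurves.
Context {R : realType}.

Definition eval2 (P : mpoly.mpoly 2 R[i]) (x y : R[i]) : R[i] :=
  mpoly.meval (tnth [tuple x; y]) P.

Definition irreducible_elt (D : idomainType) (p : D) :=
  [/\ p != 0, p \isn't a GRing.unit &
      forall q r, p = q * r -> q \is a GRing.unit \/ r \is a GRing.unit].

Definition irreducible_plane_curve (C : set (R[i] * R[i])) :=
  exists2 P : mpoly.mpoly 2 R[i],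
    irreducible_elt P & C = [set xy | eval2 P xy.1 xy.2 = 0].

(* A point of P^2 is represented by a nonzero vector [x0 : x1 : x2], and
   (x, y) in C^2 is identified with [1 : x : y]. *)
Definition proj_eq (v w : 'rV[R[i]]_3) := exists2 l : R[i], l != 0 & v = l *: w.

Definition projective_zariski_closure (C : set (R[i] * R[i])) :
    set 'rV[R[i]]_3 :=
  [set v | v != 0 /\
    forall (d : nat) (Q : mpoly.mpoly 3 R[i]),
      Q \is mpoly.ishomog1 d mpoly.mdeg ->
      (forall x y, C (x, y) -> mpoly.meval (tnth [tuple 1; x; y]) Q = 0) ->
      mpoly.meval (v ord0) Q = 0].

Definition holomorphic_to_P2 (X : topologicalType) (A : set (chart R X))
    (sigma : X -> 'rV[R[i]]_3) :=
  forall p, exists F : X -> 'rV[R[i]]_3,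
    [/\ forall i, holomorphic_at A (fun q => F q ord0 i) p, F p != 0 &
        \forall q \near p, proj_eq (F q) (sigma q)].

(* sigma : X -> P^2 is the normalization of the projective closure of C: X is
   a compact Riemann surface and sigma is holomorphic, onto the closure, and
   one-to-one over the complement of a finite set. *)
Definition is_normalization (C : set (R[i] * R[i])) (X : topologicalType)
    (A : set (chart R X)) (sigma : X -> 'rV[R[i]]_3) :=
  [/\ compact_riemann_surface A, holomorphic_to_P2 A sigma,
      forall p, projective_zariski_closure C (sigma p),
      forall v, projective_zariski_closure C v ->
        exists p, proj_eq (sigma p) v &
      exists2 F : set X, finite_set F &
        forall p q, ~ F p -> proj_eq (sigma p) (sigma q) -> p = q].

Section CoordinateFunctions.
Context {X : Type}.
Variable sigma : X -> 'rV[R[i]]_3.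

Definition afun (p : X) : R[i] := sigma p ord0 1 / sigma p ord0 0.
Definition bfun (p : X) : R[i] := sigma p ord0 2 / sigma p ord0 0.

(* u is the rational function Q1(a, b) / Q2(a, b), where Q2 does not vanish
   identically on C; the values of u at the finitely many points where this
   expression is not defined are irrelevant. *)
Definition rational_on (C : set (R[i] * R[i])) (u : X -> R[i]) :=
  exists Q1 Q2 : mpoly.mpoly 2 R[i],
    (exists x y, C (x, y) /\ eval2 Q2 x y != 0) /\
    forall p, sigma p ord0 0 != 0 -> eval2 Q2 (afun p) (bfun p) != 0 ->
      u p = eval2 Q1 (afun p) (bfun p) / eval2 Q2 (afun p) (bfun p).

End CoordinateFunctions.
End PlaneCurves.

Section CubicFamily.
Context {R : realType}.

Definition cubic (a b z : R[i]) : R[i] := z ^+ 3 - 3 * a ^+ 2 * z + b.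
Definition orbit_a (n : nat) (a b : R[i]) : R[i] := iter n (cubic a b) a.

Definition cabs (z : R[i]) : R := complex.Re `|z|.
Definition logp (x : R) : R := ln (Num.max 1 x).

Definition Gplus (a b : R[i]) : R :=
  limn (fun n => (3 ^+ n)^-1 * logp (cabs (orbit_a n a b))).

Context {X : topologicalType}.
Variables (A : set (chart R X)) (sigma : X -> 'rV[R[i]]_3).
Let a := afun sigma.
Let b := bfun sigma.

Definition gamma_a (t : X) : \bar int := (- ord A a t)%E.
Definition gamma_b (t : X) : \bar int := (- ord A b t)%E.
Definition gamma_max (t : X) : \bar int :=
  Order.max (3%:E * gamma_a t)%E (gamma_b t).
Definition gamma (n : nat) (t : X) : \bar int :=
  (- ord A (fun p => orbit_a n (a p) (b p)) t)%E.

Definition Splus : set X := [set t | (0%:E < gamma_max t)%E].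
Definition S0plus : set X :=
  [set t | forall M : int, \forall n \near \oo, (M%:E <= gamma n t)%E].

Definition Gcurve (p : X) : R := Gplus (a p) (b p).

Definition uniformizer (C : set (R[i] * R[i])) (t : X) (u : X -> R[i]) :=
  rational_on sigma C u /\ ord A u t = 1%:E%E.

End CubicFamily.

(* Main.v *)
(* Let [G = Gplus], which is continuous in [(a, b)] because the n-th term of its
   defining limit is within [O(3^-n)] of it, locally uniformly.

   Escape.  If near [t0] some [c_N] dominates [a] and the cube root of [b], then
   [c_(N+1) = c_N^3 (1 + eta)] with [eta] small, so [3^-N log|c_N|] differs from
   [G] by the convergent series of the [3^-(j+1) log|1 + eta_j|], the real part of
   a holomorphic function.  This holds at every point of [S_0^+], where [c_N] is a
   power of a uniformizer times a nonvanishing factor, and wherever [G > 0] outside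
   [S^+]; at the other points [G = 0] is a minimum, so the submean inequality is
   trivial.

   Bounded orders.  At a point of [S^+ \ S_0^+] no [c_n] has a larger pole than
   [a], which has a pole of some order [m > 0]: a larger pole would escape.  So the
   [W_n = c_n / a] are holomorphic, [W_(n+1) = a^2 (W_n - 1)^2 (W_n + 2) + W_1], and
   hence [W_n = W_n(t0) + s / a + O(z^(m+1))] with [W_n(t0)] in [{1, -2}] and
   [|s| <= 2].  If [|W_n| <= 3] on [|z| = r], then [|W_(n+k)| <= B^(3^k)] there, where
   [B] is of order [r^-m], and the Schwarz lemma applied to the [O(z^(m+1))] term gives
   [|W_(n+k)| <= 3] on a circle whose radius is about [r B^(-3^k / (m+1))].  One such
   step multiplies [3^-n log B], which bounds [G] near [t0] by the maximum principle,
   by [m / (m+1) + 3 / 3^k < 1] when [k = m + 2], so [G] tends to 0 at [t0]. *)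

Require Import Defs.
From mathcomp Require Import all_boot all_order all_algebra.
From mathcomp Require Import all_classical all_reals all_analysis.
From mathcomp Require Import complex.
From mathcomp Require Import ring lra zify.
Import Order.TTheory GRing.Theory Num.Theory.
Import numFieldNormedType.Exports.
Local Open Scope classical_set_scope.
Local Open Scope ring_scope.
Local Open Scope complex_scope.

Set Implicit Arguments.
Unset Strict Implicit.
Unset Printing Implicit Defensive.

Section ComplexCalculus.
Context {R : realType}.
Implicit Types (z w d e : R[i]) (f g h : R[i] -> R[i]).

Lemma normE z : `|z| = (cabs z)%:C.
Proof. by case: z. Qed.

Lemma cabsE z : cabs z = Num.sqrt (complex.Re z ^+ 2 + complex.Im z ^+ 2).
Proof. by case: z. Qed.

Lemma cabs_ge0 z : 0 <= cabs z.
Proof. by rewrite cabsE sqrtr_ge0. Qed.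

Lemma cabs0 : cabs (0 : R[i]) = 0.
Proof. exact: ComplexField.Normc.normc0. Qed.

Lemma cabs1 : cabs (1 : R[i]) = 1.
Proof. exact: ComplexField.Normc.normc1. Qed.

Lemma cabs_eq0 z : (cabs z == 0) = (z == 0).
Proof.
apply/eqP/eqP => [/ComplexField.Normc.eq0_normc //|->]; exact: cabs0.
Qed.

Lemma cabs_gt0 z : (0 < cabs z) = (z != 0).
Proof. by rewrite lt_def cabs_ge0 andbT cabs_eq0. Qed.

Lemma cabsM z w : cabs (z * w) = cabs z * cabs w.
Proof. exact: ComplexField.Normc.normcM. Qed.

Lemma cabsV z : cabs z^-1 = (cabs z)^-1.
Proof. exact: ComplexField.Normc.normcV. Qed.

Lemma cabsX z n : cabs (z ^+ n) = cabs z ^+ n.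
Proof. by elim: n => [|n IH]; rewrite ?expr0 ?cabs1// !exprS cabsM IH. Qed.

Lemma cabsXz z (k : int) : cabs (z ^ k) = cabs z ^ k.
Proof. by case: k => n; rewrite ?NegzE -?invr_expz ?cabsV cabsX. Qed.

Lemma cabsN z : cabs (- z) = cabs z.
Proof. exact: normcN. Qed.

Lemma cabsB z w : cabs (z - w) = cabs (w - z).
Proof. by rewrite -cabsN opprB. Qed.

Lemma cabsD z w : cabs (z + w) <= cabs z + cabs w.
Proof. exact: le_normcD. Qed.

Lemma cabsDB z w : cabs (z - w) <= cabs z + cabs w.
Proof. by rewrite -(cabsN w); exact: cabsD. Qed.

Lemma cabs_lowD z w : cabs z - cabs w <= cabs (z + w).
Proof.
by rewrite lerBlDr -{1}(addrK w z); apply: le_trans (cabsDB _ _) _.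
Qed.

Lemma cabs_lowB z w : cabs z - cabs w <= cabs (z - w).
Proof. by rewrite -(cabsN w); exact: cabs_lowD. Qed.

Lemma cabs_tri z w d : cabs (z - d) <= cabs (z - w) + cabs (w - d).
Proof. by rewrite -{1}(subrK w z) -addrA; exact: cabsD. Qed.

Lemma cabs_real (x : R) : cabs x%:C = `|x|.
Proof. by rewrite cabsE /= expr0n addr0 sqrtr_sqr. Qed.

Lemma cabs_nat (n : nat) : cabs (n%:R : R[i]) = n%:R.
Proof.
by rewrite -(rmorph_nat (real_complex R)) cabs_real ger0_norm.
Qed.

Lemma cabs_conj z : cabs (conjc z) = cabs z.
Proof. by rewrite !cabsE; case: z => x y /=; rewrite sqrrN. Qed.

Lemma Re_le_cabs z : `|complex.Re z| <= cabs z.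
Proof.
by rewrite cabsE -(sqrtr_sqr (complex.Re z)) ler_wsqrtr// lerDl sqr_ge0.
Qed.

Lemma Im_le_cabs z : `|complex.Im z| <= cabs z.
Proof.
by rewrite cabsE -(sqrtr_sqr (complex.Im z)) ler_wsqrtr// lerDr sqr_ge0.
Qed.

Lemma cabs_le_ReIm z : cabs z <= `|complex.Re z| + `|complex.Im z|.
Proof.
set s := _ + _; have s0 : 0 <= s by rewrite addr_ge0.
rewrite cabsE -(ger0_norm s0) -(sqrtr_sqr s) ler_wsqrtr// /s.
rewrite sqrrD !real_normK ?num_real// -addrA lerD2l lerDr.
by rewrite mulrn_wge0// mulr_ge0.
Qed.

Lemma nearC z (P : set R[i]) :
  (\forall w \near z, P w) <->
  exists2 r : R, 0 < r & forall w, cabs (w - z) < r -> P w.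
Proof.
split.
- move=> /nbhs_ballP[e /= e0 H]; move: e0; rewrite ltcE /= => /andP[/eqP ei e0].
  exists (complex.Re e) => // w hw; apply: H.
  by rewrite /ball/= -opprB normrN normE ltcE /= ei eqxx.
- move=> [d d0 H]; apply/nbhs_ballP; exists d%:C; first by rewrite /= ltcR.
  move=> w; rewrite /ball /= -opprB normrN normE ltcR; exact: H.
Qed.

Lemma cont_atP (T : topologicalType) (f : T -> R[i]) (p : T) :
  continuous_at p f <->
  forall e : R, 0 < e -> \forall q \near p, cabs (f q - f p) < e.
Proof.
split => [cf e e0|H].
  have /cf : nbhs (f p) [set w | cabs (w - f p) < e] by apply/nearC; exists e.
  by [].
move=> A /nearC[e e0 eA].
rewrite /nbhs /=; near=> q; apply: eA; near: q; exact: H.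
Unshelve. all: by end_near. Qed.

Lemma contP f z : continuous_at z f <->
  forall e : R, 0 < e -> exists2 r : R, 0 < r &
    forall w, cabs (w - z) < r -> cabs (f w - f z) < e.
Proof.
split=> [/cont_atP H e /H /nearC//|H].
by apply/cont_atP => e /H ?; apply/nearC.
Qed.

Lemma cont_atRP (T : topologicalType) (f : T -> R) (p : T) :
  continuous_at p f <->
  forall e : R, 0 < e -> \forall q \near p, `|f q - f p| < e.
Proof.
split => [cf e e0|H].
  by near=> q; rewrite distrC; near: q; move/cvgrPdist_lt : cf; exact.
apply/cvgrPdist_lt => e /H; apply: filterS => q; by rewrite distrC.
Unshelve. all: by end_near. Qed.

Definition has_cderiv f z d :=
  exists q, [/\ continuous_at z q, q z = d & forall w, f w = f z + (w - z) * q w].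

Definition cdiff f z := exists d, has_cderiv f z d.

Lemma has_cderivP f z d : has_cderiv f z d <->
  forall e : R, 0 < e -> exists2 r : R, 0 < r &
    forall w, cabs (w - z) < r ->
      cabs (f w - f z - d * (w - z)) <= e * cabs (w - z).
Proof.
split=> [[q [/contP cq qz fE]] e /cq[r r0 H]|H].
  exists r => // w /H; rewrite qz fE => hw.
  rewrite (_ : _ - _ = (q w - d) * (w - z)); last by rewrite fE; ring.
  by rewrite cabsM ler_wpM2r ?cabs_ge0// ltW.
exists (fun w => if w == z then d else (f w - f z) / (w - z)); split.
- apply/contP => e e0; have [|r r0 {}H] := H (e / 2); first by rewrite divr_gt0.
  exists r => // w hw; rewrite eqxx; case: eqVneq => [_|wz].
    by rewrite subrr cabs0.
  have wz0 : w - z != 0 by rewrite subr_eq0.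
  rewrite (_ : _ - d = (f w - f z - d * (w - z)) / (w - z)); last by field.
  rewrite cabsM cabsV ltr_pdivrMr ?cabs_gt0//.
  apply: le_lt_trans (H _ hw) _; rewrite ltr_pM2r ?cabs_gt0//; lra.
- by rewrite eqxx.
- move=> w; case: eqVneq => [->|wz]; first by rewrite subrr mul0r addr0.
  have wz0 : w - z != 0 by rewrite subr_eq0.
  by field.
Qed.

Lemma cdiff_derivable f z : cdiff f z <-> derivable f z 1.
Proof.
split=> [[d [q [cq qz fE]]]|].
  apply/cvg_ex; exists d => /=; rewrite -qz.
  have H : q (e + z) @[e --> (0 : R[i])] --> q z.
    have cz : continuous_at (0 : R[i]) (fun e => e + z).
      by apply/contP => e e0; exists e => // w; rewrite subr0 add0r addrK.
    rewrite /continuous_at add0r in cz.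
    exact: (cvg_comp _ _ cz cq).
  have {}H := cvg_trans (cvg_app _ (@nbhs_dnbhs _ (0 : R[i]))) H.
  apply: cvg_trans H; apply: near_eq_cvg; near=> e.
  have e0 : e != 0 by near: e; exact: nbhs_dnbhs_neq.
  rewrite /= fE.
  rewrite (_ : e *: (1 : R[i]) + z = e + z); last by rewrite scaler1.
  rewrite fE addrAC subrr add0r addrK.
  by rewrite scalerA mulVf// scale1r.
move=> /cvg_ex[d /= /cvgrPdist_lt H]; exists d; apply/has_cderivP => e e0.
have ec0 : 0 < e%:C by rewrite ltcR.
have /nbhs_ballP[r /= r0 {}H] := H _ ec0.
have /nearC[s s0 {}H] : \forall h \near (0 : R[i]), h != 0 -> `|d - h^-1 *: ((f \o shift z) (h *: 1) - f z)| < e%:C.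
  by apply/nbhs_ballP; exists r.
exists s => // w hw; have [->|wz] := eqVneq w z.
  by rewrite !subrr mulr0 subrr cabs0 mulr0.
have wz0 : w - z != 0 by rewrite subr_eq0.
have := H (w - z); rewrite subr0 => /(_ hw wz0).
rewrite normE ltcR /= => /ltW.
rewrite (_ : (w - z) *: (1 : R[i]) + z = w); last by rewrite scaler1 subrK.
rewrite (cabsB d) => H1.
rewrite -[_^-1 *: _]/(_^-1 * _) in H1.
have -> : f w - f z - d * (w - z) = ((w - z)^-1 * (f w - f z) - d) * (w - z).
  by field.
by rewrite cabsM ler_wpM2r ?cabs_ge0.
Unshelve. all: by end_near. Qed.

End ComplexCalculus.

Section ComplexDerivative.
Context {R : realType}.
Implicit Types (z w d e : R[i]) (f g h : R[i] -> R[i]).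

Lemma cont_cst (T : topologicalType) (c : R[i]) (p : T) :
  continuous_at p (fun=> c).
Proof. exact: cvg_cst. Qed.

Lemma cont_id z : continuous_at z id.
Proof. by []. Qed.

Lemma contD (T : topologicalType) (u v : T -> R[i]) p : continuous_at p u ->
  continuous_at p v -> continuous_at p (fun x => u x + v x).
Proof.
move=> /cont_atP cu /cont_atP cv; apply/cont_atP => e e0.
have e20 : 0 < e / 2 by rewrite divr_gt0.
near=> q; rewrite (_ : _ - _ = (u q - u p) + (v q - v p)); last by ring.
apply: le_lt_trans (cabsD _ _) _; rewrite [e]splitr ltrD//; near: q.
  exact: cu.
exact: cv.
Unshelve. all: by end_near. Qed.

Lemma contM (T : topologicalType) (u v : T -> R[i]) p : continuous_at p u ->
  continuous_at p v -> continuous_at p (fun x => u x * v x).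
Proof.
by move=> cu cv; apply: (@cvgM R[i] _ (nbhs p) _ u v); [exact: cu|exact: cv].
Qed.

Lemma contN (T : topologicalType) (u : T -> R[i]) p : continuous_at p u ->
  continuous_at p (fun x => - u x).
Proof.
move=> /cont_atP cu; apply/cont_atP => e /cu; apply: filterS => q.
by rewrite -opprD cabsN.
Qed.

Lemma contB (T : topologicalType) (u v : T -> R[i]) p : continuous_at p u ->
  continuous_at p v -> continuous_at p (fun x => u x - v x).
Proof. by move=> cu /contN; exact: contD. Qed.

Lemma contV (T : topologicalType) (u : T -> R[i]) p : u p != 0 ->
  continuous_at p u -> continuous_at p (fun x => (u x)^-1).
Proof. by move=> up cu; exact: (@cvgV R[i] _ (nbhs p) _ u (u p) up cu). Qed.

Lemma has_cderiv_cont f z d : has_cderiv f z d -> continuous_at z f.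
Proof.
move=> [q [cq _ fE]]; rewrite (_ : f = (fun w => f z + (w - z) * q w)).
  apply: contD; first exact: cont_cst.
  apply: contM; last exact: cq.
  by apply: contB; [exact: cont_id|exact: cont_cst].
exact/funext.
Qed.

Lemma cdiff_cont f z : cdiff f z -> continuous_at z f.
Proof. by move=> [d /has_cderiv_cont]. Qed.

Lemma has_cderiv_near f g z d : (\forall w \near z, f w = g w) ->
  has_cderiv g z d -> has_cderiv f z d.
Proof.
move=> /nearC[r r0 fg] /has_cderivP H; apply/has_cderivP => e /H[s s0 {}H].
exists (Num.min r s); first by rewrite lt_min r0.
move=> w; rewrite lt_min => /andP[wr ws]; rewrite !fg ?subrr ?cabs0//; exact: H.
Qed.

Lemma cdiff_near f g z : (\forall w \near z, f w = g w) ->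
  cdiff g z -> cdiff f z.
Proof. by move=> fg [d /(has_cderiv_near fg)]; exists d. Qed.

Lemma exists_in_punctured z r : 0 < r -> exists w, w != z /\ cabs (w - z) < r.
Proof.
move=> r0; have wE : z + (r / 2)%:C - z = (r / 2)%:C by rewrite addrC addKr.
exists (z + (r / 2)%:C); split.
  by rewrite -subr_eq0 wE eq_complex /= eqxx andbT gt_eqF// divr_gt0.
by rewrite wE cabs_real gtr0_norm ?divr_gt0//; lra.
Qed.

Lemma has_cderiv_uniq f z d e : has_cderiv f z d -> has_cderiv f z e -> d = e.
Proof.
move=> /has_cderivP Hd /has_cderivP He; apply/eqP; apply: contraT => de.
have k0 : 0 < cabs (d - e) by rewrite cabs_gt0 subr_eq0.
have k4 : 0 < cabs (d - e) / 4 by rewrite divr_gt0.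
have [r r0 {}Hd] := Hd _ k4; have [s s0 {}He] := He _ k4.
have [|w [wz]] := @exists_in_punctured z (Num.min r s); first by rewrite lt_min r0.
rewrite lt_min => /andP[wr ws]; have h1 := Hd w wr; have h2 := He w ws.
have : cabs ((d - e) * (w - z)) <= cabs (d - e) / 2 * cabs (w - z).
  set u := f _ - f _ in h1 h2.
  have -> : (d - e) * (w - z) = (u - e * (w - z)) - (u - d * (w - z)) by ring.
  apply: le_trans (cabsDB _ _) _; lra.
have w0 : 0 < cabs (w - z) by rewrite cabs_gt0 subr_eq0.
by rewrite cabsM ler_pM2r//; lra.
Qed.

Lemma has_cderiv_cst c z : has_cderiv (fun=> c) z 0.
Proof.
exists (fun=> 0); split=> [||w]; [exact: cont_cst|by []|].
by rewrite mulr0 addr0.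
Qed.

Lemma has_cderiv_id z : has_cderiv id z 1.
Proof.
exists (fun=> 1); split=> [||w]; [exact: cont_cst|by []|].
by rewrite mulr1 addrC subrK.
Qed.

Lemma has_cderivD f g z d e : has_cderiv f z d -> has_cderiv g z e ->
  has_cderiv (fun w => f w + g w) z (d + e).
Proof.
move=> [q [cq <- fE]] [p [cp <- gE]].
exists (fun w => q w + p w); split=> [||w]; [exact: (contD cq cp)|by []|].
by rewrite fE gE; ring.
Qed.

Lemma has_cderivM f g z d e : has_cderiv f z d -> has_cderiv g z e ->
  has_cderiv (fun w => f w * g w) z (d * g z + f z * e).
Proof.
move=> Hf Hg; have cg := has_cderiv_cont Hg.
move: Hf Hg => [q [cq <- fE]] [p [cp <- gE]].
exists (fun w => q w * g w + f z * p w); split=> [||w]; [|by []|].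
  apply: contD; apply: contM; [exact: cq|exact: cg|exact: cont_cst|exact: cp].
by rewrite fE gE; ring.
Qed.

Lemma has_cderivN f z d : has_cderiv f z d ->
  has_cderiv (fun w => - f w) z (- d).
Proof.
move=> /(has_cderivM (has_cderiv_cst (-1) z)).
rewrite mul0r add0r mulN1r => H.
by under eq_fun do rewrite -mulN1r.
Qed.

Lemma has_cderivB f g z d e : has_cderiv f z d -> has_cderiv g z e ->
  has_cderiv (fun w => f w - g w) z (d - e).
Proof. by move=> Hf /has_cderivN; exact: has_cderivD. Qed.

Lemma has_cderivV f z d : f z != 0 -> has_cderiv f z d ->
  has_cderiv (fun w => (f w)^-1) z (- d / (f z) ^+ 2).
Proof.
move=> fz0 Hf; have cf := has_cderiv_cont Hf.
move: Hf => [q [cq <- fE]].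
have /nearC[r r0 fn0] : \forall w \near z, f w != 0.
  have /cf : nbhs (f z) [set x | x != 0].
    apply/nearC; exists (cabs (f z)); first by rewrite cabs_gt0.
    move=> w /=; apply: contraTN => /eqP ->.
    by rewrite sub0r cabsN ltxx.
  by [].
apply: (@has_cderiv_near _
    (fun w => (f z)^-1 + (w - z) * (- q w / f z * (f w)^-1))).
  apply/nearC; exists r => // w /fn0 fw0.
  have -> : - q w / f z * (f w)^-1 = - (q w / (f z * f w)).
    by field; rewrite fw0 fz0.
  have [->|wz] := eqVneq w z; first by rewrite subrr mul0r addr0.
  have wz0 : w - z != 0 by rewrite subr_eq0.
  have -> : q w = (f w - f z) / (w - z) by rewrite (fE w); field.
  by field; rewrite fw0 fz0 wz0.
exists (fun w => - q w / f z * (f w)^-1); split.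
- apply: contM; last exact: (contV fz0 cf).
  by apply: contM; [exact: (contN cq)|exact: cont_cst].
- by field.
- by move=> w; rewrite subrr mul0r addr0.
Qed.

Lemma has_cderiv_comp f g z d e : has_cderiv f z d -> has_cderiv g (f z) e ->
  has_cderiv (fun w => g (f w)) z (e * d).
Proof.
move=> Hf; have cf := has_cderiv_cont Hf.
move: Hf => [q [cq <- fE]] [p [cp <- gE]].
exists (fun w => p (f w) * q w); split=> [||w]; [|by []|].
  by apply: contM; [exact: (cvg_comp _ _ cf cp)|exact: cq].
by rewrite gE; set x := p _; rewrite (fE w); ring.
Qed.

Lemma cdiff_cst c z : cdiff (fun=> c) z.
Proof. by eexists; exact: has_cderiv_cst. Qed.

Lemma cdiff_id z : cdiff id z.
Proof. by eexists; exact: has_cderiv_id. Qed.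

Lemma cdiffD f g z : cdiff f z -> cdiff g z -> cdiff (fun w => f w + g w) z.
Proof. by move=> [d Hf] [e Hg]; eexists; exact: has_cderivD Hf Hg. Qed.

Lemma cdiffN f z : cdiff f z -> cdiff (fun w => - f w) z.
Proof. by move=> [d Hf]; eexists; exact: has_cderivN Hf. Qed.

Lemma cdiffB f g z : cdiff f z -> cdiff g z -> cdiff (fun w => f w - g w) z.
Proof. by move=> Hf /cdiffN; exact: cdiffD. Qed.

Lemma cdiffM f g z : cdiff f z -> cdiff g z -> cdiff (fun w => f w * g w) z.
Proof. by move=> [d Hf] [e Hg]; eexists; exact: has_cderivM Hf Hg. Qed.

Lemma cdiffV f z : f z != 0 -> cdiff f z -> cdiff (fun w => (f w)^-1) z.
Proof. by move=> fz [d Hf]; eexists; exact: has_cderivV Hf. Qed.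

Lemma cdiff_div f g z : g z != 0 -> cdiff f z -> cdiff g z ->
  cdiff (fun w => f w / g w) z.
Proof. by move=> gz Hf /(cdiffV gz); exact: cdiffM. Qed.

Lemma cdiff_comp f g z : cdiff f z -> cdiff g (f z) ->
  cdiff (fun w => g (f w)) z.
Proof. by move=> [d Hf] [e Hg]; eexists; exact: has_cderiv_comp Hf Hg. Qed.

Lemma cdiffX f n z : cdiff f z -> cdiff (fun w => f w ^+ n) z.
Proof.
move=> Hf; elim: n => [|n IH].
  by under eq_fun do rewrite expr0; exact: cdiff_cst.
by under eq_fun do rewrite exprS; exact: cdiffM.
Qed.

Lemma cdiffXz f (k : int) z : f z != 0 -> cdiff f z ->
  cdiff (fun w => f w ^ k) z.
Proof.
move=> fz Hf; case: k => n; first exact: cdiffX.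
under eq_fun do rewrite NegzE -invr_expz.
by apply: cdiffV; [rewrite expf_neq0|exact: cdiffX].
Qed.

Lemma cdiff_shift z w : cdiff (fun x => x - w) z.
Proof. by apply: cdiffB; [exact: cdiff_id|exact: cdiff_cst]. Qed.

Lemma near_close f z (d : R) : 0 < d -> cdiff f z ->
  exists2 r, 0 < r & forall w, cabs (w - z) < r -> cabs (f w - f z) < d.
Proof. by move=> d0 /cdiff_cont/contP /(_ _ d0). Qed.

Lemma eq_at_center f g z rho : 0 < rho -> cdiff f z -> cdiff g z ->
  (forall w, w != z -> cabs (w - z) < rho -> f w = g w) -> f z = g z.
Proof.
move=> rho0 df dg fg; apply/eqP; rewrite -subr_eq0; apply: contraT.
rewrite -cabs_gt0 => e0; have e20 : 0 < cabs (f z - g z) / 2 by rewrite divr_gt0.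
have [r r0 Hr] := near_close e20 df; have [s s0 Hs] := near_close e20 dg.
have [|w [wz]] := @exists_in_punctured z (Num.min rho (Num.min r s)).
  by rewrite !lt_min rho0 r0.
rewrite !lt_min => /andP[wrho /andP[wr ws]].
have h1 := Hr w wr; have h2 := Hs w ws; rewrite fg// in h1.
have := cabs_tri (f z) (g w) (g z); rewrite (cabsB (f z) (g w)); lra.
Qed.

Definition holo_ball f z (r : R) := forall w, cabs (w - z) < r -> cdiff f w.

End ComplexDerivative.

Section RectangleFunctional.
Context {R : realType}.

Lemma exprn_small (k L e : R) : 0 <= k -> k < 1 -> 0 < e ->
  exists j, k ^+ j * L < e.
Proof.
move=> k0 k1 e0; have L1 : 0 < `|L| + 1 by rewrite ltr_wpDl.
have e'0 : 0 < e / (`|L| + 1) by rewrite divr_gt0.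
have /cvgrPdist_lt /(_ _ e'0) [n _ Hn] : k ^+ n @[n --> \oo] --> (0 : R).
  by apply: cvg_expr; rewrite ger0_norm.
exists n; have := Hn n (leqnn n); rewrite sub0r normrN ger0_norm ?exprn_ge0//.
rewrite ltr_pdivlMr// => h; apply: le_lt_trans h.
rewrite ler_wpM2l ?exprn_ge0//; have := ler_norm L; lra.
Qed.

Lemma half_pow_small (K e : R) : 0 < e -> exists m, K / 2 ^+ m < e.
Proof.
move=> e0; have [|||m hm] := @exprn_small (1 / 2) K e; rewrite ?divr_ge0//; first lra.
by exists m; rewrite mulrC; move: hm; rewrite expr_div_n expr1n div1r.
Qed.

Lemma nested_point (x y : R^nat) :
  (forall n, [/\ x n <= x n.+1, y n.+1 <= y n & x n <= y n]) ->
  exists l, forall n, x n <= l <= y n.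
Proof.
move=> H.
have up n m : (n <= m)%N -> x n <= x m.
  elim: m => [|m IH]; first by rewrite leqn0 => /eqP ->.
  by rewrite leq_eqVlt => /predU1P[->//|/IH/le_trans]; apply; have [] := H m.
have dn n m : (n <= m)%N -> y m <= y n.
  elim: m => [|m IH]; first by rewrite leqn0 => /eqP ->.
  by rewrite leq_eqVlt => /predU1P[->//|/IH]; apply: le_trans; have [] := H m.
have ub n m : x m <= y n.
  have [_ _ xyn] := H n; have [_ _ xym] := H m.
  case: (leqP n m) => [/dn|/ltnW/up mn]; [exact: le_trans|exact: le_trans xyn].
have hs : has_sup (range x) by split; [exists (x 0), 0|exists (y 0) => _ [m _ <-]].
exists (sup (range x)) => n; apply/andP; split.
  by apply: ub_le_sup; [exact: hs.2|exists n].
by apply: ge_sup; [exact: hs.1|move=> _ [m _ <-]].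
Qed.

Variable Phi : R -> R -> R -> R -> R[i].
Hypothesis Phi_addl : forall s1 s2 s3 t1 t2,
  Phi s1 s3 t1 t2 = Phi s1 s2 t1 t2 + Phi s2 s3 t1 t2.
Hypothesis Phi_addr : forall s1 s2 t1 t2 t3,
  Phi s1 s2 t1 t3 = Phi s1 s2 t1 t2 + Phi s1 s2 t2 t3.

(* Goursat's bisection argument. *)
Lemma rect_additive_eq0 :
  (forall s0 t0 : R, 0 <= s0 -> 0 <= t0 -> forall e : R, 0 < e ->
    exists2 r : R, 0 < r & forall s1 s2 t1 t2,
      0 <= s1 <= s0 -> s0 <= s2 -> 0 <= t1 <= t0 -> t0 <= t2 ->
      s2 - s1 < r -> t2 - t1 < r ->
      cabs (Phi s1 s2 t1 t2) <= e * ((s2 - s1) + (t2 - t1)) ^+ 2) ->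
  forall s1 s2 t1 t2, 0 <= s1 <= s2 -> 0 <= t1 <= t2 -> Phi s1 s2 t1 t2 = 0.
Proof.
move=> loc s1 s2 t1 t2 /andP[s10 s12] /andP[t10 t12].
apply/eqP; apply: contraT; rewrite -cabs_gt0 => K0.
pose a := s2 - s1; pose b := t2 - t1.
have a0 : 0 <= a by rewrite subr_ge0.
have b0 : 0 <= b by rewrite subr_ge0.
have L0 : 0 < (a + b + 1) ^+ 2 by rewrite exprn_gt0//; lra.
pose e := cabs (Phi s1 s2 t1 t2) / 2 / (a + b + 1) ^+ 2.
have e0 : 0 < e by rewrite !divr_gt0.
have eab : e * (a + b) ^+ 2 < cabs (Phi s1 s2 t1 t2).
  apply: (@le_lt_trans _ _ (e * (a + b + 1) ^+ 2)); last first.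
    by rewrite /e divfK ?gt_eqF//; lra.
  by rewrite ler_pM2l// ler_pXn2r ?nnegrE//; lra.
pose bad n (x : R * R) := [/\ 0 <= x.1, 0 <= x.2 &
  e * (a / 2 ^+ n + b / 2 ^+ n) ^+ 2 <
  cabs (Phi x.1 (x.1 + a / 2 ^+ n) x.2 (x.2 + b / 2 ^+ n))].
have step n x : exists y, bad n x -> bad n.+1 y /\
    [/\ x.1 <= y.1, y.1 + a / 2 ^+ n.+1 <= x.1 + a / 2 ^+ n,
        x.2 <= y.2 & y.2 + b / 2 ^+ n.+1 <= x.2 + b / 2 ^+ n].
  case: (pselect (bad n x)) => [|nb]; last by exists x => /nb.
  case=> x1 x2 bx.
  pose an := a / 2 ^+ n.+1; pose bn := b / 2 ^+ n.+1.
  have n2 : (0 : R) < 2 ^+ n.+1 by rewrite exprn_gt0.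
  have an0 : 0 <= an by rewrite divr_ge0// ltW.
  have bn0 : 0 <= bn by rewrite divr_ge0// ltW.
  have n20 : (2 : R) ^+ n != 0 by rewrite expf_neq0// pnatr_eq0.
  have aE : a / 2 ^+ n = an + an by rewrite /an exprS; field.
  have bE : b / 2 ^+ n = bn + bn by rewrite /bn exprS; field.
  rewrite aE bE in bx *; rewrite -/an -/bn.
  move: x1 x2 bx; case: x => x y /= x1 x2 bx.
  apply: contrapT => /forallNP no.
  have sm u v : 0 <= u -> 0 <= v -> u = x \/ u = x + an -> v = y \/ v = y + bn ->
      cabs (Phi u (u + an) v (v + bn)) <= e * (an + bn) ^+ 2.
    move=> u0 v0 hu hv; rewrite leNgt; apply/negP => hb; apply: (no (u, v)) => _.
    by split=> //=; clear -hu hv u0 v0 an0 bn0;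
      move: hu hv => [->|->] [->|->]; split; lra.
  have := bx; rewrite (Phi_addl _ (x + an)) !(Phi_addr _ _ y (y + bn) (y + (bn + bn))) !addrA.
  apply/negP; rewrite -leNgt {K0 no}.
  have h1 := sm x y x1 x2 (or_introl erefl) (or_introl erefl).
  have h2 := sm x (y + bn) x1 (addr_ge0 x2 bn0) (or_introl erefl) (or_intror erefl).
  have h3 := sm (x + an) y (addr_ge0 x1 an0) x2 (or_intror erefl) (or_introl erefl).
  have h4 := sm (x + an) (y + bn) (addr_ge0 x1 an0) (addr_ge0 x2 bn0)
     (or_intror erefl) (or_intror erefl).
  apply: le_trans (cabsD _ _) _; apply: le_trans (lerD (cabsD _ _) (lexx _)) _.
  apply: le_trans (lerD (lerD (cabsD _ _) (lexx _)) (lexx _)) _.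
  have -> : e * (an + an + bn + bn) ^+ 2 = 4 * (e * (an + bn) ^+ 2) by ring.
  clear -h1 h2 h3 h4; lra.
have [F HF] := choice (fun nx : nat * (R * R) => step nx.1 nx.2).
pose x := fix x n := if n is n'.+1 then F (n', x n') else (s1, t1).
have badx n : bad n (x n).
  elim: n => [|n IH]; last exact: (HF (n, x n) IH).1.
  rewrite /bad /= expr0 !divr1 /a /b (addrC s1) (addrC t1) !subrK.
  by split; [exact: s10|exact: t10|exact: eab].
have [S HS] : exists S, forall n, (x n).1 <= S <= (x n).1 + a / 2 ^+ n.
  apply: (@nested_point (fun n => (x n).1)) => n; have [_ []] := HF (n, x n) (badx n).
  by split=> //; rewrite lerDl divr_ge0// exprn_ge0.
have [T HT] : exists T, forall n, (x n).2 <= T <= (x n).2 + b / 2 ^+ n.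
  apply: (@nested_point (fun n => (x n).2)) => n; have [_ []] := HF (n, x n) (badx n).
  by split=> //; rewrite lerDl divr_ge0// exprn_ge0.
have S0 : 0 <= S by apply: le_trans s10 _; have /andP[] := HS 0.
have T0 : 0 <= T by apply: le_trans t10 _; have /andP[] := HT 0.
have [r r0 H] := loc S T S0 T0 e e0.
have [n hn] := half_pow_small (a + b + 1) r0.
have n2 : (0 : R) < 2 ^+ n by rewrite exprn_gt0.
have [x1 x2] := badx n; rewrite ltNge => /negP h; exfalso; apply: h.
have := H (x n).1 ((x n).1 + a / 2 ^+ n) (x n).2 ((x n).2 + b / 2 ^+ n).
have /andP[-> ->] := HS n; have /andP[-> ->] := HT n; rewrite x1 x2 /=.
rewrite ![_ + _ / _ - _]addrC !addKr; apply => //.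
  by apply: le_lt_trans hn; rewrite ler_pM2r ?invr_gt0//; lra.
by apply: le_lt_trans hn; rewrite ler_pM2r ?invr_gt0//; lra.
Qed.

End RectangleFunctional.

Section ComplexIntegral.
Context {R : realType}.
Implicit Types (u v P : R -> R[i]) (a b t : R) (c : R[i]).

Definition rderiv u t c :=
  is_derive t 1 (fun x => complex.Re (u x)) (complex.Re c) /\
  is_derive t 1 (fun x => complex.Im (u x)) (complex.Im c).

Lemma rderivD u v t c d : rderiv u t c -> rderiv v t d ->
  rderiv (fun x => u x + v x) t (c + d).
Proof.
move=> [u1 u2] [v1 v2]; split.
  rewrite raddfD; under eq_fun do rewrite raddfD; exact: is_deriveD.
rewrite raddfD; under eq_fun do rewrite raddfD; exact: is_deriveD.
Qed.

Lemma rderivZ u t c d : rderiv u t c -> rderiv (fun x => d * u x) t (d * c).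
Proof.
case: d => d1 d2; case: c => c1 c2 [/= u1 u2]; split => /=.
  have -> : (fun x => complex.Re (d1 +i* d2 * u x)) =
      d1 \*: (fun x => complex.Re (u x)) - d2 \*: (fun x => complex.Im (u x)).
    by apply/funext => x; cbn; case: (u x).
  by apply: is_deriveB; exact: is_deriveZ.
have -> : (fun x => complex.Im (d1 +i* d2 * u x)) =
    d1 \*: (fun x => complex.Im (u x)) + d2 \*: (fun x => complex.Re (u x)).
  by apply/funext => x; cbn; case: (u x).
by apply: is_deriveD; exact: is_deriveZ.
Qed.

Definition is_prim u P := forall t, -1 < t -> rderiv P t (u t).

Lemma cont_Re (T : topologicalType) (u : T -> R[i]) (p : T) :
  continuous_at p u -> continuous_at p (fun x => complex.Re (u x)).
Proof.
move=> /cont_atP H; apply/cont_atRP => e /H; apply: filterS => q.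
by rewrite -raddfB; apply: le_lt_trans; exact: Re_le_cabs.
Qed.

Lemma cont_Im (T : topologicalType) (u : T -> R[i]) (p : T) :
  continuous_at p u -> continuous_at p (fun x => complex.Im (u x)).
Proof.
move=> /cont_atP H; apply/cont_atRP => e /H; apply: filterS => q.
by rewrite -raddfB; apply: le_lt_trans; exact: Im_le_cabs.
Qed.

Lemma prim_ex_real (f : R -> R) : (forall t, continuous_at t f) ->
  exists P : R -> R, forall t, -1 < t -> is_derive t 1 P (f t).
Proof.
move=> cf; eexists => t t1.
have ft : (@lebesgue_measure R).-integrable `[-1, t + 1] (EFin \o f).
  apply: continuous_compact_integrable; first exact: segment_compact.
  by apply: continuous_subspaceT => x; exact: cf.
have [] := @continuous_FTC1_closed R f (-1) t (t + 1) _ ft t1 (cf t).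
  by rewrite ltrDl.
by move=> d1 d2; apply: DeriveDef; [exact: d1|rewrite -derive1E; exact: d2].
Qed.

Lemma prim_ex u : (forall t, continuous_at t u) -> exists P, is_prim u P.
Proof.
move=> cu.
have [P1 H1] := prim_ex_real (fun t => cont_Re (cu t)).
have [P2 H2] := prim_ex_real (fun t => cont_Im (cu t)).
by exists (fun t => P1 t +i* P2 t) => t t1; split => /=; [exact: H1|exact: H2].
Qed.

Lemma mvt_real (f df : R -> R) a b : -1 < a -> a <= b ->
  (forall t, -1 < t -> is_derive t 1 f (df t)) ->
  exists2 c, a <= c <= b & f b - f a = df c * (b - a).
Proof.
move=> a1 ab H.
have [||c cab ->] := @MVT_segment R f df a b ab.
- by move=> x; rewrite in_itv/= => /andP[ax _]; apply: H; exact: lt_trans ax.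
- apply: derivable_within_continuous => x; rewrite in_itv/= => /andP[ax _].
  by have [] := H x (lt_le_trans a1 ax).
- by exists c.
Qed.

Lemma prim_bound u P a b (M : R) : is_prim u P -> -1 < a -> a <= b ->
  (forall t, a <= t <= b -> cabs (u t) <= M) ->
  cabs (P b - P a) <= 2 * M * (b - a).
Proof.
move=> uP a1 ab uM.
have [c1 c1ab h1] := mvt_real a1 ab (fun x x1 => (uP x x1).1).
have [c2 c2ab h2] := mvt_real a1 ab (fun x x1 => (uP x x1).2).
have ba : `|b - a| = b - a by rewrite ger0_norm// subr_ge0.
apply: le_trans (cabs_le_ReIm _) _; rewrite !raddfB h1 h2 !normrM ba -mulrDl.
apply: ler_wpM2r; first by rewrite subr_ge0.
rewrite mulr_natl mulr2n; apply: lerD.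
  by apply: le_trans (Re_le_cabs _) _; exact: uM.
by apply: le_trans (Im_le_cabs _) _; exact: uM.
Qed.

Lemma prim_uniq u P Q a b : is_prim u P -> is_prim u Q -> -1 < a -> -1 < b ->
  P b - P a = Q b - Q a.
Proof.
move=> uP uQ; wlog ab : a b / a <= b => [H a1 b1|a1 b1].
  case: (leP a b) => [/H|/ltW/H]; first exact.
  by move=> /(_ b1 a1) h; rewrite -opprB h opprB.
have PQ : is_prim (fun t => u t + -1 * u t) (fun t => P t + -1 * Q t).
  by move=> t t1; apply: rderivD; [exact: uP|apply: rderivZ; exact: uQ].
have := @prim_bound _ _ a b 0 PQ a1 ab.
rewrite mulr0 mul0r => H.
apply/eqP; rewrite -subr_eq0 -cabs_eq0 eq_le cabs_ge0 andbT.
rewrite (_ : _ - _ = P b + -1 * Q b - (P a + -1 * Q a)); last by ring.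
by apply: H => t _; rewrite mulN1r subrr cabs0.
Qed.

Definition cint u a b :=
  let P := xget (fun=> 0) [set P | is_prim u P] in P b - P a.

Lemma cint_prim u P a b : is_prim u P -> -1 < a -> -1 < b ->
  cint u a b = P b - P a.
Proof.
move=> uP a1 b1; rewrite /cint; apply: (@prim_uniq u) => //.
exact: (@xgetPex _ (fun=> 0) [set P | is_prim u P] (ex_intro _ P uP)).
Qed.

Lemma cint_split u a b e : cint u a e = cint u a b + cint u b e.
Proof. by rewrite /cint /=; ring. Qed.

Lemma cint_bound u a b (M : R) : (forall t, continuous_at t u) ->
  -1 < a -> a <= b -> (forall t, a <= t <= b -> cabs (u t) <= M) ->
  cabs (cint u a b) <= 2 * M * (b - a).
Proof.
move=> cu a1 ab uM; have [P uP] := prim_ex cu.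
by rewrite (cint_prim uP)//; [exact: (prim_bound uP)|exact: lt_le_trans ab].
Qed.

Lemma cintD u v a b : (forall t, continuous_at t u) ->
  (forall t, continuous_at t v) -> -1 < a -> -1 < b ->
  cint (fun t => u t + v t) a b = cint u a b + cint v a b.
Proof.
move=> cu cv a1 b1; have [P uP] := prim_ex cu; have [Q vQ] := prim_ex cv.
rewrite (cint_prim uP)// (cint_prim vQ)//.
rewrite (@cint_prim _ (fun t => P t + Q t))//; last first.
  by move=> t t1; apply: rderivD; [exact: uP|exact: vQ].
by ring.
Qed.

Lemma cintZ u c a b : (forall t, continuous_at t u) -> -1 < a -> -1 < b ->
  cint (fun t => c * u t) a b = c * cint u a b.
Proof.
move=> cu a1 b1; have [P uP] := prim_ex cu.
rewrite (cint_prim uP)// (@cint_prim _ (fun t => c * P t))//; last first.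
  by move=> t t1; apply: rderivZ; exact: uP.
by rewrite mulrBr.
Qed.

Lemma eq_cint u v a b : u =1 v -> cint u a b = cint v a b.
Proof. by move=> /funext ->. Qed.

Lemma cint_Re u a b : (forall t, continuous_at t u) -> -1 < a -> a < b ->
  (\int[lebesgue_measure]_(t in `[a, b]) (complex.Re (u t))%:E =
   (complex.Re (cint u a b))%:E)%E.
Proof.
move=> cu a1 ab; have [P uP] := prim_ex cu.
rewrite (cint_prim uP)//; last exact: lt_trans ab.
have cP t : -1 < t -> continuous_at t (fun x => complex.Re (P x)).
  move=> /uP[[d _] _].
  exact/differentiable_continuous/derivable1_diffP.
rewrite (@continuous_FTC2 _ _ (fun x => complex.Re (P x)))//.
- by rewrite raddfB EFinB.
- by apply: continuous_subspaceT => x; apply: cont_Re; exact: cu.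
- split.
  + move=> x; rewrite in_itv/= => /andP[ax _].
    by have [[]] := uP x (lt_trans a1 ax).
  + by apply: cvg_at_right_filter; exact: cP.
  + by apply: cvg_at_left_filter; apply: cP; exact: lt_trans ab.
- move=> x; rewrite in_itv/= => /andP[ax _].
  by have [[d1 d2] _] := uP x (lt_trans a1 ax); rewrite derive1E.
Qed.

End ComplexIntegral.

Section CauchyFormula.
Context {R : realType}.
Implicit Types (s t : R) (z w : R[i]).

Definition expi t : R[i] := cos t +i* sin t.

Lemma cabs_expi t : cabs (expi t) = 1.
Proof. by rewrite cabsE /= cos2Dsin2 sqrtr1. Qed.

Lemma expi_2pi : expi (2 * pi) = expi 0.
Proof. by rewrite /expi mulr_natl cos2pi sin2pi cos0 sin0. Qed.

Lemma expi_conj t : conjc (expi t) = (expi t)^-1.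
Proof.
have e0 : expi t != 0 by rewrite -cabs_gt0 cabs_expi.
apply: (mulfI e0); rewrite mulfV//.
apply/eqP; rewrite eq_complex /= mulrN opprK -!expr2 cos2Dsin2 eqxx /=.
by apply/eqP; ring.
Qed.

Lemma expi_prim : is_prim (fun t => 'i%C * expi t) expi.
Proof.
move=> t _; split => /=; rewrite ?mul0r ?mul1r ?sub0r ?add0r.
  exact: is_derive_cos.
exact: is_derive_sin.
Qed.

Lemma contC_real (T : topologicalType) (u : T -> R) (p : T) :
  continuous_at p u -> continuous_at p (fun x => (u x)%:C).
Proof.
move=> /cont_atRP H; apply/cont_atP => e /H; apply: filterS => q.
by rewrite -rmorphB cabs_real.
Qed.

Lemma cont_expi t : continuous_at t expi.
Proof.
rewrite (_ : expi = fun x => (cos x)%:C + 'i%C * (sin x)%:C); last first.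
  apply/funext => x; apply/eqP.
  by rewrite eq_complex /=; apply/andP; split; apply/eqP; ring.
apply: contD; first by apply: contC_real; exact: continuous_cos.
apply: contM; first exact: cont_cst.
by apply: contC_real; exact: continuous_sin.
Qed.

Lemma cont_comp (T : topologicalType) (u : T -> R[i]) (f : R[i] -> R[i]) p :
  continuous_at p u -> continuous_at (u p) f ->
  continuous_at p (fun x => f (u x)).
Proof. by move=> cu cf; exact: (cvg_comp _ _ cu cf). Qed.

Definition circ0 (r : R) t : R[i] := r%:C * expi t.

Lemma cabs_circ0 (r : R) t : cabs (circ0 r t) = `|r|.
Proof. by rewrite cabsM cabs_expi mulr1 cabs_real. Qed.

Lemma cont_circ0 (r : R) t : continuous_at t (circ0 r).
Proof. by apply: contM; [exact: cont_cst|exact: cont_expi]. Qed.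

Definition lam s : R := expR (- (s ^+ 2)).

Lemma lam_gt0 s : 0 < lam s. Proof. exact: expR_gt0. Qed.

Lemma lam_le1 s : lam s <= 1.
Proof. by rewrite -expR0 ler_expR oppr_le0 sqr_ge0. Qed.

Lemma lam0 : lam 0 = 1.
Proof. by rewrite /lam expr0n oppr0 expR0. Qed.

Lemma lam_bound s : lam s * (1 + s ^+ 2) <= 1.
Proof.
rewrite /lam expRN mulrC ler_pdivrMr ?expR_gt0// mul1r.
exact: expR_ge1Dx.
Qed.

Lemma is_derive_lam s : is_derive s 1 lam (- (2 * s) * lam s).
Proof.
rewrite (_ : lam = expR \o (fun x => - x ^+ 2))//.
apply: is_derive_eq.
rewrite /= /lam /GRing.scale /=; ring.
Qed.

Lemma lam_prim :
  is_prim (fun s => (- (2 * s) * lam s)%:C) (fun s => (lam s)%:C).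
Proof.
by move=> s _; split => /=; [exact: is_derive_lam|exact: is_derive_cst].
Qed.

Lemma cont_lam s : continuous_at s lam.
Proof.
have [d _] := is_derive_lam s.
exact/differentiable_continuous/derivable1_diffP.
Qed.

Lemma prim_lipschitz (u P : R -> R[i]) (M : R) : is_prim u P ->
  (forall t, 0 <= t -> cabs (u t) <= M) ->
  forall t t', 0 <= t -> 0 <= t' -> cabs (P t - P t') <= 2 * M * `|t - t'|.
Proof.
move=> uP uM t t' t0 t'0; have gtN1 (x : R) : 0 <= x -> -1 < x by move=> ?; lra.
have [h|/ltW h] := leP t' t.
  rewrite ger0_norm ?subr_ge0//; apply: (prim_bound uP) => //; first exact: gtN1.
  by move=> x /andP[hx _]; apply: uM; exact: le_trans hx.
rewrite cabsB distrC ger0_norm ?subr_ge0//; apply: (prim_bound uP) => //.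
  exact: gtN1.
by move=> x /andP[hx _]; apply: uM; exact: le_trans hx.
Qed.

Let rect_arith (s k m a b : R) : 0 <= s -> 0 <= k -> 0 <= m -> 0 <= a ->
  0 <= b -> 2 * (2 * (s + 1) * m) * a + 2 * (2 * (s + 1) * m) * a +
    (2 * (k * m) * b + 2 * (k * m) * b) <= 4 * (2 * (s + 1) + k) * m * (a + b).
Proof.
move=> s0 k0 m0 a0 b0.
have h1 : 0 <= k * m * a by rewrite !mulr_ge0.
have h2 : 0 <= s * m * b by rewrite !mulr_ge0.
have h3 : 0 <= m * b by rewrite !mulr_ge0.
lra.
Qed.

Variables (f : R[i] -> R[i]) (r : R) (h : R[i]).
Hypotheses (r0 : 0 < r) (hr : cabs h < r).
Hypothesis df : forall w, cabs w <= r -> cdiff f w.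

Local Notation gam := (circ0 r).

(* [homot s] deforms the circle into the centre [h] as [s] goes to infinity; the
   form [f dz / (z - h)] pulls back to [pform ds + qform dt]. *)
Definition kap t : R[i] := 'i%C * (gam t / (gam t - h)).
Definition homot s t := h + (lam s)%:C * (gam t - h).
Definition pform s t := (- (2 * s))%:C * f (homot s t).
Definition qform s t := kap t * f (homot s t).
Local Notation H := homot.
Local Notation P := pform.
Local Notation Q := qform.

Let cabs_gam t : cabs (gam t) = r.
Proof. by rewrite cabs_circ0 gtr0_norm. Qed.

Let gamh_ge t : r - cabs h <= cabs (gam t - h).
Proof. by rewrite -{1}(cabs_gam t); exact: cabs_lowB. Qed.

Let gamh_neq0 t : gam t - h != 0.
Proof.
by rewrite -cabs_gt0; apply: lt_le_trans (gamh_ge t); rewrite subr_gt0.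
Qed.

Let gamh_le t : cabs (gam t - h) <= 2 * r.
Proof.
by apply: le_trans (cabsDB _ _) _; rewrite cabs_gam; move: hr; lra.
Qed.

Let H_in s t : cabs (H s t) <= r.
Proof.
rewrite (_ : H s t = (1 - lam s)%:C * h + (lam s)%:C * gam t); last first.
  by rewrite /H rmorphB rmorph1; ring.
apply: le_trans (cabsD _ _) _; rewrite (cabsM _ h) (cabsM _ (gam t)) !cabs_real cabs_gam.
have l0 := lam_gt0 s; have l1 := lam_le1 s.
rewrite (ger0_norm (ltW l0)) ger0_norm ?subr_ge0//.
have := @ler_wpM2l _ (1 - lam s) _ _ _ (ltW hr); rewrite subr_ge0 => /(_ l1).
lra.
Qed.

Let cont_gamh t : continuous_at t (fun t => gam t - h).
Proof. by apply: contB; [exact: cont_circ0|exact: cont_cst]. Qed.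

Let cont_kap t : continuous_at t kap.
Proof.
apply: contM; first exact: cont_cst.
apply: contM; first exact: cont_circ0.
by apply: contV; [exact: gamh_neq0|exact: cont_gamh].
Qed.

Let cont_Hs t s : continuous_at s (fun s => H s t).
Proof.
apply: contD; first exact: cont_cst.
by apply: contM; [apply: contC_real; exact: cont_lam|exact: cont_cst].
Qed.

Let cont_Ht s t : continuous_at t (H s).
Proof.
apply: contD; first exact: cont_cst.
by apply: contM; [exact: cont_cst|exact: cont_gamh].
Qed.

Let cont_N2 s : continuous_at s (fun s => (- (2 * s))%:C : R[i]).
Proof.
apply: contC_real; apply: (@cvgN _ R^o); apply: (@cvgMr R).
exact: cvg_id.
Qed.

Let kap_le t : cabs (kap t) <= r / (r - cabs h).
Proof.
have rh : 0 < r - cabs h by rewrite subr_gt0.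
rewrite /kap cabsM (_ : cabs 'i%C = 1) ?mul1r; last first.
  by rewrite cabsE /= expr0n expr1n add0r sqrtr1.
rewrite cabsM cabsV cabs_gam ler_pM2l// lef_pV2 ?posrE//.
exact: lt_le_trans (gamh_ge t).
Qed.

Let lam_lip s s' : 0 <= s -> 0 <= s' -> `|lam s - lam s'| <= 4 * `|s - s'|.
Proof.
move=> s0 s'0; have := @prim_lipschitz _ _ 2 lam_prim _ s s' s0 s'0.
rewrite -rmorphB cabs_real (_ : 2 * 2 = 4)//; last by rewrite -natrM.
apply => x x0; have l0 := lam_gt0 x; have lb := lam_bound x.
have h1 : 0 <= lam x * (1 + x ^+ 2 - x).
  by rewrite mulr_ge0 ?(ltW l0)//; nra.
rewrite cabs_real mulNr normrN ger0_norm; last by rewrite !mulr_ge0// ltW.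
lra.
Qed.

Let gam_prim : is_prim (fun t => 'i%C * gam t) gam.
Proof.
move=> t t1; have -> : 'i%C * gam t = r%:C * ('i%C * expi t).
  by rewrite /circ0; ring.
by apply: rderivZ; exact: expi_prim.
Qed.

Let gam_lip t t' : 0 <= t -> 0 <= t' -> cabs (gam t - gam t') <= 2 * r * `|t - t'|.
Proof.
move=> t0 t'0; apply: (prim_lipschitz gam_prim) => // x x0.
by rewrite cabsM cabs_gam cabsE /= expr0n expr1n add0r sqrtr1 mul1r.
Qed.

Let H_lip s t s' t' : 0 <= s -> 0 <= s' -> 0 <= t -> 0 <= t' ->
  cabs (H s t - H s' t') <= 8 * r * (`|s - s'| + `|t - t'|).
Proof.
move=> s0 s'0 t0 t'0.
have -> : H s t - H s' t' =
    (lam s - lam s')%:C * (gam t - h) + (lam s')%:C * (gam t - gam t').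
  by rewrite /H rmorphB; ring.
apply: le_trans (cabsD _ _) _.
rewrite (cabsM _ (gam t - h)) (cabsM _ (gam t - gam t')) !cabs_real.
have h1 : `|lam s - lam s'| * cabs (gam t - h) <= 4 * `|s - s'| * (2 * r).
  by apply: ler_pM; rewrite ?cabs_ge0 ?gamh_le//; exact: lam_lip.
have h2 : `|lam s'| * cabs (gam t - gam t') <= 1 * (2 * r * `|t - t'|).
  apply: ler_pM; rewrite ?cabs_ge0//; last exact: gam_lip.
  by rewrite gtr0_norm ?lam_gt0// lam_le1.
have h3 : 0 <= r * `|t - t'| by rewrite mulr_ge0// ltW.
lra.
Qed.

Definition cauchy_rect s1 s2 t1 t2 :=
  cint (P^~ t2) s1 s2 - cint (P^~ t1) s1 s2 -
  (cint (Q s2) t1 t2 - cint (Q s1) t1 t2).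

Let affP A d t : is_prim
  (fun s => (- (2 * s))%:C * (A + d * ((lam s)%:C * (gam t - h))))
  (fun s => A * (- s ^+ 2)%:C + d * (gam t - h) * (lam s)%:C).
Proof.
move=> x x1.
have -> : (- (2 * x))%:C * (A + d * ((lam x)%:C * (gam t - h))) =
  A * (- (2 * x))%:C + d * (gam t - h) * (- (2 * x) * lam x)%:C.
  by rewrite rmorphM; ring.
apply: rderivD; apply: rderivZ; last exact: lam_prim.
split; last exact: is_derive_cst.
by apply: is_derive_eq; rewrite /= /GRing.scale /=; ring.
Qed.

Let cont_affs A d t s :
  continuous_at s (fun s => A + d * ((lam s)%:C * (gam t - h))).
Proof.
apply: contD; first exact: cont_cst.
apply: contM; first exact: cont_cst.
by apply: contM; [apply: contC_real; exact: cont_lam|exact: cont_cst].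
Qed.

Let cont_afft A d s t :
  continuous_at t (fun t => A + d * ((lam s)%:C * (gam t - h))).
Proof.
apply: contD; first exact: cont_cst.
apply: contM; first exact: cont_cst.
by apply: contM; [exact: cont_cst|exact: cont_gamh].
Qed.

Let cont_rhos A d t s : continuous_at s (fun s => (- (2 * s))%:C *
  (f (H s t) - (A + d * ((lam s)%:C * (gam t - h))))).
Proof.
apply: contM; first exact: cont_N2.
apply: contB; last exact: cont_affs.
apply: cont_comp; first exact: cont_Hs.
by apply: cdiff_cont; apply: df; exact: H_in.
Qed.

Let cont_rhot A d s t : continuous_at t (fun t => kap t *
  (f (H s t) - (A + d * ((lam s)%:C * (gam t - h))))).
Proof.
apply: contM; first exact: cont_kap.
apply: contB; last exact: cont_afft.
apply: cont_comp; first exact: cont_Ht.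
by apply: cdiff_cont; apply: df; exact: H_in.
Qed.

Let rect_split A d s1 s2 t1 t2 (rho := fun s t =>
    f (H s t) - (A + d * ((lam s)%:C * (gam t - h)))) :
  0 <= s1 -> s1 <= s2 -> 0 <= t1 -> t1 <= t2 ->
  cauchy_rect s1 s2 t1 t2 =
    cint (fun s => (- (2 * s))%:C * rho s t2) s1 s2 -
    cint (fun s => (- (2 * s))%:C * rho s t1) s1 s2 -
    (cint (fun t => kap t * rho s2 t) t1 t2 -
     cint (fun t => kap t * rho s1 t) t1 t2).
Proof.
move=> s10 s12 t10 t12.
have s11 : -1 < s1 by lra. have s21 : -1 < s2 by lra.
have t11 : -1 < t1 by lra. have t21 : -1 < t2 by lra.
have [K HK] := prim_ex cont_kap.
have EP t : cint (P^~ t) s1 s2 =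
    (A * (- s2 ^+ 2)%:C + d * (gam t - h) * (lam s2)%:C) -
    (A * (- s1 ^+ 2)%:C + d * (gam t - h) * (lam s1)%:C) +
    cint (fun s => (- (2 * s))%:C * rho s t) s1 s2.
  have c1 s : continuous_at s
      (fun s => (- (2 * s))%:C * (A + d * ((lam s)%:C * (gam t - h)))).
    by apply: contM; [exact: cont_N2|exact: cont_affs].
  rewrite -(cint_prim (@affP A d t) s11 s21) -(cintD c1 (@cont_rhos A d t) s11 s21).
  by apply: eq_cint => s; rewrite /P /rho; ring.
have EQ s : cint (Q s) t1 t2 =
    (A * K t2 + d * (lam s)%:C * gam t2) -
    (A * K t1 + d * (lam s)%:C * gam t1) +
    cint (fun t => kap t * rho s t) t1 t2.
  have pr : is_prim (fun t => kap t * (A + d * ((lam s)%:C * (gam t - h))))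
      (fun t => A * K t + d * (lam s)%:C * gam t).
    move=> t t1'.
    have -> : kap t * (A + d * ((lam s)%:C * (gam t - h))) =
        A * kap t + d * (lam s)%:C * ('i%C * gam t).
      by rewrite /kap; field; exact: gamh_neq0.
    by apply: rderivD; apply: rderivZ; [exact: HK|exact: gam_prim].
  have c1 t : continuous_at t
      (fun t => kap t * (A + d * ((lam s)%:C * (gam t - h)))).
    by apply: contM; [exact: cont_kap|exact: cont_afft].
  rewrite -(cint_prim pr t11 t21) -(cintD c1 (@cont_rhot A d s) t11 t21).
  by apply: eq_cint => t; rewrite /Q /rho; ring.
rewrite /cauchy_rect !EP !EQ.
set I1 := cint _ s1 s2; set I2 := cint _ s1 s2.
set I3 := cint _ t1 t2; set I4 := cint _ t1 t2.
move: I1 I2 I3 I4 (lam s1)%:C (lam s2)%:C (- s1 ^+ 2)%:C (- s2 ^+ 2)%:C.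
by move: (gam t1) (gam t2) (K t1) (K t2) => *; ring.
Qed.

Let rect_loc s0 t0 : 0 <= s0 -> 0 <= t0 -> forall e : R, 0 < e ->
  exists2 rr : R, 0 < rr & forall s1 s2 t1 t2,
    0 <= s1 <= s0 -> s0 <= s2 -> 0 <= t1 <= t0 -> t0 <= t2 ->
    s2 - s1 < rr -> t2 - t1 < rr ->
    cabs (cauchy_rect s1 s2 t1 t2) <= e * ((s2 - s1) + (t2 - t1)) ^+ 2.
Proof.
move=> s00 t00 e e0; have rp := r0.
have [d /has_cderivP dH] := df (H_in s0 t0).
have rh : 0 < r - cabs h by rewrite subr_gt0.
have [k [k0 kE]] : exists k : R, 0 <= k /\ k = r / (r - cabs h).
  by eexists; split; last reflexivity; rewrite ltW// divr_gt0.
have [C [C0 CE]] : exists C : R, 0 <= C /\ C = 32 * r * (2 * (s0 + 1) + k).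
  have h1 : 0 <= 2 * (s0 + 1) + k by lra.
  have h2 : 0 <= 32 * r by rewrite mulr_ge0// ltW.
  by exists (32 * r * (2 * (s0 + 1) + k)); split; [exact: mulr_ge0|].
have eta0 : 0 < e / (C + 1) by rewrite divr_gt0//; lra.
have [del del0 {}dH] := dH _ eta0.
set A := f (H s0 t0) + d * (h - H s0 t0).
exists (Num.min 1 (del / (16 * r + 1))).
  by rewrite lt_min ltr01 divr_gt0//; lra.
move=> s1 s2 t1 t2 /andP[s10 s1s0] s0s2 /andP[t10 t1t0] t0t2.
rewrite !lt_min => /andP[s121 s12d] /andP[t121 t12d].
have [sg sgE] : exists sg : R, sg = (s2 - s1) + (t2 - t1) by eexists.
rewrite -sgE.
have sgd : 8 * r * sg < del.
  move: s12d t12d; rewrite !ltr_pdivlMr; try lra.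
  rewrite sgE; nra.
have sg0 : 0 <= sg by rewrite sgE; lra.
have rhob s t : s1 <= s <= s2 -> t1 <= t <= t2 ->
    cabs (f (H s t) - (A + d * ((lam s)%:C * (gam t - h)))) <=
    e / (C + 1) * (8 * r * sg).
  move=> /andP[hs1 hs2] /andP[ht1 ht2].
  have hl : cabs (H s t - H s0 t0) <= 8 * r * sg.
    apply: le_trans (H_lip (le_trans s10 hs1) s00 (le_trans t10 ht1) t00) _.
    apply: ler_wpM2l; first lra.
    by rewrite sgE; apply: lerD; rewrite ler_norml; apply/andP; split; lra.
  have -> : f (H s t) - (A + d * ((lam s)%:C * (gam t - h))) =
      f (H s t) - f (H s0 t0) - d * (H s t - H s0 t0).
    by rewrite /A /H; ring.
  apply: le_trans (dH _ (le_lt_trans hl sgd)) _.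
  by apply: ler_wpM2l => //; exact: ltW.
have s12 : s1 <= s2 by lra.
have t12 : t1 <= t2 by lra.
rewrite (rect_split A d s10 s12 t10 t12).
set m := e / (C + 1) * (8 * r * sg) in rhob.
have m0 : 0 <= m.
  by rewrite /m mulr_ge0 ?(ltW eta0)//; rewrite !mulr_ge0// ltW.
have bs t : t1 <= t <= t2 -> cabs (cint (fun s => (- (2 * s))%:C *
    (f (H s t) - (A + d * ((lam s)%:C * (gam t - h))))) s1 s2) <=
    2 * (2 * (s0 + 1) * m) * (s2 - s1).
  move=> ht; apply: (cint_bound (@cont_rhos A d t)); [lra|exact: s12|].
  move=> s hs; rewrite cabsM; apply: ler_pM; rewrite ?cabs_ge0//.
    by move/andP: hs => [hs1 hs2]; rewrite cabs_real normrN ger0_norm; lra.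
  exact: rhob.
have bt s : s1 <= s <= s2 -> cabs (cint (fun t => kap t *
    (f (H s t) - (A + d * ((lam s)%:C * (gam t - h))))) t1 t2) <=
    2 * (k * m) * (t2 - t1).
  move=> hs; apply: (cint_bound (@cont_rhot A d s)); [lra|exact: t12|].
  move=> t ht; rewrite cabsM; apply: ler_pM; rewrite ?cabs_ge0//.
    by rewrite kE; exact: kap_le.
  exact: rhob.
apply: le_trans (cabsDB _ _) _; apply: le_trans (lerD (cabsDB _ _) (cabsDB _ _)) _.
have b1 := bs t1; have b2 := bs t2; have b3 := bt s1; have b4 := bt s2.
rewrite !lexx s12 t12 /= in b1 b2 b3 b4.
apply: le_trans (lerD (lerD (b2 isT) (b1 isT)) (lerD (b4 isT) (b3 isT))) _.
apply: (@le_trans _ _ (4 * (2 * (s0 + 1) + k) * m * sg)).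
  rewrite sgE; have a0 : 0 <= s2 - s1 by rewrite subr_ge0.
  have b0 : 0 <= t2 - t1 by rewrite subr_ge0.
  exact: rect_arith.
have -> : 4 * (2 * (s0 + 1) + k) * m * sg = e * sg ^+ 2 * (C / (C + 1)).
  by rewrite {1}CE /m; ring.
rewrite -[leRHS]mulr1; apply: ler_wpM2l; first by rewrite mulr_ge0 ?sqr_ge0 ?ltW.
by rewrite ler_pdivrMr ?mul1r ?lerDl// ltr_wpDl.
Qed.

Let rect_eq0 s1 s2 t1 t2 : 0 <= s1 <= s2 -> 0 <= t1 <= t2 ->
  cauchy_rect s1 s2 t1 t2 = 0.
Proof.
apply: rect_additive_eq0; last exact: rect_loc.
- move=> a b c x y; rewrite /cauchy_rect (@cint_split _ (P^~ y) a b c).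
  rewrite (@cint_split _ (P^~ x) a b c).
  by do !(move: (cint _ _ _) => ?); ring.
- move=> a b x y z; rewrite /cauchy_rect (@cint_split _ (Q b) x y z).
  rewrite (@cint_split _ (Q a) x y z).
  by do !(move: (cint _ _ _) => ?); ring.
Qed.

Let pi2_gt0 : 0 < 2 * pi :> R.
Proof. by rewrite mulr_gt0// pi_gt0. Qed.

Let hom S : 0 <= S -> cint (Q S) 0 (2 * pi) = cint (Q 0) 0 (2 * pi).
Proof.
move=> S0; have := @rect_eq0 0 S 0 (2 * pi); rewrite !lexx S0 (ltW pi2_gt0).
move=> /(_ isT isT); rewrite /cauchy_rect.
have -> : P^~ (2 * pi) = P^~ 0.
  by apply/funext => s; rewrite /P /H /circ0 expi_2pi.
by rewrite subrr sub0r => /eqP; rewrite oppr_eq0 subr_eq0 => /eqP.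
Qed.

Lemma cauchy_kap :
  cint (fun t => kap t * f (gam t)) 0 (2 * pi) = f h * cint kap 0 (2 * pi).
Proof.
have -> : (fun t => kap t * f (gam t)) = Q 0.
  apply/funext => t; rewrite /Q /H lam0 mul1r.
  by rewrite addrC subrK.
have N10 : -1 < 0 :> R by rewrite ltrN10.
have N1pi : -1 < 2 * pi :> R by exact: lt_trans pi2_gt0.
have p0 := pi2_gt0.
apply/eqP; rewrite -subr_eq0; apply: contraT; rewrite -cabs_gt0.
set D := cabs _ => D0.
have rh : 0 < r - cabs h by rewrite subr_gt0.
have [k [k0 kE]] : exists k : R, 0 <= k /\ k = r / (r - cabs h).
  by eexists; split; last reflexivity; rewrite ltW// divr_gt0.
have [e [e0 eD]] : exists e : R, 0 < e /\ 2 * (k * e) * (2 * pi - 0) < D.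
  have X0 : 0 <= 2 * k * (2 * pi) by rewrite !mulr_ge0// ltW// pi_gt0.
  have X1 : 0 < 2 * k * (2 * pi) + 1 by rewrite ltr_wpDl.
  exists (D / (2 * k * (2 * pi) + 1)); split; first by rewrite divr_gt0.
  rewrite subr0 (_ : _ * _ * _ = D * ((2 * k * (2 * pi)) / (2 * k * (2 * pi) + 1))).
    by rewrite -[ltRHS]mulr1 ltr_pM2l// ltr_pdivrMr// mul1r ltrDl.
  by ring.
have dfh : cdiff f h by apply: df; exact: ltW.
have /contP /(_ _ e0)[d d0 fd] := cdiff_cont dfh.
have [S S0 lamS] : exists2 S : R, 0 <= S & lam S * (2 * r) < d.
  exists (2 * r / d); first by rewrite divr_ge0// ?ltW// mulr_gt0.
  have x0 : 0 < 2 * r / d by rewrite divr_gt0// mulr_gt0.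
  have b := lam_bound (2 * r / d).
  have l0 := lam_gt0 (2 * r / d).
  have rE : 2 * r = d * (2 * r / d) by rewrite [RHS]mulrC divfK// gt_eqF.
  rewrite [X in _ * X]rE mulrCA gtr_pMr//; apply: lt_le_trans b.
  by rewrite ltr_pM2l//; move: (2 * r / d) x0 => x x0; nra.
have : D <= 2 * (k * e) * (2 * pi - 0).
  rewrite /D -(hom S0) -(cintZ (f h) cont_kap N10 N1pi).
  have c1 t : continuous_at t (fun t => kap t * (f (H S t) - f h)).
    apply: contM; first exact: cont_kap.
    apply: contB; last exact: cont_cst.
    apply: cont_comp; first exact: cont_Ht.
    by apply: cdiff_cont; apply: df; exact: H_in.
  have c2 t : continuous_at t (fun t => f h * kap t).
    by apply: contM; [exact: cont_cst|exact: cont_kap].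
  have -> : cint (Q S) 0 (2 * pi) =
     cint (fun t => kap t * (f (H S t) - f h)) 0 (2 * pi) +
     cint (fun t => f h * kap t) 0 (2 * pi).
    by rewrite -(cintD c1 c2 N10 N1pi); apply: eq_cint => t; rewrite /Q; ring.
  rewrite addrK; apply: (cint_bound c1 N10 (ltW pi2_gt0)) => t _.
  rewrite cabsM; apply: ler_pM; rewrite ?cabs_ge0//; first by rewrite kE kap_le.
  apply: ltW; apply: fd; apply: le_lt_trans lamS.
  rewrite (_ : H S t - h = (lam S)%:C * (gam t - h)); last by rewrite /H; ring.
  rewrite (cabsM _ (gam t - h)) cabs_real gtr0_norm ?lam_gt0//.
  by rewrite ler_pM2l ?lam_gt0.
by rewrite leNgt eD.
Qed.

End CauchyFormula.

Section CauchyConsequences.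
Context {R : realType}.
Implicit Types (f g : R[i] -> R[i]) (r rho M t : R) (z w h : R[i]).

Let pi2_gt0 : 0 < 2 * pi :> R.
Proof. by rewrite mulr_gt0// pi_gt0. Qed.

Let N10 : -1 < 0 :> R. Proof. by rewrite ltrN10. Qed.

Let N1pi : -1 < 2 * pi :> R. Proof. exact: lt_trans pi2_gt0. Qed.

Lemma cint_cst c : cint (fun=> c) 0 (2 * pi) = (2 * pi)%:C * c :> R[i].
Proof.
have H : is_prim (fun=> c) (fun t : R => c * t%:C).
  move=> t _; have := @rderivZ _ (fun t => t%:C) t 1 c; rewrite mulr1; apply.
  by split => /=; [exact: is_derive_id|exact: is_derive_cst].
by rewrite (cint_prim H N10 N1pi); ring.
Qed.

Lemma cint_conj (u : R -> R[i]) : (forall t, continuous_at t u) ->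
  cint (fun t => conjc (u t)) 0 (2 * pi) = conjc (cint u 0 (2 * pi)).
Proof.
move=> /prim_ex[P HP]; rewrite (cint_prim HP N10 N1pi) rmorphB.
apply: (@cint_prim _ _ (fun t => conjc (P t))) => // t /HP[].
case: (u t) => a b /= H1 H2; split => /=.
  rewrite (_ : (fun x => complex.Re (conjc (P x))) = fun x => complex.Re (P x))//.
  by apply/funext => x; case: (P x).
rewrite (_ : (fun x => complex.Im (conjc (P x))) = - (fun x => complex.Im (P x))).
  exact: is_deriveN.
by apply/funext => x; rewrite [RHS]/(- complex.Im (P x)); case: (P x).
Qed.

Lemma mean_value0 f r : 0 < r -> (forall w, cabs w <= r -> cdiff f w) ->
  cint (fun t => f (circ0 r t)) 0 (2 * pi) = (2 * pi)%:C * f 0.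
Proof.
move=> r0 df; have h0 : cabs (0 : R[i]) < r by rewrite cabs0.
have := cauchy_kap r0 h0 df.
have kE t : kap r 0 t = 'i%C.
  rewrite /kap subr0 divff ?mulr1//.
  by rewrite -cabs_gt0 cabs_circ0 gtr0_norm.
have -> : kap r 0 = fun=> 'i%C by apply/funext.
rewrite cint_cst cintZ//; last first.
  move=> t; apply: cont_comp; first exact: cont_circ0.
  by apply: cdiff_cont; apply: df; rewrite cabs_circ0 gtr0_norm.
move=> H; apply: (@mulfI _ ('i%C : R[i])).
  by rewrite eq_complex /= oner_eq0 andbF.
by rewrite H; ring.
Qed.

Lemma circ0_sub_neq0 r h t : cabs h < r -> circ0 r t - h != 0.
Proof.
move=> hr; rewrite -cabs_gt0; apply: lt_le_trans (cabs_lowB _ _).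
rewrite cabs_circ0 ger0_norm ?subr_gt0//.
by apply: le_trans (ltW hr); exact: cabs_ge0.
Qed.

Lemma cont_circ0_sub r h t : continuous_at t (fun t => circ0 r t - h).
Proof. by apply: contB; [exact: cont_circ0|exact: cont_cst]. Qed.

Lemma cint_kernel r h : 0 < r -> cabs h < r ->
  cint (fun t => circ0 r t / (circ0 r t - h)) 0 (2 * pi) = (2 * pi)%:C.
Proof.
move=> r0 hr.
have conjM (x y : R[i]) : conjc (x * y) = conjc x * conjc y by exact: (rmorphM (@conjc R)).
have conjB (x y : R[i]) : conjc (x - y) = conjc x - conjc y by exact: (rmorphB (@conjc R)).
have conjV (x : R[i]) : conjc x^-1 = (conjc x)^-1 by exact: conjc_inv.
pose D z : R[i] := (r ^+ 2)%:C - conjc h * z.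
pose g z := (r ^+ 2)%:C / D z.
have D0 z : cabs z <= r -> D z != 0.
  move=> zr; rewrite -cabs_gt0; apply: lt_le_trans (cabs_lowB _ _).
  rewrite cabs_real cabsM cabs_conj ger0_norm ?sqr_ge0// subr_gt0 expr2.
  apply: (@le_lt_trans _ _ (cabs h * r)); last by rewrite ltr_pM2r.
  by rewrite ler_wpM2l// cabs_ge0.
have dg z : cabs z <= r -> cdiff g z.
  move=> zr; apply: cdiff_div; [exact: D0|exact: cdiff_cst|].
  apply: cdiffB; first exact: cdiff_cst.
  by apply: cdiffM; [exact: cdiff_cst|exact: cdiff_id].
have cg : cabs (circ0 r _) <= r by move=> t; rewrite cabs_circ0 gtr0_norm.
have cont t : continuous_at t (fun t => g (circ0 r t)).
  apply: cont_comp; first exact: cont_circ0.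
  by apply: cdiff_cont; apply: dg; exact: cg.
have -> : (fun t => circ0 r t / (circ0 r t - h)) = fun t => conjc (g (circ0 r t)).
  apply/funext => t; have e0 : expi t != 0 by rewrite -cabs_gt0 cabs_expi.
  have rC : r%:C != 0 by rewrite eq_complex /= eqxx andbT gt_eqF.
  have ch : circ0 r t - h != 0 by exact: circ0_sub_neq0.
  have -> : conjc (g (circ0 r t)) = (r ^+ 2)%:C / ((r ^+ 2)%:C - h * conjc (circ0 r t)).
    by rewrite /g (conjM (r ^+ 2)%:C) conjV conjB (conjM (conjc h)) conjcK !conjc_real.
  rewrite /circ0 conjM conjc_real expi_conj rmorphXn /=.
  move: ch; rewrite /circ0 => ch.
  have -> : r%:C ^+ 2 - h * (r%:C / expi t) =
    r%:C / expi t * (r%:C * expi t - h) by field.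
  by field; rewrite ch e0 rC.
rewrite (cint_conj cont) (mean_value0 r0 dg) /g /D mulr0 subr0 divff.
  by rewrite mulr1 conjc_real.
by rewrite eq_complex /= eqxx andbT expf_neq0// gt_eqF.
Qed.

Lemma cauchy_formula0 f r h : 0 < r -> cabs h < r ->
  (forall w, cabs w <= r -> cdiff f w) ->
  cint (fun t => f (circ0 r t) * (circ0 r t / (circ0 r t - h))) 0 (2 * pi) =
  (2 * pi)%:C * f h.
Proof.
move=> r0 hr df.
have ck t : continuous_at t (fun t => circ0 r t / (circ0 r t - h)).
  apply: contM; first exact: cont_circ0.
  by apply: contV; [exact: circ0_sub_neq0|exact: cont_circ0_sub].
have cf t : continuous_at t
    (fun t => f (circ0 r t) * (circ0 r t / (circ0 r t - h))).
  apply: contM; last exact: ck.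
  apply: cont_comp; first exact: cont_circ0.
  by apply: cdiff_cont; apply: df; rewrite cabs_circ0 gtr0_norm.
have i0 : 'i%C != 0 :> R[i] by rewrite eq_complex /= oner_eq0 andbF.
have := cauchy_kap r0 hr df; rewrite (cintZ _ ck N10 N1pi) (cint_kernel r0 hr).
rewrite (_ : (fun t => kap r h t * f (circ0 r t)) = fun t =>
  'i%C * (f (circ0 r t) * (circ0 r t / (circ0 r t - h)))); last first.
  by apply/funext => t; rewrite /kap; ring.
by rewrite (cintZ _ cf N10 N1pi) mulrCA => /(mulfI i0) ->; rewrite mulrC.
Qed.

Let pi2_neq0 : (2 * pi)%:C != 0 :> R[i].
Proof. by rewrite eq_complex /= eqxx andbT gt_eqF. Qed.

Lemma cdiff_translate f z w : cdiff f (z + w) -> cdiff (fun x => f (z + x)) w.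
Proof.
apply: cdiff_comp; apply: cdiffD; [exact: cdiff_cst|exact: cdiff_id].
Qed.

Lemma mean_value f z r : 0 < r ->
  (forall w, cabs (w - z) <= r -> cdiff f w) ->
  cint (fun t => f (circle z r t)) 0 (2 * pi) = (2 * pi)%:C * f z.
Proof.
move=> r0 df; have := @mean_value0 (fun x => f (z + x)) r r0.
rewrite addr0; apply => w wr; apply: cdiff_translate; apply: df.
by rewrite addrC addKr.
Qed.

Lemma max_bound f z r M : 0 < r ->
  (forall w, cabs (w - z) <= r -> cdiff f w) ->
  (forall t, 0 <= t <= 2 * pi -> cabs (f (z + circ0 r t)) <= M) ->
  forall w, cabs (w - z) <= r / 2 -> cabs (f w) <= 4 * M.
Proof.
move=> r0 df fM w wr; set h := w - z in wr.
have hr : cabs h < r by lra.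
have df0 x : cabs x <= r -> cdiff (fun x => f (z + x)) x.
  by move=> xr; apply: cdiff_translate; apply: df; rewrite addrC addKr.
have M0 : 0 <= M.
  by apply: le_trans (cabs_ge0 (f (z + circ0 r 0))) (fM _ _); rewrite lexx ltW.
have := cauchy_formula0 r0 hr df0; rewrite {2}/h (addrC z) subrK => E.
have ck t : continuous_at t
    (fun t => f (z + circ0 r t) * (circ0 r t / (circ0 r t - h))).
  apply: contM.
    apply: (@cont_comp _ _ (circ0 r) (fun x => f (z + x))); first exact: cont_circ0.
    by apply: cdiff_cont; apply: df0; rewrite cabs_circ0 gtr0_norm.
  apply: contM; first exact: cont_circ0.
  by apply: contV; [exact: circ0_sub_neq0|exact: cont_circ0_sub].
have := @cint_bound _ _ 0 (2 * pi) (M * 2) ck N10 (ltW pi2_gt0).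
rewrite E cabsM cabs_real gtr0_norm// subr0 => H.
have := H _; rewrite [leRHS]mulrC ler_pM2l// (_ : 2 * (M * 2) = 4 * M); last by ring.
apply => t ht; rewrite cabsM; apply: ler_pM; rewrite ?cabs_ge0//.
  exact: fM.
have d0 : 0 < cabs (circ0 r t - h) by rewrite cabs_gt0 circ0_sub_neq0.
rewrite cabsM cabsV ler_pdivrMr// cabs_circ0 gtr0_norm//.
have := cabs_lowB (circ0 r t) h; rewrite cabs_circ0 gtr0_norm//; lra.
Qed.

Lemma circle_bound f z r : 0 < r -> (forall w, cabs (w - z) <= r -> cdiff f w) ->
  exists M, 0 <= M /\
    forall t, 0 <= t <= 2 * pi -> cabs (f (z + circ0 r t)) <= M.
Proof.
move=> r0 df.
have cc : {within `[0, 2 * pi], continuous (fun t => cabs (f (z + circ0 r t)))}.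
  apply: continuous_subspaceT => t.
  have cf : continuous_at t (fun t => f (z + circ0 r t)).
    apply: (@cont_comp _ _ (circ0 r) (fun x => f (z + x))); first exact: cont_circ0.
    apply: cdiff_cont; apply: cdiff_translate; apply: df.
    by rewrite addrC addKr cabs_circ0 gtr0_norm.
  apply/cont_atRP => e e0; move/cont_atP/(_ _ e0): cf; apply: filterS => s.
  apply: le_lt_trans; rewrite ler_norml; apply/andP; split.
    by rewrite lerNl opprB cabsB; exact: cabs_lowB.
  exact: cabs_lowB.
have [c _ Hc] := EVT_max (ltW pi2_gt0) cc.
by exists (cabs (f (z + circ0 r c))); split=> [|t ht];
  [exact: cabs_ge0|exact: Hc].
Qed.

Lemma taylor3 f z rho : 0 < rho -> holo_ball f z rho ->
  exists A1 A2 C r, [/\ 0 <= C, 0 < r & forall h, cabs h < r ->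
    cabs (f (z + h) - f z - A1 * h - A2 * h ^+ 2) <= C * cabs h ^+ 3].
Proof.
move=> rho0 df; set r := rho / 2.
have r0 : 0 < r by rewrite divr_gt0.
have df0 x : cabs x <= r -> cdiff (fun x => f (z + x)) x.
  move=> xr; apply: cdiff_translate; apply: df; rewrite addrC addKr.
  by apply: le_lt_trans xr _; rewrite /r; lra.
pose F t := f (z + circ0 r t).
have g0 t : circ0 r t != 0.
  by have := @circ0_sub_neq0 r 0 t; rewrite subr0 cabs0; exact.
have cF t : continuous_at t F.
  apply: (@cont_comp _ _ (circ0 r) (fun x => f (z + x))); first exact: cont_circ0.
  by apply: cdiff_cont; apply: df0; rewrite cabs_circ0 gtr0_norm.
have cV t : continuous_at t (fun t => (circ0 r t)^-1).
  by apply: contV; [exact: g0|exact: cont_circ0].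
pose F1 t := F t * (circ0 r t)^-1.
pose F2 t := F1 t * (circ0 r t)^-1.
pose F3 h t := F2 t * (circ0 r t - h)^-1.
have c1 t : continuous_at t F1 by apply: contM; [exact: cF|exact: cV].
have c2 t : continuous_at t F2 by apply: contM; [exact: c1|exact: cV].
have c3 h : cabs h < r -> forall t, continuous_at t (F3 h).
  move=> hr t; apply: contM; first exact: c2.
  by apply: contV; [exact: circ0_sub_neq0|exact: cont_circ0_sub].
pose T (u : R -> R[i]) := cint u 0 (2 * pi) / (2 * pi)%:C.
have E h : cabs h < r ->
    f (z + h) = T F + h * T F1 + h ^+ 2 * T F2 + h ^+ 3 * T (F3 h).
  move=> hr; have := cauchy_formula0 r0 hr df0.
  have -> : (fun t => f (z + circ0 r t) * (circ0 r t / (circ0 r t - h))) =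
     (fun t => F t + (h * F1 t + (h ^+ 2 * F2 t + h ^+ 3 * F3 h t))).
    apply/funext => t; rewrite /F3 /F2 /F1 /F.
    by field; rewrite g0 circ0_sub_neq0.
  have d3 t : continuous_at t (fun t => h ^+ 3 * F3 h t).
    by apply: contM; [exact: cont_cst|exact: c3].
  have d2 t : continuous_at t (fun t => h ^+ 2 * F2 t).
    by apply: contM; [exact: cont_cst|exact: c2].
  have d1 t : continuous_at t (fun t => h * F1 t).
    by apply: contM; [exact: cont_cst|exact: c1].
  have d23 t := contD (@d2 t) (@d3 t); have d123 t := contD (@d1 t) (@d23 t).
  rewrite (cintD cF d123 N10 N1pi) (cintD d1 d23 N10 N1pi) (cintD d2 d3 N10 N1pi).
  rewrite (cintZ _ c1 N10 N1pi) (cintZ _ c2 N10 N1pi) (cintZ _ (c3 _ hr) N10 N1pi).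
  move=> H; apply: (mulfI pi2_neq0); rewrite -H /T.
  by do !(move: (cint _ _ _) => ?); move: (2 * pi)%:C pi2_neq0 => p p0; field.
have Ez : f z = T F.
  have := E 0; rewrite cabs0 addr0 => ->//.
  by rewrite !expr0n /= !mul0r !addr0.
have [M [M0 HM]] : exists M, 0 <= M /\ forall t, 0 <= t <= 2 * pi -> cabs (F t) <= M.
  apply: (@circle_bound f z r r0) => w wr; apply: df.
  by apply: le_lt_trans wr _; rewrite /r; lra.
exists (T F1), (T F2), (4 * (M / r / r / (r / 2))), (r / 2); split.
- by rewrite mulr_ge0// !divr_ge0// ltW// divr_gt0.
- by rewrite divr_gt0.
move=> h hr; have hr' : cabs h < r by lra.
rewrite (E _ hr') Ez (_ : _ - _ - _ - _ = h ^+ 3 * T (F3 h)); last by ring.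
rewrite cabsM cabsX mulrC ler_wpM2r ?exprn_ge0 ?cabs_ge0//.
rewrite /T cabsM cabsV cabs_real gtr0_norm// ler_pdivrMr//.
have X0 : 0 <= M / r / r / (r / 2) by rewrite !divr_ge0// ltW// divr_gt0.
have := @cint_bound _ _ 0 (2 * pi) (M / r / r / (r / 2)) (c3 _ hr') N10 (ltW pi2_gt0).
rewrite subr0 => H; apply: le_trans (H _) _; last first.
  rewrite ler_pM2r//; lra.
move=> t ht; rewrite /F3 /F2 /F1 !cabsM !cabsV cabs_circ0 gtr0_norm//.
apply: ler_pM; rewrite ?mulr_ge0 ?invr_ge0 ?cabs_ge0 ?(ltW r0)//.
  by rewrite !ler_pM2r ?invr_gt0// HM.
have d0 : 0 < cabs (circ0 r t - h) by rewrite cabs_gt0 circ0_sub_neq0.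
rewrite lef_pV2 ?posrE ?divr_gt0//.
have := cabs_lowB (circ0 r t) h; rewrite cabs_circ0 gtr0_norm//; lra.
Qed.

End CauchyConsequences.

Section LocalStructure.
Context {R : realType}.
Implicit Types (f g q : R[i] -> R[i]) (r rho M : R) (z w h : R[i]).

Lemma holo_ball_recenter f z rho w : holo_ball f z rho ->
  holo_ball f w (rho - cabs (w - z)).
Proof.
move=> df x xw; apply: df; apply: le_lt_trans (cabs_tri _ w _) _; lra.
Qed.

Lemma holo_div f z rho : 0 < rho -> holo_ball f z rho ->
  exists q, holo_ball q z rho /\ forall w, f w = f z + (w - z) * q w.
Proof.
move=> rho0 df; have [A1 [A2 [C [r [C0 r0 H]]]]] := taylor3 rho0 df.
exists (fun w => if w == z then A1 else (f w - f z) / (w - z)).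
split=> [w wz|w]; last first.
  case: eqVneq => [->|wz]; first by rewrite subrr mul0r addr0.
  by rewrite mulrC divfK ?subr_eq0// addrC subrK.
have [->{w wz}|wz0] := eqVneq w z.
  exists A2; apply/has_cderivP => e e0.
  have C1 : 0 < C + 1 by lra.
  exists (Num.min r (e / (C + 1))); first by rewrite lt_min r0 divr_gt0.
  move=> w; rewrite lt_min eqxx => /andP[wr we].
  case: eqVneq => [->|wz]; first by rewrite !subrr mulr0 subrr cabs0 mulr0.
  have wz0 : w - z != 0 by rewrite subr_eq0.
  have := H (w - z) wr; rewrite (addrC z) subrK => Hw.
  have -> : (f w - f z) / (w - z) - A1 - A2 * (w - z) =
      (f w - f z - A1 * (w - z) - A2 * (w - z) ^+ 2) / (w - z) by field.
  have c0 : 0 < cabs (w - z) by rewrite cabs_gt0.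
  rewrite cabsM cabsV ler_pdivrMr//; apply: le_trans Hw _.
  move: (cabs (w - z)) c0 we wr => x x0 we _.
  rewrite exprS expr2 !mulrA ler_pM2r// ler_pM2r//.
  move: we; rewrite ltr_pdivlMr//; nra.
have wz1 : 0 < cabs (w - z) by rewrite cabs_gt0 subr_eq0.
apply: (@cdiff_near _ _ (fun w => (f w - f z) / (w - z))).
  apply/nearC; exists (cabs (w - z)) => // x xw; case: eqVneq => [xz|//].
  by move: xw; rewrite xz cabsB ltxx.
apply: cdiff_div; [by rewrite subr_eq0| |exact: cdiff_shift].
by apply: cdiffB; [exact: df|exact: cdiff_cst].
Qed.

Lemma schwarz f g z r rho M m : 0 < r -> r < rho -> holo_ball g z rho ->
  (forall w, f w = (w - z) ^+ m * g w) ->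
  (forall t, 0 <= t <= 2 * pi -> cabs (f (z + circ0 r t)) <= M) ->
  forall w, cabs (w - z) <= r / 2 -> cabs (f w) <= 4 * M * (cabs (w - z) / r) ^+ m.
Proof.
move=> r0 rrho dg fE fM w wr.
have rm : 0 < r ^+ m by rewrite exprn_gt0.
have gM t : 0 <= t <= 2 * pi -> cabs (g (z + circ0 r t)) <= M / r ^+ m.
  move=> ht; rewrite ler_pdivlMr// mulrC; have := fM t ht.
  by rewrite fE cabsM cabsX addrC addKr cabs_circ0 gtr0_norm.
have dg' x : cabs (x - z) <= r -> cdiff g x.
  by move=> xr; apply: dg; exact: le_lt_trans rrho.
have := max_bound r0 dg' gM wr; rewrite fE cabsM cabsX expr_div_n => Hg.
apply: le_trans (ler_wpM2l _ Hg) _; first by rewrite exprn_ge0// cabs_ge0.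
by rewrite le_eqVlt; apply/orP; left; apply/eqP; ring.
Qed.

Lemma holo_zero f z rho : 0 < rho -> holo_ball f z rho ->
  (exists2 r, 0 < r & forall w, cabs (w - z) < r -> f w = 0) \/
  exists m g, [/\ holo_ball g z rho, g z != 0 & forall w, f w = (w - z) ^+ m * g w].
Proof.
move=> rho0 df.
have [|no] := pselect (exists m g,
  [/\ holo_ball g z rho, g z != 0 & forall w, f w = (w - z) ^+ m * g w]).
  by right.
left; have H m : exists g, holo_ball g z rho /\ forall w, f w = (w - z) ^+ m * g w.
  elim: m => [|m [g [dg fE]]].
    by exists f; split=> [//|w]; rewrite expr0 mul1r.
  have gz : g z = 0.
    by apply/eqP; apply: contrapT => /negP gz; apply: no; exists m, g.
  have [q [dq gE]] := holo_div rho0 dg; exists q; split=> // w.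
  by rewrite fE (gE w) gz add0r exprSr mulrA.
set r := rho / 2; have r0 : 0 < r by rewrite divr_gt0.
have rrho : r < rho by rewrite /r; lra.
have [M [M0 fM]] : exists M, 0 <= M /\
    forall t, 0 <= t <= 2 * pi -> cabs (f (z + circ0 r t)) <= M.
  by apply: circle_bound r0 _ => w wr; apply: df; exact: le_lt_trans rrho.
exists (r / 2) => [|w wr]; first by rewrite divr_gt0.
apply/eqP; apply: contraT; rewrite -cabs_gt0 => fw0.
have [m hm] := half_pow_small (4 * M) fw0.
have [g [dg fE]] := H m.
have := schwarz r0 rrho dg fE fM (ltW wr).
rewrite leNgt => /negP; case; apply: le_lt_trans hm.
apply: ler_wpM2l; first by rewrite mulr_ge0.
have h1 : cabs (w - z) / r <= 2^-1.
  by rewrite ler_pdivrMr// mulrC ltW.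
have h0 : 0 <= cabs (w - z) / r by rewrite divr_ge0 ?cabs_ge0 ?ltW.
by rewrite -exprVn; apply: lerXn2r h1; rewrite nnegrE.
Qed.

Lemma removable_singularity f z rho M : 0 < rho ->
  (forall w, w != z -> cabs (w - z) < rho -> cdiff f w /\ cabs (f w) <= M) ->
  exists g, holo_ball g z rho /\ forall w, w != z -> f w = g w.
Proof.
move=> rho0 H; pose F w := (w - z) ^+ 2 * f w.
have M0 : 0 <= M.
  have [w [wz wr]] := exists_in_punctured z rho0.
  by have [_] := H w wz wr; apply: le_trans; exact: cabs_ge0.
have dF0 : has_cderiv F z 0.
  apply/has_cderivP => e e0.
  have M1 : 0 < M + 1 by lra.
  exists (Num.min rho (e / (M + 1))); first by rewrite lt_min rho0 divr_gt0.
  move=> x; rewrite lt_min => /andP[xr xe]; rewrite mul0r subr0 /F.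
  rewrite subrr expr0n mul0r subr0 cabsM cabsX.
  have [->|xz] := eqVneq x z; first by rewrite subrr cabs0 expr0n /= mul0r mulr0.
  have [_ fM] := H x xz xr.
  rewrite expr2 mulrAC ler_wpM2r ?cabs_ge0//.
  apply: le_trans (ler_wpM2l (cabs_ge0 _) fM) _.
  move: xe; rewrite ltr_pdivlMr//; have := cabs_ge0 (x - z); nra.
have dF : holo_ball F z rho.
  move=> w wr; have [->|wz] := eqVneq w z; first by exists 0.
  have [df _] := H w wz wr.
  by apply: cdiffM => //; apply: cdiffX; exact: cdiff_shift.
have [q [dq FE]] := holo_div rho0 dF.
have qE w : w != z -> q w = (w - z) * f w.
  move=> wz; have wz0 : w - z != 0 by rewrite subr_eq0.
  apply: (mulfI wz0); have := FE w.
  rewrite /F subrr expr0n mul0r add0r => <-; ring.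
have qz : q z = 0.
  apply: has_cderiv_uniq dF0; exists q; split=> //.
  by apply: cdiff_cont; apply: dq; rewrite subrr cabs0.
have [g [dg qE2]] := holo_div rho0 dq.
exists g; split=> // w wz; have wz0 : w - z != 0 by rewrite subr_eq0.
by apply: (mulfI wz0); rewrite -qE// qE2 qz add0r.
Qed.

End LocalStructure.

Section Limits.
Context {R : realType}.
Implicit Types (f g q : R[i] -> R[i]) (r rho M C : R) (z w h : R[i]).

Lemma has_cderiv_quad g z r M : 0 < r ->
  (forall w, cabs (w - z) < r -> cabs (g w) <= M * cabs (w - z) ^+ 2) ->
  has_cderiv g z 0.
Proof.
move=> r0 H; have gz : g z = 0.
  have := H z; rewrite subrr cabs0 expr0n mulr0 => /(_ r0) h.
  by apply/eqP; rewrite -cabs_eq0 eq_le h cabs_ge0.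
apply/has_cderivP => e e0; have M1 : 0 < `|M| + 1 by rewrite ltr_wpDl.
exists (Num.min r (e / (`|M| + 1))); first by rewrite lt_min r0 divr_gt0.
move=> w; rewrite lt_min => /andP[wr we].
rewrite gz mul0r !subr0; apply: le_trans (H _ wr) _.
rewrite expr2 mulrA ler_wpM2r ?cabs_ge0//.
move: we; rewrite ltr_pdivlMr//.
have := cabs_ge0 (w - z); have := ler_norm M; have := normr_ge0 M; nra.
Qed.

Lemma has_cderiv_div f q z : continuous_at z q ->
  (forall w, f w = f z + (w - z) * q w) -> has_cderiv f z (q z).
Proof. by move=> cq fE; exists q; split. Qed.

Lemma cauchy_estimate f z r rho M d : 0 < r -> r < rho -> holo_ball f z rho ->
  (forall w, cabs (w - z) <= r -> cabs (f w) <= M) -> has_cderiv f z d ->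
  cabs d <= 8 * M / r.
Proof.
move=> r0 rrho df fM fd; have rho0 := lt_trans r0 rrho.
have [q [dq fE]] := holo_div rho0 df.
have cq : continuous_at z q by apply: cdiff_cont; apply: dq; rewrite subrr cabs0.
rewrite (has_cderiv_uniq fd (has_cderiv_div cq fE)).
have qM t : 0 <= t <= 2 * pi -> cabs (q (z + circ0 r t)) <= 2 * M / r.
  move=> _; have zk : z + circ0 r t - z = circ0 r t by rewrite addrC addKr.
  have E := fE (z + circ0 r t); rewrite zk in E.
  have cr : cabs (circ0 r t) = r by rewrite cabs_circ0 gtr0_norm.
  rewrite ler_pdivlMr// mulrC -{1}cr -cabsM.
  have -> : circ0 r t * q (z + circ0 r t) = f (z + circ0 r t) - f z.
    by rewrite E; ring.
  apply: le_trans (cabsDB _ _) _; rewrite mulr_natl mulr2n; apply: lerD.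
    by apply: fM; rewrite zk cr.
  by apply: fM; rewrite subrr cabs0 ltW.
have dq' w : cabs (w - z) <= r -> cdiff q w.
  by move=> wr; apply: dq; exact: le_lt_trans rrho.
have := max_bound r0 dq' qM (w := z); rewrite subrr cabs0.
move=> /(_ _)/le_trans; apply; first by rewrite divr_ge0// ltW.
by rewrite le_eqVlt; apply/orP; left; apply/eqP; ring.
Qed.

Lemma holo_deriv f z rho : holo_ball f z rho ->
  exists f1, holo_ball f1 z rho /\
    forall w, cabs (w - z) < rho -> has_cderiv f w (f1 w).
Proof.
move=> df; pose f1 w := xget 0 [set d | has_cderiv f w d].
have f1P w : cabs (w - z) < rho -> has_cderiv f w (f1 w).
  move=> /df[d fd].
  exact: (@xgetPex _ 0 [set d | has_cderiv f w d] (ex_intro _ d fd)).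
exists f1; split=> // w0 w0r; set s := rho - cabs (w0 - z).
have s0 : 0 < s by rewrite subr_gt0.
have df0 : holo_ball f w0 s by exact: holo_ball_recenter.
have [q [dq fE]] := holo_div s0 df0.
have [p [dp qE]] := holo_div s0 dq.
have [M [M0 pM]] : exists M, 0 <= M /\
    forall t, 0 <= t <= 2 * pi -> cabs (p (w0 + circ0 (s / 2) t)) <= M.
  apply: circle_bound; first by rewrite divr_gt0.
  by move=> w ws; apply: dp; apply: le_lt_trans ws _; lra.
have s20 : 0 < s / 2 by rewrite divr_gt0.
have dp' w : cabs (w - w0) <= s / 2 -> cdiff p w.
  by move=> ws; apply: dp; apply: le_lt_trans ws _; lra.
have pM' := max_bound s20 dp' pM.
have Hd w : cabs (w - w0) < s / 8 -> exists2 d,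
    cabs d <= 8 * (4 * M) / (s / 10) &
    f1 w = q w0 + 2 * (w - w0) * p w + (w - w0) ^+ 2 * d.
  move=> ws; have wr : cabs (w - z) < rho.
    apply: le_lt_trans (cabs_tri w w0 z) _; rewrite /s in ws s0; lra.
  have [d pd] : cdiff p w by apply: dp; lra.
  exists d.
    have s100 : 0 < s / 10 by rewrite divr_gt0.
    have s108 : s / 10 < s / 8 by lra.
    have dpw : holo_ball p w (s / 8).
      move=> x xw; apply: dp; apply: le_lt_trans (cabs_tri x w w0) _; lra.
    apply: cauchy_estimate s100 s108 dpw _ pd => x xw.
    by apply: pM'; apply: le_trans (cabs_tri x w w0) _; lra.
  apply: has_cderiv_uniq (f1P w wr) _.
  have fE2 x : f x = f w0 + (x - w0) * (q w0 + (x - w0) * p x).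
    by rewrite fE (qE x).
  apply: (@has_cderiv_near _ _ (fun x => f w0 + (x - w0) * (q w0 + (x - w0) * p x))).
    by apply/nearC; exists 1 => // x _; exact: fE2.
  have dx : has_cderiv (fun x => x - w0) w 1.
    by have := has_cderivB (has_cderiv_id w) (has_cderiv_cst w0 w); rewrite subr0.
  have := has_cderivD (has_cderiv_cst (f w0) w) (has_cderivM dx
     (has_cderivD (has_cderiv_cst (q w0) w) (has_cderivM dx pd))).
  by congr has_cderiv; ring.
pose D w := f1 w - q w0 - 2 * (w - w0) * p w.
have dD : has_cderiv D w0 0.
  apply: (@has_cderiv_quad _ _ (s / 8) (8 * (4 * M) / (s / 10))).
    by rewrite divr_gt0.
  move=> w /Hd[d dM f1E]; rewrite /D f1E.
  have -> : q w0 + 2 * (w - w0) * p w + (w - w0) ^+ 2 * d - q w0 -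
    2 * (w - w0) * p w = d * (w - w0) ^+ 2 by ring.
  by rewrite cabsM cabsX ler_wpM2r ?exprn_ge0 ?cabs_ge0.
apply: (@cdiff_near _ _ (fun w => D w + (q w0 + 2 * (w - w0) * p w))).
  by apply/nearC; exists 1 => // w _; rewrite /D; ring.
apply: cdiffD; first by exists 0.
apply: cdiffD; first exact: cdiff_cst.
apply: cdiffM; last by apply: dp; rewrite subrr cabs0.
by apply: cdiffM; [exact: cdiff_cst|exact: cdiff_shift].
Qed.

Lemma geometric_limit (u : R^nat) C :
  (forall n, `|u n.+1 - u n| <= C / 3 ^+ n) ->
  exists l, forall n, `|u n - l| <= 2 * C / 3 ^+ n.
Proof.
move=> uC; have C0 : 0 <= C.
  by have := uC 0%N; rewrite expr0 divr1; apply: le_trans.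
have c3 n : 0 <= C / 3 ^+ n by rewrite divr_ge0// exprn_ge0.
have cS n : C / 3 ^+ n.+1 = C / 3 ^+ n / 3 by rewrite exprS invfM; ring.
have [|l Hl] := @nested_point _ (fun n => u n - 2 * C / 3 ^+ n) (fun n => u n + 2 * C / 3 ^+ n).
  move=> n; rewrite -!mulrA cS; have := uC n; have := c3 n; rewrite ler_norml.
  by split; lra.
exists l => n; move: (Hl n); rewrite ler_norml; lra.
Qed.

Lemma geometric_limitC (u : nat -> R[i]) C :
  (forall n, cabs (u n.+1 - u n) <= C / 3 ^+ n) ->
  exists l, forall n, cabs (u n - l) <= 4 * C / 3 ^+ n.
Proof.
move=> uC.
have [|l1 H1] := @geometric_limit (fun n => complex.Re (u n)) C.
  by move=> n; rewrite -raddfB; apply: le_trans (Re_le_cabs _) _.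
have [|l2 H2] := @geometric_limit (fun n => complex.Im (u n)) C.
  by move=> n; rewrite -raddfB; apply: le_trans (Im_le_cabs _) _.
exists (l1 +i* l2) => n; apply: le_trans (cabs_le_ReIm _) _; rewrite !raddfB /=.
by apply: le_trans (lerD (H1 n) (H2 n)) _; rewrite -!mulrA; lra.
Qed.

Lemma geometric_small C (e : R) : 0 < e -> exists n, C / 3 ^+ n < e.
Proof.
move=> e0; have [n hn] := half_pow_small `|C| e0; exists n; apply: le_lt_trans hn.
apply: (@le_trans _ _ (`|C| / 3 ^+ n)).
  by rewrite ler_pM2r ?ler_norm// invr_gt0 exprn_gt0.
rewrite ler_wpM2l// lef_pV2 ?posrE ?exprn_gt0//.
by apply: lerXn2r; rewrite ?nnegrE//; lra.
Qed.

Lemma geometric_limit_uniq (u : nat -> R[i]) C (l l' : R[i]) :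
  (forall n, cabs (u n - l) <= C / 3 ^+ n) ->
  (forall n, cabs (u n - l') <= C / 3 ^+ n) -> l = l'.
Proof.
move=> H H'; apply/eqP; rewrite -subr_eq0; apply: contraT; rewrite -cabs_gt0 => e0.
have [n hn] := geometric_small (2 * C) e0.
have := cabs_tri l (u n) l'; rewrite (cabsB l (u n)); have := H n; have := H' n.
rewrite -mulrA in hn; lra.
Qed.

Lemma holo_limit (F : nat -> R[i] -> R[i]) z rho C : 0 <= C ->
  (forall n, holo_ball (F n) z rho) ->
  (forall n w, cabs (w - z) < rho -> cabs (F n.+1 w - F n w) <= C / 3 ^+ n) ->
  exists f, holo_ball f z rho /\
    forall n w, cabs (w - z) < rho -> cabs (F n w - f w) <= 4 * C / 3 ^+ n.
Proof.
move=> C0 dF FC; pose f w := xget 0 [set l | forall n, cabs (F n w - l) <= 4 * C / 3 ^+ n].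
have fP w : cabs (w - z) < rho -> forall n, cabs (F n w - f w) <= 4 * C / 3 ^+ n.
  move=> wr; have [l Hl] := geometric_limitC (fun n => FC n w wr).
  exact: (@xgetPex _ 0 [set l | forall n, cabs (F n w - l) <= 4 * C / 3 ^+ n]
    (ex_intro _ l Hl)).
exists f; split=> [w0 w0r|n w]; last by move=> /fP.
set s := rho - cabs (w0 - z); have s0 : 0 < s by rewrite subr_gt0.
have inb w : cabs (w - w0) < s -> cabs (w - z) < rho.
  by rewrite /s => ws; apply: le_lt_trans (cabs_tri w w0 z) _; lra.
have Fq n : exists q, holo_ball q w0 s /\ forall w, F n w = F n w0 + (w - w0) * q w.
  by apply: holo_div => //; apply: holo_ball_recenter.
have [q Hq] := choice Fq.
set r := s / 2; have r0 : 0 < r by rewrite divr_gt0.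
have rs : r < s by rewrite /r; lra.
have qC n w : cabs (w - w0) <= r / 2 -> cabs (q n.+1 w - q n w) <= (8 * C / r) / 3 ^+ n.
  have dqq x : cabs (x - w0) <= r -> cdiff (fun x => q n.+1 x - q n x) x.
    move=> xr; apply: cdiffB; [apply: (Hq n.+1).1|apply: (Hq n).1];
    exact: le_lt_trans rs.
  move=> wr; have := max_bound r0 dqq (M := 2 * (C / 3 ^+ n) / r) _ wr.
  move=> H; apply: le_trans (H _) _; last first.
    by rewrite le_eqVlt; apply/orP; left; apply/eqP; ring.
  move=> t _; have cr : cabs (circ0 r t) = r by rewrite cabs_circ0 gtr0_norm.
  have h1 := (Hq n.+1).2 (w0 + circ0 r t); have h2 := (Hq n).2 (w0 + circ0 r t).
  rewrite (addrC w0) addrK in h1 h2.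
  rewrite ler_pdivlMr// mulrC -{1}cr -cabsM (addrC w0).
  have -> : circ0 r t * (q n.+1 (circ0 r t + w0) - q n (circ0 r t + w0)) =
      (F n.+1 (circ0 r t + w0) - F n (circ0 r t + w0)) - (F n.+1 w0 - F n w0).
    by rewrite h1 h2; ring.
  apply: le_trans (cabsDB _ _) _; rewrite mulr_natl mulr2n; apply: lerD; apply: FC => //.
  by apply: inb; rewrite addrK cr.
have qlim w : exists l, cabs (w - w0) <= r / 2 ->
    forall n, cabs (q n w - l) <= 4 * (8 * C / r) / 3 ^+ n.
  have [wr|wr] := pselect (cabs (w - w0) <= r / 2); last by exists 0.
  by have [l Hl] := geometric_limitC (fun n => qC n w wr); exists l.
have [Q HQ] := choice qlim.
have r20 : 0 < r / 2 by rewrite divr_gt0.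
have w0w0 : cabs (w0 - w0) <= r / 2 by rewrite subrr cabs0 ltW.
have fE w : cabs (w - w0) <= r / 2 -> f w = f w0 + (w - w0) * Q w.
  move=> wr; have wz : cabs (w - z) < rho.
    by apply: inb; apply: le_lt_trans wr _; rewrite /r; lra.
  set K := 4 * C + r / 2 * (4 * (8 * C / r)).
  have X n : 0 <= C / 3 ^+ n by rewrite divr_ge0// exprn_ge0.
  have Kle n : 4 * C / 3 ^+ n <= K / 3 ^+ n.
    by rewrite ler_wpM2r ?invr_ge0 ?exprn_ge0// lerDl !mulr_ge0 ?invr_ge0// ltW.
  apply: (@geometric_limit_uniq (fun n => F n w) K).
    by move=> n; apply: le_trans (Kle n); exact: fP.
  move=> n; rewrite (Hq n).2.
  have -> : F n w0 + (w - w0) * q n w - (f w0 + (w - w0) * Q w) =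
      (F n w0 - f w0) + (w - w0) * (q n w - Q w) by ring.
  have -> : K / 3 ^+ n = 4 * C / 3 ^+ n + r / 2 * (4 * (8 * C / r) / 3 ^+ n).
    by rewrite /K; ring.
  apply: le_trans (cabsD _ _) _; apply: lerD; first exact: fP.
  rewrite cabsM; apply: ler_pM; rewrite ?cabs_ge0//; exact: HQ.
exists (Q w0).
apply: (@has_cderiv_near _ _ (fun w => f w0 + (w - w0) * Q w)).
  by apply/nearC; exists (r / 2) => // w /ltW; exact: fE.
exists Q; split=> //; last by move=> w; rewrite subrr mul0r addr0.
apply/contP => e e0; have e30 : 0 < e / 3 by rewrite divr_gt0.
have [n hn] := geometric_small (4 * (8 * C / r)) e30.
have cq : continuous_at w0 (q n).
  by apply: cdiff_cont; apply: (Hq n).1; rewrite subrr cabs0.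
have /contP /(_ _ e30)[d d0 Hd] := cq.
exists (Num.min d (r / 2)); first by rewrite lt_min d0.
move=> w; rewrite lt_min => /andP[wd wr].
have h1 := Hd w wd; have h2 := le_lt_trans (HQ w (ltW wr) n) hn.
have h3 := le_lt_trans (HQ w0 w0w0 n) hn; rewrite cabsB in h2.
apply: le_lt_trans (cabs_tri _ (q n w) _) _.
apply: le_lt_trans (lerD (lexx _) (cabs_tri _ (q n w0) _)) _.
by move: h1 h2 h3; clear -e e0; lra.
Qed.

End Limits.

Section ComplexLogarithm.
Context {R : realType}.
Implicit Types (x y : R) (z w : R[i]).

Lemma is_deriveP (g : R -> R) (x d : R) : is_derive x 1 g d <->
  forall e : R, 0 < e -> exists2 r : R, 0 < r &
    forall y, `|y - x| < r -> `|g y - g x - d * (y - x)| <= e * `|y - x|.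
Proof.
split=> [[dg Dg] e e0|H].
  move: dg; rewrite /derivable => /cvg_ex[l /= gl].
  have ld : l = d by rewrite -Dg; apply/esym; exact: cvg_lim gl.
  move: gl; rewrite ld => /cvgrPdist_lt/(_ e e0)/nbhs_ballP[r /= r0 Hr].
  exists r => // y yr; have [->|yx] := eqVneq y x.
    by rewrite !subrr mulr0 subrr normr0 mulr0.
  have yx0 : y - x != 0 by rewrite subr_eq0.
  have := Hr (y - x); rewrite /ball /= sub0r normrN => /(_ yr yx0).
  rewrite /GRing.scale /= mulr1 subrK => /ltW h.
  have -> : g y - g x - d * (y - x) = - (d - (y - x)^-1 * (g y - g x)) * (y - x).
    by field.
  by rewrite normrM normrN ler_wpM2r.
have cv : (fun h : R => h^-1 *: ((g \o shift x) (h *: 1) - g x)) @ 0^' --> d.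
  apply/cvgrPdist_le => e /H[r r0 Hr]; apply/nbhs_ballP; exists r => // h.
  rewrite /ball /= sub0r normrN => hr h0; have := Hr (h + x).
  rewrite addrK /GRing.scale /= mulr1 => /(_ hr) k.
  have -> : d - h^-1 * (g (h + x) - g x) = - (g (h + x) - g x - d * h) / h.
    by field.
  by rewrite normrM normrN normrV ?unitfE// ler_pdivrMr ?normr_gt0.
by apply: DeriveDef; [apply/cvg_ex; exists d|exact: cvg_lim cv].
Qed.

Definition clog z : R[i] := ln (cabs z) +i* atan (complex.Im z / complex.Re z).

Let normsq x y := x ^+ 2 + y ^+ 2.

Let ln_cabs z : z != 0 ->
  ln (cabs z) = 2^-1 * ln (normsq (complex.Re z) (complex.Im z)).
Proof.
rewrite -cabs_gt0 => z0; have -> : normsq (complex.Re z) (complex.Im z) = cabs z ^+ 2.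
  by rewrite cabsE sqr_sqrtr// addr_ge0 ?sqr_ge0.
by rewrite lnXn// -(mulr_natl (ln _) 2); lra.
Qed.

Lemma has_cderiv_clog z : 0 < complex.Re z -> has_cderiv clog z z^-1.
Proof.
case: z => x0 y0 /= x00.
set N0 := normsq x0 y0; have N00 : 0 < N0.
  by rewrite ltr_pwDl ?exprn_gt0// sqr_ge0.
have [K [K1 [Kx Ky]]] : exists K : R, 1 <= K /\ `|x0| <= K /\ `|y0| <= K.
  exists (1 + `|x0| + `|y0|); have := normr_ge0 x0; have := normr_ge0 y0.
  by move=> *; split; [|split]; lra.
have K0 : 0 < K by lra.
apply/has_cderivP => e e0.
have e10 : 0 < e / 4 / (4 * K) by rewrite !divr_gt0// mulr_gt0.
have [d1 d10 H1] := (@is_deriveP (@ln R) N0 N0^-1).1 (is_derive1_ln N00) _ e10.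
have e20 : 0 < e / 4 * (x0 ^+ 2 / (4 * K)).
  by rewrite mulr_gt0 ?divr_gt0 ?exprn_gt0 ?mulr_gt0.
have [d2 d20 H2] := (@is_deriveP (@atan R) (y0 / x0) _).1 (is_derive1_atan _) _ e20.
have r0 : 0 < d1 / (8 * K) by rewrite divr_gt0// mulr_gt0.
have r1 : 0 < d2 * (x0 ^+ 2 / (4 * K)) by rewrite mulr_gt0// divr_gt0 ?exprn_gt0// mulr_gt0.
have r2 : 0 < e / 4 * N0 by rewrite mulr_gt0// divr_gt0.
have r3 : 0 < e / 4 * (x0 * N0 / (4 * K)) by rewrite mulr_gt0 ?divr_gt0 ?mulr_gt0.
exists (Num.min (Num.min (Num.min 1 (x0 / 2)) (Num.min (d1 / (8 * K)) (d2 * (x0 ^+ 2 / (4 * K)))))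
   (Num.min (e / 4 * N0) (e / 4 * (x0 * N0 / (4 * K))))).
  by rewrite !lt_min ltr01 r0 r1 r2 r3 !andbT divr_gt0.
move=> w; rewrite !lt_min => /andP[/andP[/andP[c1 c2] /andP[c3 c4]] /andP[c5 c6]].
have := Re_le_cabs (w - x0 +i* y0); have := Im_le_cabs (w - x0 +i* y0).
have w0E : w - x0 +i* y0 = (complex.Re w - x0) +i* (complex.Im w - y0) by case: w {c1 c2 c3 c4 c5 c6}.
set c := cabs _ in c1 c2 c3 c4 c5 c6 *.
have c0 : 0 <= c := cabs_ge0 _.
rewrite w0E /=; set a := complex.Re w - x0; set b := complex.Im w - y0 => bc ac.
have xE : complex.Re w = x0 + a by rewrite /a addrC subrK.
have yE : complex.Im w = y0 + b by rewrite /b addrC subrK.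
have xpos : x0 / 2 < complex.Re w by move: ac; rewrite xE ler_norml; lra.
have w0 : w != 0 by rewrite eq_complex /= negb_and gt_eqF//; lra.
have z0 : x0 +i* y0 != 0 by rewrite eq_complex /= negb_and gt_eqF.
have la : `|a * x0 + b * y0| <= 2 * (c * K).
  apply: le_trans (ler_normD _ _) _; rewrite !normrM.
  have := ler_pM (normr_ge0 _) (normr_ge0 _) ac Kx.
  have := ler_pM (normr_ge0 _) (normr_ge0 _) bc Ky; lra.
have lb : `|b * x0 - a * y0| <= 2 * (c * K).
  apply: le_trans (ler_normB _ _) _; rewrite !normrM.
  have := ler_pM (normr_ge0 _) (normr_ge0 _) bc Kx.
  have := ler_pM (normr_ge0 _) (normr_ge0 _) ac Ky; lra.
have a2 : a ^+ 2 <= c * c.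
  by rewrite -real_normK ?num_real// expr2; exact: ler_pM.
have b2 : b ^+ 2 <= c * c.
  by rewrite -real_normK ?num_real// expr2; exact: ler_pM.
have cc : c * c <= c * K by rewrite ler_wpM2l//; lra.
set N := normsq (complex.Re w) (complex.Im w).
have NE : N - N0 = 2 * (a * x0 + b * y0) + (a ^+ 2 + b ^+ 2).
  by rewrite /N /N0 /normsq xE yE; ring.
have lN : `|N - N0| <= 6 * (c * K).
  rewrite NE; apply: le_trans (ler_normD _ _) _.
  rewrite normrM (ger0_norm (addr_ge0 (sqr_ge0 a) (sqr_ge0 b))) ger0_norm//.
  by clear -la a2 b2 cc; lra.
have c3' : 8 * (c * K) < d1 by move: c3; rewrite ltr_pdivlMr ?mulr_gt0//; clear; lra.
have Nd : `|N - N0| < d1.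
  by have := mulr_ge0 c0 (ltW K0); move: c3' lN; clear; lra.
set x := complex.Re w in xE xpos *; set y := complex.Im w in yE *.
have x0' : 0 < x by clear -xpos x00; lra.
have xx0 : 0 < x * x0 by rewrite mulr_gt0.
have vE : y / x - y0 / x0 = (b * x0 - a * y0) / (x * x0).
  by rewrite yE; move: (gt_eqF x0') (gt_eqF x00); rewrite xE => h1 h2; field; rewrite h1 h2.
have ck0 : 0 <= c * K by rewrite mulr_ge0// ltW.
have inv_x : (x * x0)^-1 <= 2 / x0 ^+ 2.
  rewrite -[leLHS]div1r ler_pdivrMr// mulrAC ler_pdivlMr ?exprn_gt0// expr2; clear -xpos x00; nra.
have lv : `|y / x - y0 / x0| <= 4 * (c * K) / x0 ^+ 2.
  rewrite vE normrM normfV (gtr0_norm xx0).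
  have -> : 4 * (c * K) / x0 ^+ 2 = 2 * (c * K) * (2 / x0 ^+ 2) by ring.
  by apply: ler_pM => //; rewrite invr_ge0 ltW.
have vd : `|y / x - y0 / x0| < d2.
  apply: le_lt_trans lv _; rewrite ltr_pdivrMr ?exprn_gt0//.
  by move: c4; rewrite mulrA ltr_pdivlMr ?mulr_gt0//; clear; lra.
have R1 := H1 N Nd; have R2 := H2 _ vd.
apply: le_trans (cabs_le_ReIm _) _.
have -> : complex.Re (clog w - clog (x0 +i* y0) - (x0 +i* y0)^-1 * (a +i* b)) =
    2^-1 * (ln N - ln N0 - N0^-1 * (N - N0)) + (a ^+ 2 + b ^+ 2) / (2 * N0).
  rewrite !raddfB /= (ln_cabs w0) (ln_cabs z0) /= -/x -/y -/N -/(normsq x0 y0) -/N0 NE.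
  by field; rewrite gt_eqF.
have -> : complex.Im (clog w - clog (x0 +i* y0) - (x0 +i* y0)^-1 * (a +i* b)) =
    (atan (y / x) - atan (y0 / x0) - (1 + (y0 / x0) ^+ 2)^-1 * (y / x - y0 / x0)) -
    (b * x0 - a * y0) * a / (x * N0).
  rewrite !raddfB /= -/x -/y vE.
  move: (gt_eqF x0') (gt_eqF x00) (gt_eqF N00).
  rewrite /N0 /normsq => h1 h2 h3.
  have xa : a = x - x0 by [].
  have -> : 1 + (y0 / x0) ^+ 2 = (x0 ^+ 2 + y0 ^+ 2) / x0 ^+ 2 by field; rewrite h2.
  by rewrite xa; field; rewrite h1 h2 h3.
have B1 : `|2^-1 * (ln N - ln N0 - N0^-1 * (N - N0))| <= e / 4 * c.
  rewrite normrM (@gtr0_norm _ 2^-1) ?invr_gt0//.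
  apply: le_trans (ler_wpM2l _ (le_trans R1 (ler_wpM2l (ltW e10) lN))) _.
    by rewrite invr_ge0.
  have -> : 2^-1 * (e / 4 / (4 * K) * (6 * (c * K))) = 3 / 16 * (e * c).
    by field; rewrite gt_eqF.
  have := mulr_ge0 (ltW e0) c0; clear; lra.
have B2 : `|(a ^+ 2 + b ^+ 2) / (2 * N0)| <= e / 4 * c.
  rewrite ger0_norm; last by rewrite divr_ge0 ?addr_ge0 ?sqr_ge0// mulr_ge0// ltW.
  rewrite ler_pdivrMr ?mulr_gt0//.
  have := ler_wpM2r c0 (ltW c5); clear -a2 b2; lra.
have B3 := le_trans R2 (ler_wpM2l (ltW e20) lv).
have B3' : e / 4 * (x0 ^+ 2 / (4 * K)) * (4 * (c * K) / x0 ^+ 2) = e / 4 * c.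
  by field; rewrite !gt_eqF.
have B4 : `|(b * x0 - a * y0) * a / (x * N0)| <= e / 4 * c.
  rewrite normrM normfV normrM (@gtr0_norm _ (x * N0)) ?mulr_gt0//.
  rewrite ler_pdivrMr ?mulr_gt0//.
  apply: le_trans (ler_pM (normr_ge0 _) (normr_ge0 _) lb ac) _.
  have h : c * (4 * K) <= e / 4 * (x0 * N0).
    by move: c6; rewrite mulrA ltr_pdivlMr ?mulr_gt0// => /ltW.
  have h2 := ler_wpM2r c0 h.
  have h3 : 0 <= e / 4 * c * N0 by rewrite !mulr_ge0 ?invr_ge0// ltW.
  have h4 := ler_wpM2l h3 (ltW xpos); clear -h2 h4; lra.
rewrite B3' in B3.
apply: le_trans (lerD (ler_normD _ _) (ler_normB _ _)) _.
by apply: le_trans (lerD (lerD B1 B2) (lerD B3 B4)) _; clear; lra.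
Qed.

End ComplexLogarithm.

Section HarmonicFunctions.
Context {R : realType}.
Implicit Types (h : R[i] -> R) (Phi : R[i] -> R[i]) (z w : R[i]) (V : set R[i]).

Definition local_Re h z Phi :=
  exists2 r : R, 0 < r &
    holo_ball Phi z r /\ forall w, cabs (w - z) < r -> h w = complex.Re (Phi w).

Lemma local_Re_derive h z Phi d : local_Re h z Phi -> has_cderiv Phi z d ->
  is_derive (complex.Re z) 1 (slice_x h z) (complex.Re d) /\
  is_derive (complex.Im z) 1 (slice_y h z) (complex.Re ('i%C * d)).
Proof.
move=> [r r0 [_ hP]] /has_cderivP H; split; apply/is_deriveP => e /H[s s0 {}H];
  (exists (Num.min r s); first by rewrite lt_min r0) => y;
  rewrite lt_min => /andP[yr ys].
- have zE : (y +i* complex.Im z) - z = (y - complex.Re z)%:C.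
    by apply/eqP; rewrite eq_complex; case: (z) => a b /=; rewrite subrr !eqxx.
  have := H (y +i* complex.Im z); rewrite zE cabs_real => /(_ ys).
  apply: le_trans; rewrite /slice_x hP ?zE ?cabs_real// hP; last first.
    by case: (z) => a b; rewrite subrr cabs0.
  apply: le_trans (Re_le_cabs _); rewrite le_eqVlt; apply/orP; left; apply/eqP.
  congr `| _ |; rewrite !raddfB; congr (_ - _ - _); first by case: (z).
  by case: (d) => a b /=; ring.
- have zE : (complex.Re z +i* y) - z = 'i%C * (y - complex.Im z)%:C.
    apply/eqP; rewrite eq_complex; case: (z) => a b /=; apply/andP; split; apply/eqP; ring.
  have ci u : cabs ('i%C * u%:C) = `|u| :> R.
    by rewrite cabsM cabs_real cabsE /= expr0n expr1n add0r sqrtr1 mul1r.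
  have := H (complex.Re z +i* y); rewrite zE ci => /(_ ys).
  apply: le_trans; rewrite /slice_y hP ?zE ?ci// hP; last first.
    by case: (z) => a b; rewrite subrr cabs0.
  apply: le_trans (Re_le_cabs _); rewrite le_eqVlt; apply/orP; left; apply/eqP.
  congr `| _ |; rewrite !raddfB; congr (_ - _ - _); first by case: (z).
  by case: (d) => a b /=; ring.
Qed.

Lemma local_Re_recenter h z Phi (r : R) w : holo_ball Phi z r ->
  (forall w, cabs (w - z) < r -> h w = complex.Re (Phi w)) ->
  cabs (w - z) < r -> local_Re h w Phi.
Proof.
move=> dP hP wr; exists (r - cabs (w - z)); first by rewrite subr_gt0.
split; first exact: holo_ball_recenter.
by move=> x xw; apply: hP; apply: le_lt_trans (cabs_tri _ w _) _; lra.
Qed.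

Lemma local_Re_partial h z Phi : local_Re h z Phi ->
  exists Phi1, local_Re (dx h) z Phi1 /\
    local_Re (dy h) z (fun w => 'i%C * Phi1 w).
Proof.
move=> [r r0 [dP hP]]; have [P1 [dP1 P1E]] := holo_deriv dP.
exists P1; split; exists r => //; split => //.
- move=> w wr; have [[_ <-] _] :=
    local_Re_derive (local_Re_recenter dP hP wr) (P1E w wr).
  by [].
- by move=> w wr; apply: cdiffM; [exact: cdiff_cst|exact: dP1].
- move=> w wr; have [_ [_ <-]] :=
    local_Re_derive (local_Re_recenter dP hP wr) (P1E w wr).
  by [].
Qed.

Lemma local_Re_cont h z Phi : local_Re h z Phi -> continuous_at z h.
Proof.
move=> [r r0 [dP hP]].
have cP : continuous_at z (fun w => complex.Re (Phi w)).
  by apply: cont_Re; apply: cdiff_cont; apply: dP; rewrite subrr cabs0.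
apply/cont_atRP => e e0; move/cont_atRP/(_ _ e0)/nearC: cP => [s s0 H].
apply/nearC; exists (Num.min r s); first by rewrite lt_min r0.
move=> w; rewrite lt_min => /andP[wr ws].
by rewrite !hP ?subrr ?cabs0//; exact: H.
Qed.

Lemma C1_on_local_Re V h : (forall z, V z -> exists Phi, local_Re h z Phi) ->
  C1_on V h.
Proof.
move=> H; split=> z /H[Phi hP].
  have [r r0 [dP _]] := hP.
  have [d Pd] : cdiff Phi z by apply: dP; rewrite subrr cabs0.
  have [D1 D2] := local_Re_derive hP Pd.
  by split; [exact: (@ex_derive _ _ _ _ _ _ _ D1)|exact: (@ex_derive _ _ _ _ _ _ _ D2)].
have [P1 [h1 h2]] := local_Re_partial hP.
by split; [exact: local_Re_cont h1|exact: local_Re_cont h2].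
Qed.

Lemma harmonic_local_Re V h : open V ->
  (forall z, V z -> exists Phi, local_Re h z Phi) -> harmonic_on V h.
Proof.
move=> oV H; split=> //; first split; try exact: C1_on_local_Re.
- by apply: C1_on_local_Re => z /H[P /local_Re_partial[P1 [h1 _]]]; exists P1.
- apply: C1_on_local_Re => z /H[P /local_Re_partial[P1 [_ h1]]].
  by exists (fun w => 'i%C * P1 w).
move=> z /H[P /local_Re_partial[P1 [h1 h2]]].
have [r r0 [dP1 _]] := h1.
have [d P1d] : cdiff P1 z by apply: dP1; rewrite subrr cabs0.
have [[_ D1] _] := local_Re_derive h1 P1d.
have iP1d : has_cderiv (fun w => 'i%C * P1 w) z ('i%C * d).
  by have := has_cderivM (has_cderiv_cst 'i%C z) P1d; rewrite mul0r add0r.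
have [_ [_ D2]] := local_Re_derive h2 iP1d.
rewrite /dx in D1 *; rewrite /dy in D2 *; rewrite D1 D2.
by case: (d) => a b /=; ring.
Qed.

Lemma local_Re_mean h z Phi : local_Re h z Phi ->
  exists2 rho : R, 0 < rho & forall r : R, 0 <= r < rho ->
    ((h z)%:E = ((2 * pi)^-1)%:E *
       \int[lebesgue_measure]_(t in `[0%R, (2 * pi)%R]) (h (circle z r t))%:E)%E.
Proof.
move=> [rho rho0 [dP hP]]; exists rho => // r /andP[r0 rrho].
have pi2_gt0 : 0 < 2 * pi :> R by rewrite mulr_gt0// pi_gt0.
have N10 : -1 < 0 :> R by rewrite ltrN10.
have cr t : cabs (circle z r t - z) = r.
  by rewrite /circle addrC addKr -/(expi t) -/(circ0 r t) cabs_circ0 ger0_norm.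
have cP t : continuous_at t (fun t => Phi (circle z r t)).
  apply: cont_comp; last by apply: cdiff_cont; apply: dP; rewrite cr.
  by apply: contD; [exact: cont_cst|exact: cont_circ0].
rewrite (_ : (fun t => (h (circle z r t))%:E) =
   fun t => (complex.Re (Phi (circle z r t)))%:E); last first.
  by apply/funext => t; rewrite hP ?cr.
rewrite (cint_Re cP N10 pi2_gt0).
have -> : cint (fun t => Phi (circle z r t)) 0 (2 * pi) = (2 * pi)%:C * Phi z.
  have [r00|r00] := eqVneq r 0; last first.
    apply: mean_value; first by rewrite lt_def r00.
    by move=> w wr; apply: dP; exact: le_lt_trans rrho.
  rewrite -cint_cst; congr cint; apply/funext => t.
  by rewrite r00 /circle mul0r addr0.
rewrite hP ?subrr ?cabs0// -EFinM; congr (_%:E).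
by case: (Phi z) => a b /=; rewrite mul0r subr0 mulKf// gt_eqF.
Qed.

End HarmonicFunctions.

Section GreenFunction.
Context {R : realType}.
Implicit Types (a b z : R[i]) (x y B : R).

Lemma logp_ge0 x : 0 <= logp x.
Proof. by rewrite /logp ln_ge0// le_max lexx. Qed.

Let max1_gt0 x : 0 < Num.max 1 x.
Proof. by rewrite lt_max ltr01. Qed.

Lemma logp_le x y : x <= y -> logp x <= logp y.
Proof.
move=> xy; rewrite /logp ler_ln ?posrE//.
by rewrite ge_max !le_max lexx xy orbT.
Qed.

Lemma logp_ln x : 1 <= x -> logp x = ln x.
Proof. by move=> x1; rewrite /logp max_r. Qed.

Lemma logp_lipschitz x y : logp x - logp y <= `|x - y|.
Proof.
have [xy|/ltW yx] := leP x y.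
  by apply: le_trans (normr_ge0 _); rewrite subr_le0 logp_le.
set u := Num.max 1 x; set v := Num.max 1 y.
have uv : u - v <= x - y by rewrite /u /v; case: (leP 1 x); case: (leP 1 y); lra.
have v1 : 1 <= v by rewrite le_max lexx.
have vu : v <= u by rewrite /u /v ge_max !le_max lexx yx orbT.
have u0 : 0 < u := max1_gt0 x; have v0 : 0 < v := max1_gt0 y.
rewrite /logp -/u -/v -ln_div ?posrE// (_ : u / v = 1 + (u / v - 1)); last by ring.
apply: le_trans (le_ln1Dx _) _.
  by have := divr_gt0 u0 v0; lra.
rewrite ger0_norm; last lra.
apply: le_trans uv; rewrite lerBlDr ler_pdivrMr//.
have : 0 <= (u - v) * (v - 1) by rewrite mulr_ge0 ?subr_ge0.
by move: (u) (v) => u' v'; lra.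
Qed.

Lemma orbit_aS n a b : orbit_a n.+1 a b = cubic a b (orbit_a n a b).
Proof. by []. Qed.

Lemma cubic_upper a b z B : 1 <= B -> cabs a <= B -> cabs b <= B ->
  cabs (cubic a b z) <= 5 * B ^+ 2 * Num.max 1 (cabs z) ^+ 3.
Proof.
move=> B1 aB bB; set m := Num.max 1 (cabs z).
have m1 : 1 <= m by rewrite le_max lexx.
have zm : cabs z <= m by rewrite le_max lexx orbT.
have z0 := cabs_ge0 z; have a0 := cabs_ge0 a; have b0 := cabs_ge0 b.
have h : cabs (cubic a b z) <= cabs z ^+ 3 + 3 * cabs a ^+ 2 * cabs z + cabs b.
  apply: le_trans (cabsD _ _) _; rewrite lerD2r.
  apply: le_trans (cabsDB _ _) _.
  by rewrite (cabsX z) (cabsM _ z) (cabsM 3) (cabsX a) cabs_nat.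
apply: (le_trans h).
have h1 : cabs z ^+ 3 <= m ^+ 3 by apply: lerXn2r; rewrite ?nnegrE//; lra.
have h2 : cabs a ^+ 2 <= B ^+ 2 by apply: lerXn2r; rewrite ?nnegrE//; lra.
have m3 : m <= m ^+ 3 by rewrite ler_eXnr.
have B2 : B <= B ^+ 2 by rewrite ler_eXnr.
have B12 : 1 <= B ^+ 2 by lra.
have h3 : cabs a ^+ 2 * cabs z <= B ^+ 2 * m ^+ 3.
  by apply: ler_pM; rewrite ?sqr_ge0//; lra.
have h4 : m ^+ 3 <= B ^+ 2 * m ^+ 3 by rewrite ler_peMl//; lra.
have h5 : B <= B ^+ 2 * m ^+ 3.
  by apply: le_trans B2 _; rewrite ler_peMr//; lra.
lra.
Qed.

Lemma cubic_lower a b z :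
  24 * cabs a ^+ 2 <= cabs z ^+ 2 -> 8 * cabs b <= cabs z ^+ 3 ->
  3 / 4 * cabs z ^+ 3 <= cabs (cubic a b z).
Proof.
move=> az bz; have z0 := cabs_ge0 z.
have h : cabs z ^+ 3 - (3 * cabs a ^+ 2 * cabs z + cabs b) <= cabs (cubic a b z).
  rewrite /cubic (_ : z ^+ 3 - _ + b = z ^+ 3 + (b - 3 * a ^+ 2 * z)); last by ring.
  apply: le_trans (cabs_lowD _ _); rewrite cabsX lerD2l lerN2.
  apply: le_trans (cabsDB _ _) _.
  by rewrite (cabsM _ z) (cabsM 3) (cabsX a) cabs_nat addrC.
apply: le_trans h.
have : 24 * cabs a ^+ 2 * cabs z <= cabs z ^+ 2 * cabs z by rewrite ler_wpM2r.
rewrite -exprSr; lra.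
Qed.

Definition green_const B := 3 * ln (5 * B).

Lemma logp_cubic a b z B : 1 <= B -> cabs a <= B -> cabs b <= B ->
  `|logp (cabs (cubic a b z)) - 3 * logp (cabs z)| <= green_const B.
Proof.
move=> B1 aB bB; have a0 := cabs_ge0 a; have b0 := cabs_ge0 b.
have B0 : 0 < B by lra.
have B50 : 0 < 5 * B by lra.
have lnXB : green_const B = ln ((5 * B) ^+ 3).
  by rewrite lnXn ?mulr_gt0// -(mulr_natl (ln _) 3).
have ln3 (x : R) : 0 < x -> 3 * ln x = ln (x ^+ 3).
  by move=> x0; rewrite lnXn// -(mulr_natl (ln _) 3).
set m := Num.max 1 (cabs z); have m1 : 1 <= m by rewrite le_max lexx.
have m0 : 0 < m by lra.
have B2 : B <= B ^+ 2 by rewrite ler_eXnr.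
have B3 : B ^+ 2 <= B ^+ 3 by rewrite ler_weXn2l.
have B5 : 0 < (5 * B) ^+ 3 by rewrite exprn_gt0// mulr_gt0.
have E5 : (5 * B) ^+ 3 = 125 * B ^+ 3 by ring.
have mE : logp (cabs z) = ln m by [].
have up : logp (cabs (cubic a b z)) <= 3 * logp (cabs z) + green_const B.
  have m3 : 1 <= m ^+ 3 by rewrite exprn_ege1.
  have X : Num.max 1 (cabs (cubic a b z)) <= m ^+ 3 * (5 * B) ^+ 3.
    rewrite ge_max; apply/andP; split.
      by rewrite -[leLHS]mulr1; apply: ler_pM => //; lra.
    apply: le_trans (cubic_upper z B1 aB bB) _; rewrite -/m mulrC.
    by rewrite ler_wpM2l//; lra.
  rewrite lnXB mE ln3// -lnM ?posrE ?exprn_gt0//.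
  rewrite /logp ler_ln ?posrE//.
  by rewrite mulr_gt0// exprn_gt0.
have lo : 3 * logp (cabs z) <= logp (cabs (cubic a b z)) + green_const B.
  have [zB|Bz] := leP (5 * B) (cabs z); last first.
    have : logp (cabs z) <= ln (5 * B).
      rewrite -(@logp_ln (5 * B)); last lra.
      by apply: logp_le; exact: ltW.
    have := logp_ge0 (cabs (cubic a b z)); rewrite /green_const; lra.
  have z2 : (5 * B) ^+ 2 <= cabs z ^+ 2 by apply: lerXn2r; rewrite ?nnegrE//; lra.
  have z3 : (5 * B) ^+ 3 <= cabs z ^+ 3 by apply: lerXn2r; rewrite ?nnegrE//; lra.
  have a2 : cabs a ^+ 2 <= B ^+ 2 by apply: lerXn2r; rewrite ?nnegrE//; lra.
  have E52 : (5 * B) ^+ 2 = 25 * B ^+ 2 by ring.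
  have low : 3 / 4 * cabs z ^+ 3 <= cabs (cubic a b z) by apply: cubic_lower; lra.
  have z1 : 1 <= cabs z by lra.
  have c1 : 1 <= cabs (cubic a b z) by lra.
  have z00 : 0 < cabs z by lra.
  have z30 : 0 < cabs z ^+ 3 by rewrite exprn_gt0.
  have c0 : 0 < cabs (cubic a b z) by lra.
  rewrite !logp_ln// lnXB ln3// -lnM ?posrE// ler_ln ?posrE ?mulr_gt0//.
  have : 125 * cabs (cubic a b z) <= cabs (cubic a b z) * (5 * B) ^+ 3.
    by rewrite mulrC ler_wpM2l ?cabs_ge0//; lra.
  lra.
by rewrite ler_norml; apply/andP; split; lra.
Qed.

Lemma cvg_green a b B : 1 <= B -> cabs a <= B -> cabs b <= B ->
  forall n, `|(3 ^+ n)^-1 * logp (cabs (orbit_a n a b)) - Gplus a b| <=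
    2 * green_const B / 3 ^+ n.
Proof.
move=> B1 aB bB; pose g n := (3 ^+ n)^-1 * logp (cabs (orbit_a n a b)).
have gS n : `|g n.+1 - g n| <= green_const B / 3 ^+ n.
  have e0 : 0 < (3 : R) ^+ n by rewrite exprn_gt0.
  have -> : g n.+1 - g n = (logp (cabs (cubic a b (orbit_a n a b))) -
      3 * logp (cabs (orbit_a n a b))) / (3 * 3 ^+ n).
    by rewrite /g orbit_aS exprS; field; rewrite gt_eqF.
  rewrite normrM normfV (@gtr0_norm _ (3 * _)) ?mulr_gt0//.
  have k := logp_cubic (orbit_a n a b) B1 aB bB.
  apply: ler_pM; rewrite ?invr_ge0 ?mulr_ge0 ?(ltW e0)//.
  by rewrite lef_pV2 ?posrE ?mulr_gt0// ler_peMl ?(ltW e0)// ler1n.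
have [l Hl] := geometric_limit gS.
suff <- : l = Gplus a b by exact: Hl.
apply/esym/cvg_lim => //; apply/cvgrPdist_le => e e0.
have [N hN] := geometric_small (2 * green_const B) e0.
exists N => // n /= Nn; rewrite distrC; apply: le_trans (Hl n) _.
apply: le_trans (ltW hN).
have K0 : 0 <= 2 * green_const B.
  by have := le_trans (normr_ge0 _) (Hl 0%N); rewrite expr0 divr1.
rewrite ler_wpM2l// lef_pV2 ?posrE ?exprn_gt0//.
by rewrite ler_eXn2l//; lra.
Qed.

Lemma le_bound a b : exists B : R, [/\ 1 <= B, cabs a <= B & cabs b <= B].
Proof.
by exists (1 + cabs a + cabs b); have := cabs_ge0 a; have := cabs_ge0 b; split; lra.
Qed.

Lemma Gplus_ge0 a b : 0 <= Gplus a b.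
Proof.
have [B [B1 aB bB]] := le_bound a b; have H := cvg_green B1 aB bB.
rewrite leNgt; apply/negP => G0; have G1 : 0 < - Gplus a b by lra.
have [n hn] := geometric_small (2 * green_const B) G1.
have := H n; rewrite ler_norml => /andP[_].
have : 0 <= (3 ^+ n)^-1 * logp (cabs (orbit_a n a b)).
  by rewrite mulr_ge0 ?invr_ge0 ?exprn_ge0// logp_ge0.
lra.
Qed.

Lemma Gplus_le a b (L C : R) N :
  (forall k, (3 ^+ (N + k))^-1 * logp (cabs (orbit_a (N + k) a b)) <=
     L + C / 3 ^+ k) -> Gplus a b <= L.
Proof.
have [B [B1 aB bB]] := le_bound a b; have H := cvg_green B1 aB bB.
move=> LC; rewrite leNgt; apply/negP => G0; have G1 : 0 < Gplus a b - L by lra.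
have [k hk] := geometric_small (2 * green_const B + C) G1.
have := H (N + k)%N; rewrite ler_norml => /andP[h _]; have := LC k.
have K0 : 0 <= 2 * green_const B.
  by have := le_trans (normr_ge0 _) (H 0%N); rewrite expr0 divr1.
have : 2 * green_const B / 3 ^+ (N + k) <= 2 * green_const B / 3 ^+ k.
  rewrite ler_wpM2l// lef_pV2 ?posrE ?exprn_gt0//.
  by rewrite ler_eXn2l ?leq_addl//; lra.
rewrite mulrDl in hk; lra.
Qed.

Lemma cont_cabs (T : topologicalType) (u : T -> R[i]) (p : T) :
  continuous_at p u -> continuous_at p (fun t => cabs (u t)).
Proof.
move=> /cont_atP H; apply/cont_atRP => e /H; apply: filterS => q.
apply: le_lt_trans; rewrite ler_norml; apply/andP; split.
  by rewrite lerNl opprB cabsB; exact: cabs_lowB.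
exact: cabs_lowB.
Qed.

Lemma contX (T : topologicalType) (u : T -> R[i]) (p : T) n :
  continuous_at p u -> continuous_at p (fun t => u t ^+ n).
Proof.
move=> cu; elim: n => [|n IH]; first exact: cont_cst.
rewrite (_ : (fun t => u t ^+ n.+1) = (fun t => u t * u t ^+ n)).
  by apply: contM; [exact: cu|exact: IH].
by apply/funext => t; rewrite exprS.
Qed.

Lemma cont_orbit (T : topologicalType) (u v : T -> R[i]) (p : T) n :
  continuous_at p u -> continuous_at p v ->
  continuous_at p (fun t => orbit_a n (u t) (v t)).
Proof.
move=> cu cv; elim: n => [|n IH]; first exact: cu.
have c2 := contX (n := 2) cu; have c3 := contX (n := 3) IH.
apply: contD; last exact: cv.
apply: contB; first exact: c3.
by apply: contM; [apply: contM; [exact: cont_cst|exact: c2]|exact: IH].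
Qed.

Lemma cont_Gplus (T : topologicalType) (u v : T -> R[i]) (p : T) :
  continuous_at p u -> continuous_at p v ->
  continuous_at p (fun t => Gplus (u t) (v t)).
Proof.
move=> cu cv; have [B [B1 aB bB]] := le_bound (u p) (v p).
have B2 : 1 <= B + 1 by lra.
apply/cont_atRP => e e0; have e30 : 0 < e / 3 by rewrite divr_gt0.
have [n hn] := geometric_small (2 * green_const (B + 1)) e30.
have near_le (f : T -> R[i]) : continuous_at p f -> cabs (f p) <= B ->
    \forall q \near p, cabs (f q) <= B + 1.
  move=> /cont_atP /(_ _ ltr01) H fB; apply: filterS H => q hq.
  by have := cabs_tri (f q) (f p) 0; rewrite !subr0; lra.
have nu := near_le u cu aB; have nv := near_le v cv bB.
have := cont_cabs (cont_orbit (n := n) cu cv) => /cont_atRP /(_ _ e30) no.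
near=> q.
have uB : cabs (u q) <= B + 1 by near: q; exact: nu.
have vB : cabs (v q) <= B + 1 by near: q; exact: nv.
have oq : `|cabs (orbit_a n (u q) (v q)) - cabs (orbit_a n (u p) (v p))| < e / 3.
  by near: q; exact: no.
have h1 := cvg_green B2 uB vB n.
have h2 : `|(3 ^+ n)^-1 * logp (cabs (orbit_a n (u p) (v p))) - Gplus (u p) (v p)|
    <= 2 * green_const (B + 1) / 3 ^+ n by apply: cvg_green => //; lra.
have k : `|logp (cabs (orbit_a n (u q) (v q))) -
    logp (cabs (orbit_a n (u p) (v p)))| < e / 3.
  rewrite ltr_norml; apply/andP; split.
    by rewrite ltrNl opprB; apply: le_lt_trans (logp_lipschitz _ _) _; rewrite distrC.
  exact: le_lt_trans (logp_lipschitz _ _) _.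
have {}k : `|(3 ^+ n)^-1 * logp (cabs (orbit_a n (u q) (v q))) -
    (3 ^+ n)^-1 * logp (cabs (orbit_a n (u p) (v p)))| < e / 3.
  rewrite -mulrBr normrM; apply: le_lt_trans k; rewrite ler_piMl//.
  rewrite ger0_norm ?invr_ge0 ?exprn_ge0// invf_le1 ?exprn_gt0//.
  by rewrite exprn_ege1//; lra.
rewrite ltr_norml; apply/andP; split; move: h1 h2 k hn; clear;
  rewrite !(ler_norml, ltr_norml); lra.
Unshelve. all: by end_near. Qed.

End GreenFunction.

Section EscapingOrbits.
Context {R : realType}.
Implicit Types (f g : R[i] -> R[i]) (r rho : R) (z w : R[i]).

Lemma Re_gt_half w : cabs (w - 1) <= 1 / 2 -> 1 / 2 <= complex.Re w.
Proof.
move=> h; have := le_trans (Re_le_cabs _) h.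
by rewrite raddfB ler_norml /=; lra.
Qed.

Lemma clog_bound w : cabs (w - 1) <= 1 / 2 -> cabs (clog w) <= 1 + pi / 2.
Proof.
move=> h; have cw0 : 1 / 2 <= cabs w.
  apply: le_trans (Re_gt_half h) _; apply: le_trans (ler_norm _) _.
  exact: Re_le_cabs.
have cw1 : cabs w <= 3 / 2.
  have := cabs_tri w 1 0; rewrite !subr0 cabs1; lra.
have c0 : 0 < cabs w by lra.
apply: le_trans (cabs_le_ReIm _) _; apply: lerD => /=.
  rewrite ler_norml; apply/andP; split.
    rewrite lerNl -lnV ?posrE//.
    have v2 : (cabs w)^-1 <= 2 by rewrite -[leLHS]div1r ler_pdivrMr//; lra.
    apply: (@le_trans _ _ ((cabs w)^-1 - 1)); last lra.
    have -> : ln (cabs w)^-1 = ln (1 + ((cabs w)^-1 - 1)) by congr ln; ring.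
    apply: le_ln1Dx; have : 0 < (cabs w)^-1 by rewrite invr_gt0.
    lra.
  have -> : ln (cabs w) = ln (1 + (cabs w - 1)) by congr ln; ring.
  by apply: le_trans (le_ln1Dx _) _; lra.
rewrite ler_norml; apply/andP; split; apply: ltW.
  exact: atan_gtNpi2.
exact: atan_ltpi2.
Qed.

Lemma cdiff_orbit (a b : R[i] -> R[i]) z n : cdiff a z -> cdiff b z ->
  cdiff (fun w => orbit_a n (a w) (b w)) z.
Proof.
move=> da db; elim: n => [|n IH]; first exact: da.
apply: cdiffD; last exact: db.
apply: cdiffB; first exact: (cdiffX 3 IH).
by apply: cdiffM; [apply: cdiffM; [exact: cdiff_cst|exact: (cdiffX 2 da)]|exact: IH].
Qed.

Lemma ln_cabs_local_Re g z rho : 0 < rho -> holo_ball g z rho -> g z != 0 ->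
  exists r Phi, [/\ 0 < r, r <= rho, holo_ball Phi z r & forall w,
    cabs (w - z) < r -> g w != 0 /\ ln (cabs (g w)) = complex.Re (Phi w)].
Proof.
move=> rho0 dg gz; have gz0 : 0 < cabs (g z) by rewrite cabs_gt0.
have g20 : 0 < cabs (g z) / 2 by rewrite divr_gt0.
have cg : continuous_at z g by apply: cdiff_cont; apply: dg; rewrite subrr cabs0.
have /contP /(_ _ g20)[s s0 Hs] := cg.
have q1 w : cabs (w - z) < s -> cabs (g w / g z - 1) <= 1 / 2.
  move=> /Hs h; have -> : g w / g z - 1 = (g w - g z) / g z by field.
  rewrite cabsM cabsV ler_pdivrMr//; lra.
exists (Num.min rho s), (fun w => (ln (cabs (g z)))%:C + clog (g w / g z)).
split; first by rewrite lt_min rho0.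
- by rewrite ge_min lexx.
- move=> w; rewrite lt_min => /andP[wr ws].
  apply: cdiffD; first exact: cdiff_cst.
  apply: (cdiff_comp (f := fun w => g w / g z)).
    by apply: cdiffM; [exact: dg|exact: cdiff_cst].
  by exists (g w / g z)^-1; apply: has_cderiv_clog; have := Re_gt_half (q1 w ws); lra.
move=> w; rewrite lt_min => /andP[_ ws].
have gw : g w != 0.
  apply/eqP => g0; have := Re_gt_half (q1 w ws); rewrite g0 mul0r /=; lra.
split=> //; rewrite raddfD /= -lnM ?posrE//; last first.
  by rewrite cabs_gt0 mulf_neq0// invr_neq0.
by rewrite -cabsM mulrCA divff// mulr1.
Qed.

Variables (a b : R[i] -> R[i]) (z0 : R[i]) (rho : R) (N : nat).
Let c n w := orbit_a n (a w) (b w).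
Let eta n w := (b w - 3 * a w ^+ 2 * c n w) / c n w ^+ 3.
Hypothesis rho0 : 0 < rho.
Hypothesis da : forall w, w != z0 -> cabs (w - z0) < rho -> cdiff a w.
Hypothesis db : forall w, w != z0 -> cabs (w - z0) < rho -> cdiff b w.
Hypothesis escN : forall w, w != z0 -> cabs (w - z0) < rho ->
  [/\ 2 <= cabs (c N w), 24 * cabs (a w) ^+ 2 <= cabs (c N w) ^+ 2 &
      8 * cabs (b w) <= cabs (c N w) ^+ 3].

Let esc n w : w != z0 -> cabs (w - z0) < rho ->
  [/\ 2 <= cabs (c (N + n) w),
      24 * cabs (a w) ^+ 2 <= cabs (c (N + n) w) ^+ 2 &
      8 * cabs (b w) <= cabs (c (N + n) w) ^+ 3].
Proof.
move=> wz wr; elim: n => [|n [c2 ca cb]]; first by rewrite addn0; exact: escN.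
have low := cubic_lower ca cb.
have mono : cabs (c (N + n) w) <= cabs (c (N + n.+1) w).
  rewrite addnS; apply: le_trans low.
  have : 2 * 2 <= cabs (c (N + n) w) ^+ 2 by rewrite expr2; apply: ler_pM.
  move: (cabs (c (N + n) w)) c2 => x x2 xx; rewrite exprSr; nra.
split; first exact: le_trans mono.
  by apply: le_trans ca _; apply: lerXn2r; rewrite ?nnegrE ?cabs_ge0.
by apply: le_trans cb _; apply: lerXn2r; rewrite ?nnegrE ?cabs_ge0.
Qed.

Let c_neq0 n w : w != z0 -> cabs (w - z0) < rho -> c (N + n) w != 0.
Proof. by move=> wz wr; rewrite -cabs_gt0; have [? _ _] := esc n wz wr; lra. Qed.

Let c_step n w : w != z0 -> cabs (w - z0) < rho ->
  c (N + n).+1 w = c (N + n) w ^+ 3 * (1 + eta (N + n) w).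
Proof.
move=> wz wr; rewrite /eta /c orbit_aS -/(c (N + n) w) /cubic.
by field; exact: c_neq0.
Qed.

Let eta_le n w : w != z0 -> cabs (w - z0) < rho -> cabs (eta (N + n) w) <= 1 / 4.
Proof.
move=> wz wr; have [c2 ca cb] := esc n wz wr.
have c0 : 0 < cabs (c (N + n) w) by lra.
rewrite /eta cabsM cabsV (cabsX (c (N + n) w)) ler_pdivrMr ?exprn_gt0//.
apply: le_trans (cabsDB _ _) _.
rewrite (cabsM _ (c (N + n) w)) (cabsM 3) (cabsX (a w)) cabs_nat.
have := ler_wpM2r (ltW c0) ca; rewrite -exprSr; lra.
Qed.

Let dc n w : w != z0 -> cabs (w - z0) < rho -> cdiff (c n) w.
Proof. by move=> wz wr; apply: cdiff_orbit; [exact: da|exact: db]. Qed.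

Let eta_ext n : exists e, [/\ holo_ball e z0 rho,
  forall w, w != z0 -> eta (N + n) w = e w &
  forall w, cabs (w - z0) < rho -> cabs (1 + e w - 1) <= 1 / 2].
Proof.
have [|e [de eE]] := @removable_singularity _ (eta (N + n)) z0 rho (1 / 4) rho0.
  move=> w wz wr; split; last exact: eta_le.
  apply: cdiff_div; first by rewrite expf_neq0// c_neq0.
    apply: cdiffB; first exact: db.
    apply: cdiffM; last exact: dc.
    by apply: cdiffM; [exact: cdiff_cst|apply: cdiffX; exact: da].
  by apply: cdiffX; exact: dc.
exists e; split=> // w wr; rewrite addrC addKr.
have [->{w wr}|wz] := eqVneq w z0; last first.
  by rewrite -eE//; have := eta_le n wz wr; lra.
have q0 : 0 < 1 / 4 :> R by lra.
have de0 : cdiff e z0 by apply: de; rewrite subrr cabs0.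
have [s s0 Hs] := near_close q0 de0.
have [|w [wz]] := @exists_in_punctured R z0 (Num.min rho s); first by rewrite lt_min rho0.
rewrite lt_min => /andP[wr ws]; have h1 := Hs w ws; have h2 := eta_le n wz wr.
have := cabs_tri (e z0) (e w) 0; rewrite !subr0 (cabsB (e z0)) -(eE _ wz).
by rewrite -(eE _ wz) in h1; lra.
Qed.

Lemma escape_factor n : exists e, [/\ holo_ball e z0 rho, e z0 != 0 &
  forall w, w != z0 -> cabs (w - z0) < rho ->
    c (N + n) w = c N w ^+ (3 ^ n) * e w].
Proof.
elim: n => [|n [e [de e0 eE]]].
  exists (fun=> 1); split; [by move=> w _; exact: cdiff_cst|exact: oner_neq0|].
  by move=> w _ _; rewrite addn0 expn0 expr1 mulr1.
have [f [df fE fb]] := eta_ext n.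
exists (fun w => e w ^+ 3 * (1 + f w)); split.
- move=> w wr; apply: cdiffM; first by apply: cdiffX; exact: de.
  by apply: cdiffD; [exact: cdiff_cst|exact: df].
- rewrite mulf_neq0 ?expf_neq0//; apply/eqP => f0.
  by have := Re_gt_half (fb z0 _); rewrite subrr cabs0 f0 /= => /(_ rho0); lra.
- move=> w wz wr; rewrite addnS c_step// eE// fE// exprMn -exprM expnSr.
  by rewrite mulrA.
Qed.

Lemma escape_green : exists Phi, holo_ball Phi z0 rho /\
  forall w, w != z0 -> cabs (w - z0) < rho ->
    Gplus (a w) (b w) = (3 ^+ N)^-1 * ln (cabs (c N w)) + complex.Re (Phi w).
Proof.
have [e He] := choice eta_ext.
pose F := fix F n w := if n is n'.+1 then
  F n' w + ((3 ^+ (N + n').+1)^-1)%:C * clog (1 + e n' w) else 0.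
have dF n : holo_ball (F n) z0 rho.
  elim: n => [|n IH] w wr /=; first exact: cdiff_cst.
  have [de _ eb] := He n.
  apply: cdiffD; first exact: IH.
  apply: cdiffM; first exact: cdiff_cst.
  apply: (cdiff_comp (f := fun w => 1 + e n w)).
    by apply: cdiffD; [exact: cdiff_cst|exact: de].
  by eexists; apply: has_cderiv_clog; have := Re_gt_half (eb w wr); lra.
pose C : R := 1 + pi / 2.
have C0 : 0 <= C by rewrite addr_ge0// divr_ge0// pi_ge0.
have FC n w : cabs (w - z0) < rho -> cabs (F n.+1 w - F n w) <= C / 3 ^+ n.
  move=> wr; rewrite /= addrC addKr cabsM cabs_real.
  have [_ _ eb] := He n.
  rewrite gtr0_norm ?invr_gt0 ?exprn_gt0// mulrC.
  apply: ler_pM; rewrite ?cabs_ge0 ?invr_ge0 ?exprn_ge0//.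
    by apply: clog_bound; exact: eb.
  rewrite lef_pV2 ?posrE ?exprn_gt0// -addnS.
  by rewrite ler_weXn2l// ?ler1n// addnS ltnW// ltnS leq_addl.
have [Phi [dPhi PhiE]] := holo_limit C0 dF FC.
exists Phi; split=> // w wz wr.
pose g m := (3 ^+ m)^-1 * ln (cabs (c m w)).
have gF n : complex.Re (F n w) = g (N + n)%N - g N.
  elim: n => [|n IH]; first by rewrite addn0 subrr.
  have [_ eE _] := He n.
  have [c2 _ _] := esc n wz wr.
  have c0 : 0 < cabs (c (N + n) w) by lra.
  rewrite /= raddfD /= IH /g addnS c_step// cabsM (cabsX (c (N + n) w)).
  have e10 : 1 + eta (N + n) w != 0.
    by apply/eqP => h; have := c_neq0 n.+1 wz wr; rewrite addnS c_step// h mulr0 eqxx.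
  rewrite lnM ?posrE ?exprn_gt0// ?cabs_gt0// lnXn// -(mulr_natl (ln _) 3).
  rewrite -(eE _ wz) mul0r subr0 exprS.
  by field; rewrite !gt_eqF ?exprn_gt0.
have [B [B1 aB bB]] := le_bound (a w) (b w).
have HG := cvg_green B1 aB bB; set K := green_const B in HG.
have K0 : 0 <= 2 * K.
  by have := le_trans (normr_ge0 _) (HG 0%N); rewrite expr0 divr1.
have e3 n : 0 < (3 : R) ^+ n by rewrite exprn_gt0.
have : (complex.Re (Phi w))%:C = (Gplus (a w) (b w) - g N)%:C.
  apply: (@geometric_limit_uniq _ (fun n => (complex.Re (F n w))%:C) (4 * C + 2 * K)).
    move=> n; rewrite -rmorphB cabs_real -raddfB.
    apply: le_trans (Re_le_cabs _) _; apply: le_trans (PhiE n w wr) _.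
    by rewrite ler_pM2r ?invr_gt0// lerDl.
  move=> n; rewrite -rmorphB cabs_real gF.
  have -> : g (N + n)%N - g N - (Gplus (a w) (b w) - g N) = g (N + n)%N - Gplus (a w) (b w).
    by ring.
  have [c2 _ _] := esc n wz wr.
  have := HG (N + n)%N; rewrite logp_ln -/(c _ _); last by rewrite /c in c2 *; lra.
  move=> /le_trans; apply.
  apply: (@le_trans _ _ (2 * K / 3 ^+ n)).
    rewrite ler_wpM2l// lef_pV2 ?posrE// ler_weXn2l ?ler1n//.
    exact: leq_addl.
  by rewrite ler_pM2r ?invr_gt0// lerDr mulr_ge0.
by move=> /complexI ->; rewrite addrC subrK.
Qed.

End EscapingOrbits.

Section BoundedOrbits.
Context {R : realType}.
Implicit Types (f g q : R[i] -> R[i]) (r rho M : R) (z w : R[i]).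

Lemma removable_near f z rho : 0 < rho ->
  (forall w, w != z -> cabs (w - z) < rho -> cdiff f w) ->
  (exists M r, 0 < r /\
    forall w, w != z -> cabs (w - z) < r -> cabs (f w) <= M) ->
  exists g, holo_ball g z rho /\ forall w, w != z -> f w = g w.
Proof.
move=> rho0 df [M [r [r0 fM]]].
have s0 : 0 < Num.min r rho by rewrite lt_min r0.
have [|g [dg fg]] := @removable_singularity _ f z (Num.min r rho) M s0.
  by move=> w wz; rewrite lt_min => /andP[wr wrho]; split; [exact: df|exact: fM].
exists g; split=> // w wrho; have [->{w wrho}|wz] := eqVneq w z.
  by apply: dg; rewrite subrr cabs0.
have wz0 : 0 < cabs (w - z) by rewrite cabs_gt0 subr_eq0.
apply: (@cdiff_near _ _ f); last exact: df.
apply/nearC; exists (cabs (w - z)) => // x xw; apply/esym/fg.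
by apply: contraTneq xw => ->; rewrite cabsB ltxx.
Qed.

Variables (a b e : R[i] -> R[i]) (z0 : R[i]) (rho : R) (m : nat).
Let c n w := orbit_a n (a w) (b w).
Let eps w := (w - z0) ^+ m * e w.
Hypothesis rho0 : 0 < rho.
Hypothesis m0 : (0 < m)%N.
Hypothesis da : forall w, w != z0 -> cabs (w - z0) < rho -> cdiff a w.
Hypothesis db : forall w, w != z0 -> cabs (w - z0) < rho -> cdiff b w.
Hypothesis de : holo_ball e z0 rho.
Hypothesis e0 : e z0 != 0.
Hypothesis aE : forall w, w != z0 -> cabs (w - z0) < rho ->
  a w != 0 /\ (a w)^-1 = eps w.
Hypothesis bounded : forall n, exists M r, 0 < r /\
  forall w, w != z0 -> cabs (w - z0) < r -> cabs (c n w / a w) <= M.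

Let ctr : cabs (z0 - z0) < rho.
Proof. by rewrite subrr cabs0; exact: rho0. Qed.

Let deps : holo_ball eps z0 rho.
Proof.
by move=> w wr; apply: cdiffM; [apply: cdiffX; exact: cdiff_shift|exact: de].
Qed.

Let eps0 : eps z0 = 0.
Proof. by rewrite /eps subrr expr0n eqn0Ngt m0 mul0r. Qed.

Let eps_neq0 w : w != z0 -> cabs (w - z0) < rho -> eps w != 0.
Proof. by move=> wz wr; have [an <-] := aE wz wr; rewrite invr_neq0. Qed.

Let W_ex : exists W : nat -> R[i] -> R[i], forall n, holo_ball (W n) z0 rho /\
  forall w, w != z0 -> c n w / a w = W n w.
Proof.
suff H n : exists f, holo_ball f z0 rho /\
    forall w, w != z0 -> c n w / a w = f w by have [W HW] := choice H; exists W.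
apply: (removable_near rho0); last exact: bounded.
move=> w wz wr; have [an _] := aE wz wr.
apply: cdiff_div; [exact: an| |exact: da].
by apply: cdiff_orbit; [exact: da|exact: db].
Qed.

Section Normalized.
Variable W : nat -> R[i] -> R[i].
Hypothesis dW : forall n, holo_ball (W n) z0 rho.
Hypothesis WE : forall n w, w != z0 -> c n w / a w = W n w.

Let dWz n : cdiff (W n) z0. Proof. exact: dW ctr. Qed.

Let W0 w : w != z0 -> cabs (w - z0) < rho -> W 0 w = 1.
Proof.
by move=> wz wr; rewrite -WE// /c /orbit_a /= divff//; have [] := aE wz wr.
Qed.

Let WS n w : cabs (w - z0) < rho ->
  eps w ^+ 2 * W n.+1 w = (W n w - 1) ^+ 2 * (W n w + 2) + eps w ^+ 2 * W 1 w.
Proof.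
have off x : x != z0 -> cabs (x - z0) < rho ->
    eps x ^+ 2 * W n.+1 x = (W n x - 1) ^+ 2 * (W n x + 2) + eps x ^+ 2 * W 1 x.
  move=> xz xr; have [an <-] := aE xz xr; rewrite -!WE// /c !orbit_aS /cubic.
  by rewrite -/(c n x) /orbit_a /=; field.
move=> wr; have [->|wz] := eqVneq w z0; last exact: off.
apply: (eq_at_center rho0 _ _ off).
  by apply: cdiffM; [apply: cdiffX; exact: deps|exact: dWz].
apply: cdiffD; last by apply: cdiffM; [apply: cdiffX; exact: deps|exact: dWz].
apply: cdiffM; last by apply: cdiffD; [exact: dWz|exact: cdiff_cst].
by apply: cdiffX; apply: cdiffB; [exact: dWz|exact: cdiff_cst].
Qed.

Let Wctr n : W n z0 = 1 \/ W n z0 = -2.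
Proof.
have := WS n ctr; rewrite eps0 expr0n /= !mul0r addr0 => /esym/eqP.
rewrite mulf_eq0 expf_eq0 /= subr_eq0 addr_eq0 => /orP[/eqP|/eqP]; first by left.
by right.
Qed.

Let Wctr_le n : cabs (W n z0) <= 2.
Proof. by case: (Wctr n) => ->; rewrite ?cabsN ?cabs1 ?cabs_nat//; lra. Qed.

Let sW n w := (W n w - W n z0) / eps w.

Let sW_eq n w : w != z0 -> cabs (w - z0) < rho ->
  (W n z0 = 1 -> sW n w ^+ 2 * (W n w + 2) = W n.+1 w - W 1 w) /\
  (W n z0 = -2 -> sW n w * (W n w - 1) ^+ 2 = eps w * (W n.+1 w - W 1 w)).
Proof.
move=> wz wr; have en := eps_neq0 wz wr; have E := WS n wr.
split=> Wz; rewrite /sW Wz; apply: (mulfI (expf_neq0 2 en)).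
  rewrite mulrBr E; field; exact: en.
have -> : eps w ^+ 2 * (eps w * (W n.+1 w - W 1 w)) =
  eps w * (eps w ^+ 2 * W n.+1 w - eps w ^+ 2 * W 1 w) by ring.
rewrite E; field; exact: en.
Qed.

Let sW_bounded n : exists M r, 0 < r /\
  forall w, w != z0 -> cabs (w - z0) < r -> cabs (sW n w) <= M.
Proof.
have [r1 r10 H1] := near_close ltr01 (dWz n).
have dD : cdiff (fun w => W n.+1 w - W 1 w) z0 by apply: cdiffB; exact: dWz.
have [r2 r20 H2] := near_close ltr01 dD.
have [r3 r30 H3] := near_close ltr01 (deps ctr).
set M := cabs (W n.+1 z0 - W 1 z0) + 1.
have M1 : 1 <= M by rewrite lerDr cabs_ge0.
exists M, (Num.min rho (Num.min r1 (Num.min r2 r3))); split.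
  by rewrite !lt_min rho0 r10 r20.
move=> w wz; rewrite !lt_min => /andP[wr /andP[w1 /andP[w2 w3]]].
have [S1 S2] := sW_eq n wz wr.
have h1 := H1 w w1; have h2 := H2 w w2; have h3 := H3 w w3.
rewrite eps0 subr0 in h3.
have {}h2 : cabs (W n.+1 w - W 1 w) <= M.
  have := cabs_tri (W n.+1 w - W 1 w) (W n.+1 z0 - W 1 z0) 0.
  by rewrite !subr0 /M; lra.
have [Wz|Wz] := Wctr n; rewrite Wz in h1.
  have h4 : 2 <= cabs (W n w + 2).
    have := cabs_lowB 3 (1 - W n w); rewrite cabsB cabs_nat.
    rewrite (_ : (1 - W n w) - 3 = - (W n w + 2)) ?cabsN; last by ring.
    rewrite cabsB; lra.
  have := congr1 (@cabs R) (S1 Wz); rewrite cabsM cabsX.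
  move: (cabs (sW n w)) (cabs_ge0 (sW n w)) (cabs (W n w + 2)) h4 => x x0 y y2 E.
  rewrite leNgt; apply/negP => Mx.
  have : 2 * x ^+ 2 <= M by rewrite -{}E in h2; apply: le_trans h2; rewrite mulrC ler_wpM2l ?sqr_ge0.
  have : 1 * x <= x * x by rewrite ler_wpM2r//; lra.
  rewrite expr2; lra.
have h4 : 2 <= cabs (W n w - 1).
  have := cabs_lowB 3 (W n w + 2); rewrite cabs_nat.
  rewrite (_ : 3 - (W n w + 2) = - (W n w - 1)) ?cabsN; last by ring.
  by rewrite opprK in h1; lra.
have := congr1 (@cabs R) (S2 Wz); rewrite cabsM (cabsX (W n w - 1)) (cabsM (eps w)).
have h5 : cabs (eps w) * cabs (W n.+1 w - W 1 w) <= 1 * M.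
  by apply: ler_pM; rewrite ?cabs_ge0// ltW.
have h6 : 1 <= cabs (W n w - 1) ^+ 2 by rewrite exprn_ege1//; lra.
have := ler_wpM2l (cabs_ge0 (sW n w)) h6; lra.
Qed.

Let chi n : exists s q, [/\ cabs s <= 2, holo_ball q z0 rho &
  forall w, cabs (w - z0) < rho ->
    W n w = W n z0 + s * eps w + (w - z0) ^+ m.+1 * q w].
Proof.
have dsW w : w != z0 -> cabs (w - z0) < rho -> cdiff (sW n) w.
  move=> wz wr; apply: cdiff_div; [exact: eps_neq0| |exact: deps].
  by apply: cdiffB; [exact: dW|exact: cdiff_cst].
have [S [dS SE]] := removable_near rho0 dsW (sW_bounded n).
have dSz := dS _ ctr.
have [p [dp pE]] := holo_div rho0 dS.
exists (S z0), (fun w => p w * e w); split; first last.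
- move=> w wr; have [->|wz] := eqVneq w z0.
    by rewrite eps0 mulr0 addr0 subrr expr0n mul0r addr0.
  have en := eps_neq0 wz wr.
  have -> : W n w = W n z0 + sW n w * eps w by rewrite /sW divfK// addrC subrK.
  by rewrite SE// (pE w) exprSr /eps; ring.
- by move=> w wr; apply: cdiffM; [exact: dp|exact: de].
have [Wz|Wz] := Wctr n.
  have : S z0 ^+ 2 * (W n z0 + 2) = W n.+1 z0 - W 1 z0.
    apply: (@eq_at_center R (fun w => S w ^+ 2 * (W n w + 2))
      (fun w => W n.+1 w - W 1 w) z0 rho rho0).
    - apply: cdiffM; first exact: (cdiffX 2 dSz).
      by apply: cdiffD; [exact: dWz|exact: cdiff_cst].
    - by apply: cdiffB; exact: dWz.
    - by move=> w wz wr; rewrite -SE//; exact: (sW_eq n wz wr).1.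
  move/(congr1 (@cabs R)); rewrite cabsM (cabsX (S z0)) Wz.
  have -> : (1 + 2 : R[i]) = 3%:R by rewrite -[RHS](@natrD _ 1 2).
  rewrite cabs_nat => E.
  have : cabs (W n.+1 z0 - W 1 z0) <= 2 + 2.
    by apply: le_trans (cabsDB _ _) _; apply: lerD; exact: Wctr_le.
  rewrite -E; have := cabs_ge0 (S z0).
  move: (cabs (S z0)) => x x0 h; rewrite leNgt; apply/negP => x2.
  have : 2 * 2 <= x ^+ 2 by rewrite expr2; apply: ler_pM => //; exact: ltW.
  lra.
have : S z0 * (W n z0 - 1) ^+ 2 = eps z0 * (W n.+1 z0 - W 1 z0).
  apply: (@eq_at_center R (fun w => S w * (W n w - 1) ^+ 2)
    (fun w => eps w * (W n.+1 w - W 1 w)) z0 rho rho0).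
  - apply: cdiffM; first exact: dSz.
    by apply: cdiffX; apply: cdiffB; [exact: dWz|exact: cdiff_cst].
  - by apply: cdiffM; [exact: deps|apply: cdiffB; exact: dWz].
  - by move=> w wz wr; rewrite -SE//; exact: (sW_eq n wz wr).2.
rewrite eps0 mul0r => /eqP; rewrite mulf_eq0 expf_eq0 /= Wz => /orP[/eqP ->|].
  by rewrite cabs0.
rewrite (_ : -2 - 1 = - (3%:R : R[i])); last by ring.
by rewrite oppr_eq0 pnatr_eq0.
Qed.

Let scale : exists r1 A, [/\ 0 < r1, r1 <= 1 / 2, r1 < rho & 1 <= A] /\
  forall w, w != z0 -> cabs (w - z0) <= r1 ->
    [/\ cabs (eps w) <= 1 / 4, cabs (W 1 w) <= 3 &
        cabs (a w) <= A / cabs (w - z0) ^+ m].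
Proof.
have q0 : 0 < 1 / 4 :> R by lra.
have [r1 r10 H1] := near_close q0 (deps ctr).
have [r2 r20 H2] := near_close ltr01 (dWz 1).
have ez : 0 < cabs (e z0) / 2 by rewrite divr_gt0// cabs_gt0.
have [r3 r30 H3] := near_close ez (de ctr).
exists (Num.min (1 / 2) (Num.min rho (Num.min r1 (Num.min r2 r3))) / 2).
set r := Num.min _ _; have r0 : 0 < r by rewrite !lt_min rho0 r10 r20 r30; lra.
have rr : r / 2 < r by rewrite ltr_pdivrMr//; lra.
have : r / 2 < r by []; rewrite {2}/r !lt_min.
move=> /andP[h /andP[hrho /andP[h1 /andP[h2 h3]]]].
exists (1 + 2 / cabs (e z0)); split.
  split; [by rewrite divr_gt0|exact: ltW|exact: hrho|].
  by rewrite lerDl divr_ge0// cabs_ge0.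
move=> w wz wr; have wrho := le_lt_trans wr hrho.
have k1 := H1 w (le_lt_trans wr h1); have k2 := H2 w (le_lt_trans wr h2).
have k3 := H3 w (le_lt_trans wr h3); rewrite eps0 subr0 in k1.
split; first exact: ltW.
  have := cabs_tri (W 1 w) (W 1 z0) 0; rewrite !subr0; have := Wctr_le 1; lra.
have ew : cabs (e z0) / 2 <= cabs (e w).
  have := cabs_tri (e z0) (e w) 0; rewrite !subr0 (cabsB (e z0)); lra.
have [an aw] := aE wz wrho.
have u0 : 0 < cabs (w - z0) ^+ m by rewrite exprn_gt0// cabs_gt0 subr_eq0.
have -> : a w = (eps w)^-1 by rewrite -aw invrK.
rewrite cabsV /eps cabsM cabsX invfM mulrC ler_pM2r ?invr_gt0//.
have ez0 : 0 < cabs (e z0) by rewrite cabs_gt0.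
apply: (@le_trans _ _ (2 / cabs (e z0))); last lra.
rewrite -[leRHS]invrK lef_pV2 ?posrE ?invr_gt0 ?divr_gt0//; last lra.
by rewrite invfM invrK mulrC.
Qed.

Section Growth.
Variables (r1 A : R).
Hypotheses (r10 : 0 < r1) (r1h : r1 <= 1 / 2) (r1rho : r1 < rho) (A1 : 1 <= A).
Hypothesis scaled : forall w, w != z0 -> cabs (w - z0) <= r1 ->
  [/\ cabs (eps w) <= 1 / 4, cabs (W 1 w) <= 3 &
      cabs (a w) <= A / cabs (w - z0) ^+ m].

Let a_ge4 w : w != z0 -> cabs (w - z0) <= r1 -> 4 <= cabs (a w).
Proof.
move=> wz wr; have [e4 _ _] := scaled wz wr.
have [an aw] := aE wz (le_lt_trans wr r1rho).
have ew : 0 < cabs (eps w) by rewrite cabs_gt0 eps_neq0//; exact: le_lt_trans r1rho.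
rewrite -[leRHS]invrK -cabsV aw -[leLHS]invrK lef_pV2 ?posrE ?invr_gt0//; lra.
Qed.

Let V n w := 2 * cabs (a w) * (cabs (W n w) + 3).

Let V_step n w : w != z0 -> cabs (w - z0) <= r1 -> V n.+1 w <= V n w ^+ 3.
Proof.
move=> wz wr; have [e4 W13 _] := scaled wz wr; have a4 := a_ge4 wz wr.
have wr' := le_lt_trans wr r1rho.
have [an aw] := aE wz wr'.
have E : W n.+1 w = a w ^+ 2 * ((W n w - 1) ^+ 2 * (W n w + 2)) + W 1 w.
  have en : eps w ^+ 2 != 0 by rewrite expf_neq0// eps_neq0.
  apply: (mulfI en); rewrite (WS n wr') [RHS]mulrDr; congr (_ + _).
  by rewrite -aw; field.
set x := cabs (a w) in a4 *; set y := cabs (W n w).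
have y0 : 0 <= y := cabs_ge0 _.
have h : cabs (W n.+1 w) <= x ^+ 2 * ((y + 1) ^+ 2 * (y + 2)) + 3.
  rewrite E; apply: le_trans (cabsD _ _) _; apply: lerD => //.
  rewrite (cabsM (a w ^+ 2)) (cabsM _ (W n w + 2)) !cabsX -/x.
  apply: ler_wpM2l; first exact: sqr_ge0.
  apply: ler_pM; rewrite ?sqr_ge0 ?cabs_ge0//.
    apply: lerXn2r; rewrite ?nnegrE ?cabs_ge0 ?addr_ge0//.
    by apply: le_trans (cabsDB _ _) _; rewrite cabs1.
  by apply: le_trans (cabsD _ _) _; rewrite cabs_nat.
have -> : V n.+1 w = 2 * x * (cabs (W n.+1 w) + 3) by [].
have -> : V n w = 2 * x * (y + 3) by [].
have x16 : 1 <= x ^+ 2 by rewrite exprn_ege1//; lra.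
have h2 : cabs (W n.+1 w) + 3 <= x ^+ 2 * (y + 3) ^+ 3.
  have k : (y + 1) ^+ 2 * (y + 2) + 6 <= (y + 3) ^+ 3.
    have := mulr_ge0 y0 y0; have := mulr_ge0 (mulr_ge0 y0 y0) y0; lra.
  have := ler_wpM2l (sqr_ge0 x) k; lra.
have x0 : 0 <= 2 * x by lra.
apply: le_trans (ler_wpM2l x0 h2) _.
have p0 : 0 <= x * x ^+ 2 * (y + 3) ^+ 3.
  by rewrite !mulr_ge0 ?sqr_ge0 ?exprn_ge0//; lra.
have -> : (2 * x * (y + 3)) ^+ 3 = 8 * (x * x ^+ 2 * (y + 3) ^+ 3) by ring.
lra.
Qed.

Let V_ge1 n w : w != z0 -> cabs (w - z0) <= r1 -> 1 <= V n w.
Proof.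
move=> wz wr; have a4 := a_ge4 wz wr; rewrite -[leLHS]mulr1.
by apply: ler_pM => //; [lra|have := cabs_ge0 (W n w); lra].
Qed.

Let V_iter n k w : w != z0 -> cabs (w - z0) <= r1 ->
  V (n + k) w <= V n w ^+ (3 ^ k).
Proof.
move=> wz wr; elim: k => [|k IH]; first by rewrite addn0 expn0 expr1.
rewrite addnS expnSr exprM; apply: le_trans (V_step _ wz wr) _.
have v1 := V_ge1 (n + k) wz wr; have v2 := V_ge1 n wz wr.
apply: lerXn2r => //; rewrite nnegrE; first lra.
by rewrite exprn_ge0//; lra.
Qed.

Let valid n r := [/\ 0 < r, r <= r1 &
  forall w, cabs (w - z0) = r -> cabs (W n w) <= 3].

Let B r := 12 * A / r ^+ m.

Let B_ge r : 0 < r -> r <= r1 -> 12 * 2 ^+ m <= B r.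
Proof.
move=> r0 rr; rewrite /B ler_pdivlMr ?exprn_gt0// -mulrA -exprMn.
apply: (@le_trans _ _ (12 * 1)); last by rewrite ler_pM2l.
rewrite ler_pM2l// exprn_ile1//; first by rewrite mulr_ge0// ltW.
by move: rr r1h; lra.
Qed.

Let circ_bound n k r w : valid n r -> cabs (w - z0) = r ->
  cabs (W (n + k) w) <= B r ^+ (3 ^ k).
Proof.
move=> [r0 rr H] wr; have wz : w != z0.
  by rewrite -subr_eq0 -cabs_gt0 wr.
have wr1 : cabs (w - z0) <= r1 by rewrite wr.
have [_ _ aA] := scaled wz wr1; rewrite wr in aA.
have a4 := a_ge4 wz wr1.
have VB : V n w <= B r.
  rewrite /V /B; have := H w wr; have := cabs_ge0 (W n w) => w0 w3.
  have : 2 * cabs (a w) * (cabs (W n w) + 3) <= 2 * cabs (a w) * 6.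
    by apply: ler_wpM2l; lra.
  lra.
have v1 := V_ge1 n wz wr1.
apply: (@le_trans _ _ (V (n + k) w)).
  have w0 := cabs_ge0 (W (n + k) w); rewrite /V.
  have : 1 * (cabs (W (n + k) w) + 3) <= 2 * cabs (a w) * (cabs (W (n + k) w) + 3).
    by apply: ler_wpM2r; lra.
  lra.
apply: le_trans (V_iter n k wz wr1) _.
by apply: lerXn2r => //; rewrite nnegrE; lra.
Qed.

Let on_circle r t : 0 < r -> cabs (z0 + circ0 r t - z0) = r.
Proof. by move=> r0; rewrite addrC addKr cabs_circ0 gtr0_norm. Qed.

Let green_bound n r w : valid n r -> w != z0 -> cabs (w - z0) <= r / 2 ->
  Gplus (a w) (b w) <= ln (B r) / 3 ^+ n.
Proof.
move=> vr wz wr; have [r0 rr H] := vr.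
have wr1 : cabs (w - z0) <= r1 by lra.
have a4 := a_ge4 wz wr1; have Bge := B_ge r0 rr.
have m2 : 1 <= 2 ^+ m :> R by rewrite exprn_ege1// ler1n.
have B1 : 1 <= B r by lra.
have B0 : 0 < B r by lra.
apply: (@Gplus_le _ _ _ _ (ln (4 * cabs (a w))) n) => k.
have dWr x : cabs (x - z0) <= r -> cdiff (W (n + k)) x.
  move=> xr; apply: dW; apply: le_lt_trans xr _; exact: le_lt_trans r1rho.
have := max_bound r0 dWr (M := B r ^+ (3 ^ k)) _ wr.
move=> /(_ (fun t _ => circ_bound k vr (on_circle t r0))) hW.
have BX : 1 <= B r ^+ (3 ^ k) by rewrite exprn_ege1.
have [an _] := aE wz (le_lt_trans wr1 r1rho).
have cE : c (n + k) w = a w * W (n + k) w by rewrite -WE// mulrCA divff// mulr1.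
have hc : cabs (orbit_a (n + k) (a w) (b w)) <= 4 * cabs (a w) * B r ^+ (3 ^ k).
  rewrite -/(c _ _) cE cabsM.
  have := ler_wpM2l (cabs_ge0 (a w)) hW; lra.
have e30 : 0 < (3 : R) ^+ n by rewrite exprn_gt0.
have e31 : 0 < (3 : R) ^+ k by rewrite exprn_gt0.
have a40 : 1 <= 4 * cabs (a w) by lra.
have X1 : 1 <= 4 * cabs (a w) * B r ^+ (3 ^ k).
  by rewrite -[leLHS]mulr1; apply: ler_pM.
have lX : logp (cabs (orbit_a (n + k) (a w) (b w))) <=
    ln (4 * cabs (a w)) + 3 ^+ k * ln (B r).
  apply: le_trans (logp_le hc) _; rewrite logp_ln// lnM ?posrE; try lra.
  by rewrite lnXn// -(mulr_natl (ln (B r))) natrX.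
have i0 : 0 <= (3 ^+ (n + k) : R)^-1 by rewrite invr_ge0 exprn_ge0.
apply: le_trans (ler_wpM2l i0 lX) _.
have l0 : 0 <= ln (4 * cabs (a w)) by rewrite ln_ge0.
have -> : (3 ^+ (n + k) : R)^-1 * (ln (4 * cabs (a w)) + 3 ^+ k * ln (B r)) =
  ln (B r) / 3 ^+ n + ln (4 * cabs (a w)) / 3 ^+ k / 3 ^+ n.
  by rewrite exprD; field; rewrite !gt_eqF.
rewrite lerD2l ler_pdivrMr// ler_peMr//.
  by rewrite divr_ge0// ltW.
by rewrite exprn_ege1// ler1n.
Qed.

Let kappa : R := m%:R / m.+1%:R + 3 / 3 ^+ m.+2.

Let kappa_ge0 : 0 <= kappa.
Proof. by rewrite addr_ge0// divr_ge0// exprn_ge0. Qed.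

Let kappa_lt1 : kappa < 1.
Proof.
have h : (m.+1%:R : R) < 3 ^+ m.+1.
  by rewrite -natrX ltr_nat; exact: ltn_expl.
have -> : kappa = 1 - m.+1%:R^-1 + (3 ^+ m.+1)^-1.
  by rewrite /kappa [in 3 ^+ m.+2]exprS -natr1; field; rewrite ?natr1 ?expf_neq0 ?pnatr_eq0.
have : (3 ^+ m.+1)^-1 < m.+1%:R^-1 :> R.
  by rewrite ltf_pV2 ?posrE ?exprn_gt0.
by move: (_^-1) (m.+1%:R^-1) => x y; lra.
Qed.

Let step n r : valid n r -> exists r', valid (n + m.+2) r' /\
  ln (B r') / 3 ^+ (n + m.+2) <= kappa * (ln (B r) / 3 ^+ n).
Proof.
move=> vr; have [r0 rr H] := vr; set k := m.+2.
have Bge := B_ge r0 rr.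
have m2 : 1 <= 2 ^+ m :> R by rewrite exprn_ege1// ler1n.
have B12 : 12 <= B r by lra.
have B0 : 0 < B r by lra.
set X := B r ^+ (3 ^ k).
have X1 : B r <= X by rewrite /X ler_eXnr ?expn_gt0//; lra.
have X0 : 0 < 16 * X by lra.
pose t := expR (- (ln (16 * X) / m.+1%:R)).
have t0 : 0 < t := expR_gt0 _.
have tm : t ^+ m.+1 = (16 * X)^-1.
  by rewrite -expRM_natr mulNr divfK ?pnatr_eq0// expRN lnK// posrE.
have t2 : t <= 1 / 2.
  rewrite leNgt; apply/negP => h.
  have : (1 / 2) ^+ m.+1 < t ^+ m.+1 by rewrite ltr_pXn2r ?nnegrE// ?ltW//; lra.
  rewrite tm expr_div_n expr1n div1r ltf_pV2 ?posrE ?exprn_gt0// exprS; lra.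
have rt0 : 0 < r * t by rewrite mulr_gt0.
have rth : r * t <= r / 2 by have := ler_wpM2l (ltW r0) t2; lra.
exists (r * t); split.
  split=> //; first by lra.
  move=> w wr; have wz : w != z0 by rewrite -subr_eq0 -cabs_gt0 wr.
  have wr1 : cabs (w - z0) <= r1 by lra.
  have [s [q [s2 dq WX]]] := chi (n + k).
  have d1 : r < rho := le_lt_trans rr r1rho.
  have e4 x : x != z0 -> cabs (x - z0) <= r1 ->
      cabs (W (n + k) z0 + s * eps x) <= 5 / 2.
    move=> xz xr; have [ex _ _] := scaled xz xr.
    apply: le_trans (cabsD _ _) _; have := Wctr_le (n + k).
    have : cabs (s * eps x) <= 2 * (1 / 4).
      by rewrite cabsM; apply: ler_pM; rewrite ?cabs_ge0.
    lra.
  pose D x := (x - z0) ^+ m.+1 * q x.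
  have DE x : cabs (x - z0) < rho -> D x = W (n + k) x - (W (n + k) z0 + s * eps x).
    by move=> xr; rewrite (WX x xr) /D; ring.
  have Dc u : 0 <= u <= 2 * pi -> cabs (D (z0 + circ0 r u)) <= 2 * X.
    move=> _; have ur := on_circle u r0.
    have uz : z0 + circ0 r u != z0 by rewrite -subr_eq0 -cabs_gt0 ur.
    rewrite DE ?ur//; apply: le_trans (cabsDB _ _) _.
    have := circ_bound k vr ur; rewrite -/X.
    have := e4 _ uz; rewrite ur => /(_ rr); lra.
  have := schwarz r0 d1 dq (fun x => erefl (D x)) Dc (w := w).
  rewrite wr => /(_ rth).
  have -> : r * t / r = t by field; rewrite gt_eqF.
  rewrite tm => hD.
  have hD' : cabs (D w) <= 1 / 2.
    apply: le_trans hD _; rewrite le_eqVlt; apply/orP; left; apply/eqP.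
    by field; rewrite gt_eqF//; lra.
  have wrho := le_lt_trans wr1 r1rho.
  have := cabs_tri (W (n + k) w) (W (n + k) z0 + s * eps w) 0.
  rewrite !subr0 -(DE w wrho).
  have := e4 w wz wr1; lra.
have lB : 0 < ln (B r) by rewrite ln_gt0//; lra.
have l16 : ln 16 <= 2 * ln (B r).
  rewrite (mulr_natl (ln (B r)) 2) -lnXn// ler_ln ?posrE ?exprn_gt0//.
  have : 12 * 12 <= B r * B r by apply: ler_pM.
  rewrite expr2; lra.
set la := m%:R / m.+1%:R : R.
have la0 : 0 <= la by rewrite divr_ge0.
have la1 : la <= 1 by rewrite ler_pdivrMr// mul1r ler_nat.
have lBt : ln (B (r * t)) = ln (B r) + la * (ln 16 + 3 ^+ k * ln (B r)).
  have -> : B (r * t) = B r * t^-1 ^+ m.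
    by rewrite /B exprMn invfM exprVn mulrA.
  rewrite lnM ?posrE ?exprn_gt0 ?invr_gt0// lnXn ?invr_gt0//; congr (_ + _).
  rewrite lnV ?posrE// /t expRK opprK lnM ?posrE//; last lra.
  rewrite /X lnXn// -(mulr_natl (ln (B r))) natrX -mulr_natl /la; ring.
rewrite lBt exprD.
have e3 : 0 < (3 : R) ^+ n by rewrite exprn_gt0.
have e3k : 0 < (3 : R) ^+ k by rewrite exprn_gt0.
have -> : kappa * (ln (B r) / 3 ^+ n) =
   (3 * ln (B r) + la * (3 ^+ k * ln (B r))) / (3 ^+ n * 3 ^+ k).
  by rewrite /kappa -/k -/la; field; rewrite !gt_eqF.
have p3 : 0 < (3 ^+ n * 3 ^+ k : R)^-1 by rewrite invr_gt0 mulr_gt0.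
rewrite (ler_pM2r p3).
have h16 : la * ln 16 <= 1 * (2 * ln (B r)).
  by apply: ler_pM => //; rewrite ln_ge0// ler1n.
have -> : la * (ln 16 + 3 ^+ k * ln (B r)) =
  la * ln 16 + la * (3 ^+ k * ln (B r)) by ring.
rewrite addrA lerD2r; lra.
Qed.

Let small_ratio j : exists n r, valid n r /\ ln (B r) / 3 ^+ n <= kappa ^+ j * ln (B r1).
Proof.
elim: j => [|j [n [r [vr IH]]]].
  exists 0%N, r1; split; last by rewrite !expr0 divr1 mul1r.
  split=> // w wr; rewrite W0 ?cabs1 ?wr//; first by lra.
  by rewrite -subr_eq0 -cabs_gt0 wr.
have [r' [vr' h]] := step vr; exists (n + m.+2)%N, r'; split=> //.
by apply: le_trans h _; rewrite exprS -mulrA ler_wpM2l.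
Qed.

Lemma growth_green_small (d : R) : 0 < d -> exists2 r, 0 < r &
  forall w, w != z0 -> cabs (w - z0) < r -> Gplus (a w) (b w) <= d.
Proof.
move=> d0; have [j hj] := exprn_small (ln (B r1)) kappa_ge0 kappa_lt1 d0.
have [n [r [vr h]]] := small_ratio j; have [r0 _ _] := vr.
exists (r / 2); first by rewrite divr_gt0.
move=> w wz /ltW wr; apply: le_trans (green_bound vr wz wr) _.
by apply: le_trans h _; exact: ltW.
Qed.

End Growth.

Lemma bounded_green_small (d : R) : 0 < d -> exists2 r, 0 < r &
  forall w, w != z0 -> cabs (w - z0) < r -> Gplus (a w) (b w) <= d.
Proof.
by move=> d0; have [r1 [A [[r10 r1h r1rho A1] H]]] := scale; exact: growth_green_small r10 r1h r1rho A1 H d d0.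
Qed.

End Normalized.

Lemma nonescape_small (d : R) : 0 < d -> exists2 r, 0 < r &
  forall w, w != z0 -> cabs (w - z0) < r -> Gplus (a w) (b w) <= d.
Proof.
move=> d0; have [W HW] := W_ex.
exact: (bounded_green_small (fun n => (HW n).1) (fun n => (HW n).2) d0).
Qed.

End BoundedOrbits.

Section LocalOrders.
Context {R : realType}.
Implicit Types (f g : R[i] -> R[i]) (z w : R[i]) (k : int) (P Q : R[i] -> Prop).

Definition pnear z P :=
  exists2 r : R, 0 < r & forall w, w != z -> cabs (w - z) < r -> P w.

Lemma pnearS z P Q : (forall w, w != z -> P w -> Q w) -> pnear z P -> pnear z Q.
Proof. by move=> PQ [r r0 H]; exists r => // w wz wr; apply: PQ => //; exact: H. Qed.

Lemma pnearI z P Q : pnear z P -> pnear z Q -> pnear z (fun w => P w /\ Q w).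
Proof.
move=> [r r0 H] [s s0 K]; exists (Num.min r s); first by rewrite lt_min r0.
by move=> w wz; rewrite lt_min => /andP[wr ws]; split; [exact: H|exact: K].
Qed.

Lemma pnearT z P : (forall w, w != z -> P w) -> pnear z P.
Proof. by move=> H; exists 1 => // w wz _; exact: H. Qed.

Lemma pnear_ball z (r : R) : 0 < r -> pnear z (fun w => cabs (w - z) < r).
Proof. by move=> r0; exists r. Qed.

Lemma pnear_ex z P : pnear z P -> exists2 w, w != z & P w.
Proof.
move=> [r r0 H]; have [w [wz wr]] := exists_in_punctured z r0.
by exists w => //; exact: H.
Qed.

Definition holo_at f z := exists2 r : R, 0 < r & holo_ball f z r.

Lemma holo_at_cdiff f z : holo_at f z -> cdiff f z.
Proof. by move=> [r r0 H]; apply: H; rewrite subrr cabs0. Qed.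

Lemma holo_at2 f g h z : (forall w, cdiff f w -> cdiff g w -> cdiff h w) ->
  holo_at f z -> holo_at g z -> holo_at h z.
Proof.
move=> H [r r0 df] [s s0 dg]; exists (Num.min r s); first by rewrite lt_min r0.
by move=> w; rewrite lt_min => /andP[wr ws]; apply: H; [exact: df|exact: dg].
Qed.

Lemma holo_at_all f z : (forall w, cdiff f w) -> holo_at f z.
Proof. by move=> H; exists 1 => // w _; exact: H. Qed.

Lemma holo_at_neq0 f z : holo_at f z -> f z != 0 ->
  exists2 r : R, 0 < r & holo_ball f z r /\ forall w, cabs (w - z) < r -> f w != 0.
Proof.
move=> [r r0 df] fz; have dz : cdiff f z by apply: df; rewrite subrr cabs0.
have fz0 : 0 < cabs (f z) by rewrite cabs_gt0.
have [s s0 H] := near_close fz0 dz.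
exists (Num.min r s); first by rewrite lt_min r0.
split=> w; rewrite lt_min => /andP[wr ws]; first exact: df.
have := H w ws; have := cabs_tri (f z) (f w) 0; rewrite !subr0 (cabsB (f z)).
by move=> h1 h2; rewrite -cabs_gt0; move: h1 h2; lra.
Qed.

Lemma holo_at_pnear_neq0 f z : holo_at f z -> f z != 0 -> pnear z (fun w => f w != 0).
Proof.
by move=> df fz; have [r r0 [_ H]] := holo_at_neq0 df fz; exists r => // w _; exact: H.
Qed.

Lemma holo_at_Xz f z k : holo_at f z -> f z != 0 -> holo_at (fun w => f w ^ k) z.
Proof.
move=> df fz; have [r r0 [d n]] := holo_at_neq0 df fz.
by exists r => // w wr; apply: cdiffXz; [exact: n|exact: d].
Qed.

Lemma holo_at_div f g z : holo_at f z -> holo_at g z -> g z != 0 ->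
  holo_at (fun w => f w / g w) z.
Proof.
move=> [r r0 df] dg gz; have [s s0 [{}dg n]] := holo_at_neq0 dg gz.
exists (Num.min r s); first by rewrite lt_min r0.
move=> w; rewrite lt_min => /andP[wr ws].
by apply: cdiff_div; [exact: n|exact: df|exact: dg].
Qed.

Definition has_cord f z k := exists g,
  [/\ holo_at g z, g z != 0 & pnear z (fun w => f w = (w - z) ^ k * g w)].

Lemma has_cord_uniq f z k l : has_cord f z k -> has_cord f z l -> k = l.
Proof.
wlog kl : k l / k <= l => [H fk fl|].
  by have [/H->//|/ltW lk] := lerP k l; rewrite (H l k).
move=> [g [dg gz fg]] [h [dh hz fh]]; have [//|k'l] := eqVneq k l.
have [n nE] : exists n : nat, l = k + n.+1%:Z.
  have : k < l by rewrite lt_neqAle k'l.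
  rewrite -subr_gt0; case E : (l - k) => [[|n]|]// _.
  by exists n; rewrite -E addrC subrK.
have [r r0 H] := pnearI fg fh.
suff gz0 : g z = (z - z) ^+ n.+1 * h z.
  by move: gz; rewrite gz0 subrr expr0n mul0r eqxx.
apply: (@eq_at_center _ g (fun w => (w - z) ^+ n.+1 * h w) z r) => //.
- exact: holo_at_cdiff.
- by apply: cdiffM; [apply: cdiffX; exact: cdiff_shift|exact: holo_at_cdiff].
move=> w wz wr; have [-> E] := H w wz wr; have wz0 : w - z != 0 by rewrite subr_eq0.
by apply: (mulfI (expfz_neq0 k wz0)); rewrite E nE expfzDr// mulrA.
Qed.

Lemma has_cord_neq0 f z k : has_cord f z k -> pnear z (fun w => f w != 0).
Proof.
move=> [g [dg gz fg]]; apply: pnearS (pnearI fg (holo_at_pnear_neq0 dg gz)).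
by move=> w wz [-> gw]; rewrite mulf_neq0// expfz_neq0// subr_eq0.
Qed.

Lemma has_cord_pnear f g z k : pnear z (fun w => f w = g w) ->
  has_cord g z k -> has_cord f z k.
Proof.
move=> fg [h [dh hz gh]]; exists h; split=> //.
by apply: pnearS (pnearI fg gh) => w _ [-> ->].
Qed.

Lemma has_cord_holo f z : holo_at f z ->
  pnear z (fun w => f w = 0) \/ exists m : nat, has_cord f z m.
Proof.
move=> [r r0 df]; have [[s s0 H]|[m [g [dg gz fg]]]] := holo_zero r0 df.
  by left; exists s => // w _; exact: H.
by right; exists m, g; split=> //; [exists r|apply: pnearT => w _; rewrite fg].
Qed.

Lemma has_cord_holo0 f z : holo_at f z -> f z != 0 -> has_cord f z 0.
Proof.
by move=> df fz; exists f; split=> //; apply: pnearT => w _; rewrite expr0z mul1r.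
Qed.

Lemma has_cord_neg f z (m : nat) : has_cord f z (- m%:Z) ->
  exists r e, [/\ 0 < r, holo_ball e z r, e z != 0 & forall w, w != z -> cabs (w - z) < r ->
    f w != 0 /\ (f w)^-1 = (w - z) ^+ m * e w].
Proof.
move=> [g [dg gz [s s0 H]]]; have [r r0 [d n]] := holo_at_neq0 dg gz.
exists (Num.min r s), (fun w => (g w)^-1); split; first by rewrite lt_min r0.
- by move=> w; rewrite lt_min => /andP[wr _]; apply: cdiffV; [exact: n|exact: d].
- by rewrite invr_eq0.
move=> w wz; rewrite lt_min => /andP[wr ws]; have wz0 : w - z != 0 by rewrite subr_eq0.
by rewrite H// mulf_neq0 ?expfz_neq0 ?n// invfM -exprnN invrK.
Qed.

Lemma has_cordM f g z k l : has_cord f z k -> has_cord g z l ->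
  has_cord (fun w => f w * g w) z (k + l).
Proof.
move=> [f1 [df fz fE]] [g1 [dg gz gE]]; exists (fun w => f1 w * g1 w); split.
- by apply: (holo_at2 _ df dg) => w; exact: cdiffM.
- by rewrite mulf_neq0.
apply: pnearS (pnearI fE gE) => w wz [-> ->].
by rewrite expfzDr ?subr_eq0//; ring.
Qed.

Lemma has_cord_addl f g z k l : k < l -> has_cord f z k -> has_cord g z l ->
  has_cord (fun w => f w + g w) z k.
Proof.
move=> kl [f1 [df fz fE]] [g1 [dg gz gE]].
have [n nE] : exists n : nat, l = k + n.+1%:Z.
  move: kl; rewrite -subr_gt0; case E : (l - k) => [[|n]|]// _.
  by exists n; rewrite -E addrC subrK.
exists (fun w => f1 w + (w - z) ^+ n.+1 * g1 w); split.
- apply: (holo_at2 _ df dg) => w d1 d2; apply: cdiffD => //.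
  by apply: cdiffM => //; apply: cdiffX; exact: cdiff_shift.
- by rewrite subrr expr0n mul0r addr0.
apply: pnearS (pnearI fE gE) => w wz [-> ->].
by rewrite nE expfzDr ?subr_eq0// mulrDr mulrA.
Qed.

Definition mero f z := exists (m : nat) g,
  holo_at g z /\ pnear z (fun w => f w = g w / (w - z) ^+ m).

Lemma mero_holo f z : holo_at f z -> mero f z.
Proof.
by move=> df; exists 0%N, f; split=> //; apply: pnearT => w _; rewrite expr0 divr1.
Qed.

Lemma meroD f g z : mero f z -> mero g z -> mero (fun w => f w + g w) z.
Proof.
move=> [m [f1 [df fE]]] [n [g1 [dg gE]]].
exists (m + n)%N, (fun w => f1 w * (w - z) ^+ n + g1 w * (w - z) ^+ m); split.
  apply: (holo_at2 _ df dg) => w d1 d2; apply: cdiffD.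
    by apply: cdiffM => //; apply: cdiffX; exact: cdiff_shift.
  by apply: cdiffM => //; apply: cdiffX; exact: cdiff_shift.
apply: pnearS (pnearI fE gE) => w wz [-> ->]; have wz0 : w - z != 0 by rewrite subr_eq0.
by rewrite exprD; field; rewrite !expf_neq0.
Qed.

Lemma meroM f g z : mero f z -> mero g z -> mero (fun w => f w * g w) z.
Proof.
move=> [m [f1 [df fE]]] [n [g1 [dg gE]]].
exists (m + n)%N, (fun w => f1 w * g1 w); split.
  by apply: (holo_at2 _ df dg) => w; exact: cdiffM.
apply: pnearS (pnearI fE gE) => w wz [-> ->].
by rewrite exprD invfM mulrACA.
Qed.

Lemma mero_cst (c : R[i]) z : mero (fun=> c) z.
Proof. by apply/mero_holo/holo_at_all => w; exact: cdiff_cst. Qed.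

Lemma mero_pnear f g z : pnear z (fun w => f w = g w) -> mero g z -> mero f z.
Proof.
move=> fg [m [h [dh gh]]]; exists m, h; split=> //.
by apply: pnearS (pnearI fg gh) => w _ [-> ->].
Qed.

Lemma mero_orbit a b z n : mero a z -> mero b z ->
  mero (fun w => orbit_a n (a w) (b w)) z.
Proof.
move=> ma mb; elim: n => [//|n IH].
apply: (@mero_pnear _ (fun w => (orbit_a n (a w) (b w) * orbit_a n (a w) (b w)
   + - 3 * a w * a w) * orbit_a n (a w) (b w) + b w)).
  apply: pnearT => w _; rewrite orbit_aS /cubic.
  by move: (orbit_a n (a w) (b w)) (a w) (b w) => x y t; ring.
apply: meroD => //; apply: meroM => //; apply: meroD; first exact: meroM.
by apply: meroM => //; apply: meroM => //; exact: mero_cst.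
Qed.

Lemma mero_cdiff f z : mero f z -> pnear z (cdiff f).
Proof.
move=> [m [g [[r r0 dg] [s s0 H]]]].
exists (Num.min r s); first by rewrite lt_min r0.
move=> w wz; rewrite lt_min => /andP[wr ws].
apply: (@cdiff_near _ _ (fun w => g w / (w - z) ^+ m)).
  apply/nearC; exists (Num.min (s - cabs (w - z)) (cabs (w - z))).
    by rewrite lt_min subr_gt0 ws cabs_gt0 subr_eq0.
  move=> x; rewrite lt_min => /andP[h1 h2]; apply: H.
    by apply: contraTneq h2 => ->; rewrite cabsB ltxx.
  by have := cabs_tri x w z; lra.
apply: cdiff_div; first by rewrite expf_neq0// subr_eq0.
  exact: dg.
by apply: cdiffX; exact: cdiff_shift.
Qed.

Lemma mero_cord f z : mero f z ->
  pnear z (fun w => f w = 0) \/ exists k, has_cord f z k.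
Proof.
move=> [m [g [dg fE]]]; have [g0|[n [h [dh hz gE]]]] := has_cord_holo dg.
  by left; apply: pnearS (pnearI g0 fE) => w _ [E ->]; rewrite E mul0r.
right; exists (n%:Z - m%:Z), h; split=> //.
apply: pnearS (pnearI gE fE) => w wz [E ->].
by rewrite E expfzDr ?subr_eq0// mulrAC exprnN.
Qed.

Definition big_pow f z k :=
  exists M : R, pnear z (fun w => cabs (f w) <= M * cabs (w - z) ^ k).

Lemma big_pow0 f z k : pnear z (fun w => f w = 0) -> big_pow f z k.
Proof. by exists 0; apply: pnearS H => w _ ->; rewrite cabs0 mul0r. Qed.

Lemma big_pow_cord f z k l : l <= k -> has_cord f z k -> big_pow f z l.
Proof.
move=> lk [g [dg gz fE]].
have [r r0 H] := near_close ltr01 (holo_at_cdiff dg).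
exists (cabs (g z) + 1).
apply: pnearS (pnearI fE (pnearI (pnear_ball z r0) (pnear_ball z ltr01))).
move=> w wz [-> [wr w1]]; have wz0 : 0 < cabs (w - z) by rewrite cabs_gt0 subr_eq0.
rewrite cabsM cabsXz mulrC; apply: ler_pM; rewrite ?cabs_ge0 ?exprz_ge0 ?cabs_ge0//.
  have := H w wr; have := cabs_tri (g w) (g z) 0; rewrite !subr0; lra.
have [n ->] : exists n : nat, k = l + n%:Z.
  move: lk; rewrite -subr_ge0; case E : (k - l) => [n|]// _.
  by exists n; rewrite -E addrC subrK.
rewrite expfzDr ?gt_eqF// ler_piMr// ?exprz_ge0 ?cabs_ge0//.
by rewrite exprn_ile1// ?cabs_ge0// ltW.
Qed.

Lemma pnear_small z (M e : R) : 0 < e -> pnear z (fun w => M * cabs (w - z) <= e).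
Proof.
move=> e0; have M0 : 0 < `|M| + 1 by rewrite ltr_wpDl.
exists (e / (`|M| + 1)); first by rewrite divr_gt0.
move=> w _; rewrite ltr_pdivlMr// mulrC => h.
have := ler_norm M; move=> h1.
by have := ler_wpM2r (cabs_ge0 (w - z)) h1; have := cabs_ge0 (w - z); lra.
Qed.

Lemma escape_of_orders (a b c : R[i] -> R[i]) z (k : nat) : (0 < k)%N ->
  has_cord c z (- k%:Z) -> big_pow a z (1 - k%:Z) -> big_pow b z (1 - 3 * k%:Z) ->
  pnear z (fun w => [/\ 2 <= cabs (c w), 24 * cabs (a w) ^+ 2 <= cabs (c w) ^+ 2 &
     8 * cabs (b w) <= cabs (c w) ^+ 3]).
Proof.
move=> k0 [g [dg gz cE]] [Ma Ha] [Mb Hb].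
have G0 : 0 < cabs (g z) / 2 by rewrite divr_gt0// cabs_gt0.
have [r r0 H] := near_close G0 (holo_at_cdiff dg).
set G := cabs (g z) / 2 in G0 H *.
have G30 : 0 < G ^+ 3 by rewrite exprn_gt0.
apply: pnearS (pnearI cE (pnearI Ha (pnearI Hb (pnearI (pnear_ball z r0)
  (pnearI (pnear_ball z ltr01) (pnearI (pnear_small z 2 G0)
  (pnearI (pnear_small z (5 * Ma) G0) (pnear_small z (8 * Mb) G30)))))))).
move=> w wz [-> [ha [hb [wr [w1 [s2 [sa sb]]]]]]].
have x0 : 0 < cabs (w - z) by rewrite cabs_gt0 subr_eq0.
rewrite cabsM cabsXz.
have gG : G <= cabs (g w).
  have := H w wr; have := cabs_tri (g z) (g w) 0.
  by rewrite !subr0 (cabsB (g z)) /G; lra.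
move: (cabs (w - z)) (cabs (g w)) (cabs (a w)) (cabs (b w)) (cabs_ge0 (a w))
  gG x0 w1 s2 sa sb ha hb => x y A B A0 gG x0 w1 s2 sa sb ha hb.
have xn : x != 0 by rewrite gt_eqF.
set X := x ^ (- k%:Z); have X0 : 0 < X by rewrite exprz_gt0.
have xX : 1 <= X * x.
  rewrite /X -exprnN -{2}(invrK x) -[leLHS](@divff _ (x^-1 ^+ 1)) ?expr1 ?invr_eq0//.
  rewrite ler_pM2r ?invrK// -exprVn.
  by apply: (@ler_weXn2l _ x^-1 _ 1 k k0); rewrite invf_ge1// ltW.
have XG : X * G <= X * y by rewrite ler_pM2l.
have XG0 : 0 <= X * G by rewrite mulr_ge0// ltW.
split.
- have : 2 * (X * x) <= X * G by have := ler_wpM2l (ltW X0) s2; lra.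
  lra.
- have -> : 24 * A ^+ 2 = 24 / 25 * (5 * A) ^+ 2 by field.
  have h5 : 5 * A <= X * G.
    have : 5 * A <= X * (5 * Ma * x).
      by move: ha; rewrite expfzDr// expr1z -/X; lra.
    by have := ler_wpM2l (ltW X0) sa; lra.
  have : (5 * A) ^+ 2 <= (X * y) ^+ 2.
    by apply: lerXn2r; rewrite ?nnegrE; lra.
  by have := sqr_ge0 (5 * A); lra.
have hX : x ^ (1 - 3 * k%:Z) = X ^+ 3 * x.
  rewrite expfzDr// expr1z mulrC; congr (_ * x).
  by rewrite /X exprnP exprz_exp mulNr mulrC.
have : 8 * B <= X ^+ 3 * (8 * Mb * x) by move: hb; rewrite hX; lra.
have X30 : 0 <= X ^+ 3 by rewrite exprn_ge0// ltW.
have := ler_wpM2l X30 sb; rewrite -exprMn.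
have : (X * G) ^+ 3 <= (X * y) ^+ 3 by apply: lerXn2r; rewrite ?nnegrE; lra.
lra.
Qed.

End LocalOrders.

Section LocalGreen.
Context {R : realType}.
Implicit Types (a b : R[i] -> R[i]) (z w : R[i]).

Lemma orbit_unbounded (a b : R[i]) (K : R) : 0 < Gplus a b ->
  exists N, K < cabs (orbit_a N a b).
Proof.
move=> G0; apply/not_existsP => H.
suff : Gplus a b <= 0 by rewrite leNgt G0.
have K1 : 0 < Num.max 1 K by rewrite lt_max ltr01.
apply: (@Gplus_le _ _ _ _ (ln (Num.max 1 K)) 0) => k; rewrite add0n add0r mulrC.
rewrite ler_wpM2r ?invr_ge0 ?exprn_ge0//.
have hK : cabs (orbit_a k a b) <= Num.max 1 K.
  by rewrite le_max; apply/orP; right; rewrite leNgt; apply/negP; exact: H.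
by apply: le_trans (logp_le hK) _; rewrite logp_ln// le_max lexx.
Qed.

Lemma Re_realM (x : R) z : complex.Re (x%:C * z) = x * complex.Re z.
Proof. by case: z => u v /=; rewrite mul0r subr0. Qed.

Lemma holo_at_scaleD (x : R) f g z : holo_at f z -> holo_at g z ->
  holo_at (fun w => x%:C * f w + g w) z.
Proof.
apply: holo_at2 => w df dg; apply: cdiffD => //.
by apply: cdiffM => //; exact: cdiff_cst.
Qed.

Lemma green_local_Re a b z : holo_at a z -> holo_at b z ->
  0 < Gplus (a z) (b z) ->
  exists Phi, local_Re (fun w => Gplus (a w) (b w)) z Phi.
Proof.
move=> ha hb G0; have [ra ra0 da] := ha; have [rb rb0 db] := hb.
have [r1 r10 H1] := near_close ltr01 (holo_at_cdiff ha).
have [r2 r20 H2] := near_close ltr01 (holo_at_cdiff hb).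
pose K := 2 + 5 * (cabs (a z) + 1) + 8 * (cabs (b z) + 1).
have [N hN] := orbit_unbounded (K + 1) G0.
have dN := cdiff_orbit N (holo_at_cdiff ha) (holo_at_cdiff hb).
have [r3 r30 H3] := near_close ltr01 dN.
pose r := Num.min (Num.min ra rb) (Num.min r1 (Num.min r2 r3)).
have r0 : 0 < r by rewrite !lt_min ra0 rb0 r10 r20.
have rP w : cabs (w - z) < r -> [/\ cdiff a w, cdiff b w &
    [/\ 2 <= cabs (orbit_a N (a w) (b w)),
        24 * cabs (a w) ^+ 2 <= cabs (orbit_a N (a w) (b w)) ^+ 2 &
        8 * cabs (b w) <= cabs (orbit_a N (a w) (b w)) ^+ 3]].
  rewrite !lt_min => /andP[/andP[wa wb] /andP[w1 /andP[w2 w3]]].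
  split; [exact: da|exact: db|].
  have := H1 w w1; have := H2 w w2; have := H3 w w3; rewrite /=.
  have := cabs_tri (a w) (a z) 0; have := cabs_tri (b w) (b z) 0.
  have := cabs_tri (orbit_a N (a z) (b z)) (orbit_a N (a w) (b w)) 0.
  rewrite !subr0 (cabsB (orbit_a N (a z) (b z))).
  move: hN; rewrite /K.
  have := cabs_ge0 (a z); have := cabs_ge0 (b z).
  have := cabs_ge0 (a w); have := cabs_ge0 (b w).
  move: (cabs (orbit_a N (a w) (b w) - _)) => y.
  move: (cabs (a w - _)) (cabs (b w - _)) (cabs (a w)) (cabs (b w)) (cabs (a z))
    (cabs (b z)) (cabs (orbit_a N (a w) (b w))) (cabs (orbit_a N (a z) (b z))).
  move=> xa xb A B A1 B1 C C1 B0 A0 B10 A10 h1 h2 h3 h4 h5 h6 h7.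
  have C2 : 2 <= C by lra.
  have CA : 5 * A <= C by lra.
  have CB : 8 * B <= C by lra.
  split=> //.
    have : (5 * A) ^+ 2 <= C ^+ 2 by apply: lerXn2r; rewrite ?nnegrE; lra.
    by have := sqr_ge0 A; rewrite exprMn; lra.
  by apply: le_trans CB _; rewrite ler_eXnr//; lra.
pose z1 := z + (r / 4)%:C.
have z1z : cabs (z1 - z) = r / 4.
  by rewrite /z1 addrC addKr cabs_real gtr0_norm// divr_gt0.
have in_ball w : cabs (w - z1) < r / 2 -> cabs (w - z) < r.
  by move=> h; have := cabs_tri w z1 z; rewrite z1z; move: (r0) h; lra.
have r20' : 0 < r / 2 by rewrite divr_gt0.
have [Phi1 [dPhi1 E1]] := @escape_green _ a b z1 (r / 2) N r20'
  (fun w _ h => let: And3 p _ _ := rP w (in_ball w h) in p)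
  (fun w _ h => let: And3 _ p _ := rP w (in_ball w h) in p)
  (fun w _ h => let: And3 _ _ p := rP w (in_ball w h) in p).
have cN0 : orbit_a N (a z) (b z) != 0.
  rewrite -cabs_gt0; apply: lt_trans hN; rewrite /K.
  have := cabs_ge0 (a z); have := cabs_ge0 (b z); lra.
have dc : holo_ball (fun w => orbit_a N (a w) (b w)) z r.
  by move=> w /rP[d1 d2 _]; exact: cdiff_orbit.
have [s [Phi2 [s0 sr dPhi2 E2]]] := ln_cabs_local_Re r0 dc cN0.
exists (fun w => ((3 ^+ N)^-1)%:C * Phi2 w + Phi1 w), (Num.min s (r / 4)).
  by rewrite lt_min s0 divr_gt0.
have near1 w : cabs (w - z) < r / 4 -> w != z1 /\ cabs (w - z1) < r / 2.
  move=> h; split; first by apply: contraTneq h => ->; rewrite z1z ltxx.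
  by have := cabs_tri w z z1; rewrite (cabsB z) z1z; move: h; lra.
split=> w; rewrite lt_min => /andP[ws wr]; have [wz1 w1] := near1 w wr.
  apply: cdiffD; last exact: dPhi1.
  by apply: cdiffM; [exact: cdiff_cst|exact: dPhi2].
by rewrite E1// (E2 w ws).2 raddfD /= -[in LHS]Re_realM.
Qed.

Lemma nonescape_orders a b z (m : nat) : (0 < m)%N -> has_cord a z (- m%:Z) ->
  mero b z -> (forall n, big_pow (fun w => orbit_a n (a w) (b w)) z (- m%:Z)) ->
  forall d : R, 0 < d -> pnear z (fun w => Gplus (a w) (b w) <= d).
Proof.
move=> m0 oa mb bd d d0; have [r1 [e [r10 de ez aE]]] := has_cord_neg oa.
have ma : mero a z.
  have [g [dg _ gE]] := oa; exists m, g; split=> //.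
  by apply: pnearS gE => w wz ->; rewrite mulrC -exprnN.
have [r2 r20 da] := mero_cdiff ma; have [r3 r30 db] := mero_cdiff mb.
pose rho := Num.min r1 (Num.min r2 r3).
have rho0 : 0 < rho by rewrite !lt_min r10 r20.
have rP w : cabs (w - z) < rho -> [/\ cabs (w - z) < r1, cabs (w - z) < r2 &
    cabs (w - z) < r3] by rewrite !lt_min => /andP[-> /andP[-> ->]].
have bounded n : exists M s, 0 < s /\ forall w, w != z -> cabs (w - z) < s ->
    cabs (orbit_a n (a w) (b w) / a w) <= M.
  have [M HM] := bd n.
  have [s s0 Hs] := near_close ltr01 (holo_at_cdiff (ex_intro2 _ _ r1 r10 de)).
  have [t t0 Ht] := pnearI HM (pnearI (pnear_ball z s0) (pnear_ball z r10)).
  exists (M * (cabs (e z) + 1)), t; split=> // w wz wt.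
  have [h1 [h2 h3]] := Ht w wz wt; have [an ->] := aE w wz h3.
  have x0 : 0 < cabs (w - z) by rewrite cabs_gt0 subr_eq0.
  have E : cabs (e w) <= cabs (e z) + 1.
    by have := Hs w h2; have := cabs_tri (e w) (e z) 0; rewrite !subr0; lra.
  rewrite cabsM (cabsM (_ ^+ m)) cabsX.
  have X0 : 0 < cabs (w - z) ^+ m by rewrite exprn_gt0.
  have -> : M * (cabs (e z) + 1) = (M * cabs (w - z) ^ (- m%:Z)) *
      (cabs (w - z) ^+ m * (cabs (e z) + 1)).
    by rewrite -exprnN; field; rewrite expf_neq0// gt_eqF.
  by apply: ler_pM => //; [exact: cabs_ge0|apply: mulr_ge0; [exact: ltW|exact: cabs_ge0]|
    rewrite ler_pM2l].
have [r r0 H] := @nonescape_small _ a b e z rho m rho0 m0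
  (fun w wz h => let: And3 _ p _ := rP w h in da w wz p)
  (fun w wz h => let: And3 _ _ p := rP w h in db w wz p)
  (fun w h => let: And3 p _ _ := rP w h in de w p) ez
  (fun w wz h => let: And3 p _ _ := rP w h in aE w wz p) bounded d d0.
by exists r.
Qed.

Section Escape.
Variables (a b : R[i] -> R[i]) (z : R[i]) (N k : nat).
Hypotheses (ma : mero a z) (mb : mero b z) (k0 : (0 < k)%N).
Let c n w := orbit_a n (a w) (b w).
Hypothesis cN : has_cord (c N) z (- k%:Z).
Hypotheses (ak : big_pow a z (1 - k%:Z)) (bk : big_pow b z (1 - 3 * k%:Z)).

Let escape_hyps : exists2 r : R, 0 < r &
  [/\ forall w, w != z -> cabs (w - z) < r -> cdiff a w,
      forall w, w != z -> cabs (w - z) < r -> cdiff b w &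
      forall w, w != z -> cabs (w - z) < r -> [/\ 2 <= cabs (c N w),
        24 * cabs (a w) ^+ 2 <= cabs (c N w) ^+ 2 & 8 * cabs (b w) <= cabs (c N w) ^+ 3]].
Proof.
have [r r0 H] := pnearI (mero_cdiff ma) (pnearI (mero_cdiff mb)
  (escape_of_orders k0 cN ak bk)).
by exists r => //; split=> w wz /(H w wz)[? []].
Qed.

Lemma escape_orders n : has_cord (c (N + n)) z (- (k * 3 ^ n)%N%:Z).
Proof.
have [r r0 [Ha Hb Hc]] := escape_hyps.
have [e [de ez E]] := escape_factor r0 Ha Hb Hc n.
have he : holo_at e z by exists r.
have [g [dg gz gE]] := cN; exists (fun w => g w ^+ (3 ^ n) * e w); split.
- by apply: (holo_at2 _ dg he) => w d1 d2; apply: cdiffM => //; exact: cdiffX.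
- by rewrite mulf_neq0// expf_neq0.
apply: pnearS (pnearI gE (ex_intro2 _ _ r r0 (fun w wz wr => E w wz wr))).
move=> w wz [h1 h2]; rewrite /c h2 -/(c N w) h1 exprMn mulrA; congr (_ * _ * _).
by rewrite exprnP exprz_exp mulNr -PoszM.
Qed.

Lemma escape_local_Re u : has_cord u z 1 -> exists Psi, holo_at Psi z /\
  pnear z (fun w => u w != 0 /\ complex.Re (Psi w) =
    Gplus (a w) (b w) + k%:R / 3 ^+ N * ln (cabs (u w))).
Proof.
move=> ou; have [r r0 [Ha Hb Hc]] := escape_hyps.
have [Phi [dPhi E]] := escape_green r0 Ha Hb Hc.
have [g [[s s0 dg] gz gE]] := cN; have [v [[t t0 dv] vz vE]] := ou.
have [s1 [G [s10 _ dG GE]]] := ln_cabs_local_Re s0 dg gz.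
have [t1 [V [t10 _ dV VE]]] := ln_cabs_local_Re t0 dv vz.
exists (fun w => ((3 ^+ N)^-1)%:C * G w + ((k%:R / 3 ^+ N)%:C * V w + Phi w)); split.
  apply: holo_at_scaleD; first by exists s1.
  by apply: holo_at_scaleD; [exists t1|exists r].
apply: pnearS (pnearI gE (pnearI vE (pnearI (pnear_ball z s10) (pnearI (pnear_ball z t10)
  (ex_intro2 _ _ r r0 (fun w wz wr => E w wz wr)))))).
move=> w wz [cE [uE [ws [wt ->]]]]; have [g0 lg] := GE w ws; have [v0 lv] := VE w wt.
have wz0 : w - z != 0 by rewrite subr_eq0.
split; first by rewrite uE mulf_neq0.
rewrite -/(c N w) cE uE expr1z !cabsM cabsXz !raddfD /= -!Re_realM in lg lv *.
have x0 : 0 < cabs (w - z) by rewrite cabs_gt0.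
rewrite !Re_realM -lg -lv -exprnN !lnM ?posrE ?invr_gt0 ?exprn_gt0 ?cabs_gt0//.
rewrite lnV ?posrE ?exprn_gt0// lnXn// -(mulr_natl _ k).
by field; rewrite gt_eqF// exprn_gt0.
Qed.

End Escape.

End LocalGreen.

Section Charts.
Context {R : realType} {X : topologicalType}.
Local Notation dom := chart_dom.
Local Notation coord := chart_coord.
Local Notation param := chart_param.
Variable A : set (chart R X).
Hypothesis hA : is_atlas A.
Implicit Types (c : chart R X) (p q : X) (f g : X -> R[i]) (P : X -> Prop).

Lemma chart_paramK c p : A c -> dom c p ->
  param c (coord c p) = p.
Proof. by move=> Ac; have [hc _ _] := hA; have [_ _ + _ _] := hc c Ac; apply. Qed.

Lemma chart_ball c p : A c -> dom c p -> exists2 r : R, 0 < r &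
  forall w, cabs (w - coord c p) < r ->
    dom c (param c w) /\ coord c (param c w) = w.
Proof.
move=> Ac cp; have [hc _ _] := hA; have [_ oV parK _ _] := hc c Ac.
have : \forall w \near coord c p, (coord c @` dom c) w.
  by apply: open_nbhs_nbhs; split=> //; exists p.
move/nearC => [r r0 H]; exists r => // w /H [q cq <-].
by rewrite parK.
Qed.

Lemma near_chart c p P : A c -> dom c p ->
  (\forall q \near p, P q) <->
  exists2 r : R, 0 < r &
    forall w, cabs (w - coord c p) < r -> P (param c w).
Proof.
move=> Ac cp; have [hc _ _] := hA; have [oD _ parK cco cpar] := hc c Ac.
split=> [Pp|[r r0 H]].
  apply/nearC; have := cpar p cp; rewrite /continuous_at parK// => h.
  exact: (h P Pp).
have nD : \forall q \near p, dom c q by exact: open_nbhs_nbhs.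
have /cont_atP /(_ r r0) nco := cco p cp.
by apply: filterS2 nD nco => q cq /H; rewrite parK.
Qed.

Lemma pnear_chart c p P : A c -> dom c p ->
  (\forall q \near p^', P q) <->
  pnear (coord c p) (fun w => P (param c w)).
Proof.
move=> Ac cp; have parK := chart_paramK Ac cp; have [s s0 Hs] := chart_ball Ac cp.
split=> [|[r r0 H]].
  rewrite near_withinE => /(near_chart _ Ac cp)[r r0 H].
  exists (Num.min r s); first by rewrite lt_min r0.
  move=> w wz; rewrite lt_min => /andP[wr /Hs[_ ws]]; apply: H => //.
  by apply: contraNneq wz => /(congr1 (coord c)); rewrite ws => ->.
rewrite near_withinE; apply/(near_chart _ Ac cp).
exists (Num.min r s); first by rewrite lt_min r0.
move=> w; rewrite lt_min => /andP[wr /Hs[_ ws]] wp; apply: H => //.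
by apply: contraNneq wp => ->; rewrite parK.
Qed.

Lemma transition_ball c1 c2 p : A c1 -> A c2 -> dom c1 p -> dom c2 p ->
  exists2 r : R, 0 < r & forall w, cabs (w - coord c1 p) < r ->
    [/\ dom c1 (param c1 w), coord c1 (param c1 w) = w,
        dom c2 (param c1 w) &
        cdiff (fun x => coord c2 (param c1 x)) w].
Proof.
move=> A1 A2 d1 d2; have [hc _ htr] := hA.
have [oD2 _ _ _ _] := hc c2 A2; have [r r0 Hr] := chart_ball A1 d1.
have /(near_chart _ A1 d1) [s s0 Hs] : \forall q \near p, dom c2 q.
  exact: open_nbhs_nbhs.
exists (Num.min r s); first by rewrite lt_min r0.
move=> w; rewrite lt_min => /andP[/Hr[h1 h2] /Hs h3]; split=> //.
by have := htr _ _ _ A1 A2 h1 h3; rewrite h2 => /cdiff_derivable.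
Qed.

Lemma holomorphic_chart f c p : holomorphic_at A f p -> A c -> dom c p ->
  holo_at (f \o param c) (coord c p).
Proof.
move=> [c' [A' d' /nearC[s s0 Hs]]] Ac dc.
have [r r0 Hr] := transition_ball Ac A' dc d'.
pose tr x := coord c' (param c x).
have [_ _ _ dtr] : [/\ dom c (param c (coord c p)), coord c
    (param c (coord c p)) = coord c p,
    dom c' (param c (coord c p)) & cdiff tr (coord c p)].
  by apply: Hr; rewrite subrr cabs0.
have trp : tr (coord c p) = coord c' p by rewrite /tr chart_paramK.
have [t t0 Ht] := near_close s0 dtr.
exists (Num.min r t); first by rewrite lt_min r0.
move=> w; rewrite lt_min => /andP[wr wt]; have [h1 h2 h3 h4] := Hr w wr.
apply: (@cdiff_near _ _ (fun x => (f \o param c') (tr x))).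
  apply/nearC; exists (r - cabs (w - coord c p)); first by rewrite subr_gt0.
  move=> x xw; have [|k1 k2 k3 k4] := Hr x.
    by have := cabs_tri x w (coord c p); move: xw; lra.
  by rewrite /= /tr chart_paramK.
apply: (@cdiff_comp _ tr (f \o param c')) => //.
by apply/cdiff_derivable/Hs; have := Ht w wt; rewrite trp.
Qed.

Lemma holomorphic_at_coord (g : R[i] -> R[i]) c p : A c -> dom c p ->
  holo_at g (coord c p) -> holomorphic_at A (g \o coord c) p.
Proof.
move=> Ac cp [r r0 dg]; have [s s0 Hs] := chart_ball Ac cp.
exists c; split=> //; apply/nearC; exists (Num.min r s); first by rewrite lt_min r0.
move=> w; rewrite lt_min => /andP[wr ws]; apply/cdiff_derivable.
apply: (@cdiff_near _ _ g); last exact: dg.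
apply/nearC; exists (s - cabs (w - coord c p)); first by rewrite subr_gt0.
move=> x xw; rewrite /= (Hs x _).2//.
by have := cabs_tri x w (coord c p); move: xw; lra.
Qed.

Lemma transition_factor c1 c2 p : A c1 -> A c2 -> dom c1 p -> dom c2 p ->
  has_cord (fun w => coord c2 (param c1 w) - coord c2 p)
    (coord c1 p) 1.
Proof.
move=> A1 A2 d1 d2; have [_ _ htr] := hA.
have [r r0 Hr] := transition_ball A1 A2 d1 d2.
set z := coord c1 p; pose tr x := coord c2 (param c1 x).
have dtr : holo_ball tr z r by move=> w /Hr[].
have [tau [dtau tauE]] := holo_div r0 dtr.
have trp : tr z = coord c2 p by rewrite /tr /z chart_paramK.
have zz : cabs (z - z) < r by rewrite subrr cabs0.
have D1 : has_cderiv tr z (tau z).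
  by exists tau; split=> //; exact: (cdiff_cont (dtau z zz)).
have [d D2] : cdiff (fun x => coord c1 (param c2 x)) (tr z).
  by rewrite trp; apply/cdiff_derivable; exact: htr.
have D3 : has_cderiv (fun x => x) z (d * tau z).
  apply: has_cderiv_near (has_cderiv_comp D1 D2).
  apply/nearC; exists r => // w /Hr[h1 h2 h3 _].
  by rewrite /tr chart_paramK.
have tz : tau z != 0.
  apply: contraTneq (oner_neq0 R[i]) => t0; rewrite negbK; apply/eqP.
  by rewrite (has_cderiv_uniq (has_cderiv_id z) D3) t0 mulr0.
exists tau; split=> //; first by exists r.
by apply: pnearT => w _; rewrite -/(tr w) tauE trp expr1z addrC addKr.
Qed.

Lemma has_ord_chart f c p (k : int) : A c -> dom c p ->
  has_ord A f p k%:E <-> has_cord (f \o param c) (coord c p) k.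
Proof.
move=> Ac cp; split.
  move=> [c' [g [A' d' hg gp /(pnear_chart _ Ac cp) fE]]].
  have [t [[r r0 dt] tz tE]] := transition_factor Ac A' cp d'.
  have dg := holomorphic_chart hg Ac cp.
  have dt' : holo_at t (coord c p) by exists r.
  exists (fun w => t w ^ k * (g \o param c) w); split.
  - by apply: (holo_at2 _ (holo_at_Xz k dt' tz) dg) => w; exact: cdiffM.
  - by rewrite mulf_neq0// ?expfz_neq0//= chart_paramK.
  apply: pnearS (pnearI fE tE) => w wz [E1 E2].
  by rewrite /= E1 E2 expr1z expfzMl mulrA.
move=> [g [dg gz gE]]; exists c, (g \o coord c); split=> //.
  exact: holomorphic_at_coord.
apply/(pnear_chart _ Ac cp); have [s s0 Hs] := chart_ball Ac cp.
by apply: pnearS (pnearI gE (pnear_ball _ s0)) => w wz [E /Hs[_ ws]]; rewrite /= ws -E.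
Qed.

Lemma has_ord_infty f c p : A c -> dom c p ->
  has_ord A f p +oo%E <-> pnear (coord c p) (fun w => (f \o param c) w = 0).
Proof. by move=> Ac cp; exact: (pnear_chart _ Ac cp). Qed.

Lemma has_ord_uniq f p m n : has_ord A f p m -> has_ord A f p n -> m = n.
Proof.
have [_ cov _] := hA; have [c Ac cp] := cov p.
have ninf k : has_ord A f p k%:E -> has_ord A f p +oo%E -> False.
  move=> /(has_ord_chart _ _ Ac cp)/has_cord_neq0 n0 /(has_ord_infty _ Ac cp) z0.
  by have [w _ [+ E]] := pnear_ex (pnearI n0 z0); rewrite /= in E *; rewrite E eqxx.
case: m n => [k| |] [l| |] // hk hl; [|by case: (ninf k)|by case: (ninf l)].
congr EFin; move: hk hl => /(has_ord_chart _ _ Ac cp) hk /(has_ord_chart _ _ Ac cp).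
exact: has_cord_uniq.
Qed.

Lemma ordE f p m : has_ord A f p m -> ord A f p = m.
Proof. by move=> fm; apply: xget_unique => // n fn; exact: has_ord_uniq fn fm. Qed.

Lemma ord1_has_cord f c p : A c -> dom c p -> ord A f p = 1%:E ->
  has_cord (f \o param c) (coord c p) 1.
Proof.
move=> Ac cp f1; apply/(has_ord_chart _ _ Ac cp); rewrite -f1 /ord.
move: f1; rewrite /ord; case: xgetP => // m -> //.
Qed.

Lemma ord_cases f c p : A c -> dom c p ->
  mero (f \o param c) (coord c p) ->
  (ord A f p = +oo%E /\
     pnear (coord c p) (fun w => (f \o param c) w = 0)) \/
  exists2 k : int, ord A f p = k%:E &
     has_cord (f \o param c) (coord c p) k.
Proof.
move=> Ac cp /mero_cord[f0|[k fk]]; [left|right].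
  by split=> //; apply/ordE/(has_ord_infty _ Ac cp).
by exists k => //; apply/ordE/(has_ord_chart _ _ Ac cp).
Qed.

Lemma ord_holo_ge0 f c p : A c -> dom c p ->
  holo_at (f \o param c) (coord c p) -> (0%:E <= ord A f p)%E.
Proof.
move=> Ac cp /has_cord_holo[f0|[m fm]].
  by rewrite (ordE (m := +oo%E)) ?leey//; apply/(has_ord_infty _ Ac cp).
by rewrite (ordE (m := (m%:Z)%:E)) ?lee_fin//; apply/(has_ord_chart _ _ Ac cp).
Qed.

Lemma coord_image_open c (U : set X) : A c -> open U ->
  open (coord c @` (U `&` dom c)).
Proof.
move=> Ac oU; rewrite openE => _ [p [Up cp] <-].
have [r r0 H] := chart_ball Ac cp.
have /(near_chart _ Ac cp)[s s0 K] : \forall q \near p, U q by exact: open_nbhs_nbhs.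
apply/nearC; exists (Num.min r s); first by rewrite lt_min r0.
move=> w; rewrite lt_min => /andP[/H[h1 h2] /K h3].
by exists (param c w).
Qed.

Lemma coord_ball_open c p (r : R) : A c ->
  open (dom c `&` [set q | cabs (coord c q - coord c p) < r]).
Proof.
move=> Ac; rewrite openE => q [cq qr].
have [hc _ _] := hA; have [oD _ _ cco _] := hc c Ac.
have r'0 : 0 < r - cabs (coord c q - coord c p) by rewrite subr_gt0.
have /cont_atP /(_ _ r'0) nco := cco q cq.
have nD : \forall x \near q, dom c x by exact: open_nbhs_nbhs.
apply: filterS2 nD nco => x cx xq; split=> //=.
by have := cabs_tri (coord c x) (coord c q) (coord c p); move: xq; lra.
Qed.

Lemma surface_harmonic_Re c p (r : R) (Psi : R[i] -> R[i]) : A c -> dom c p ->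
  holo_ball Psi (coord c p) r ->
  surface_harmonic_on A
    (dom c `&` [set q | cabs (coord c q - coord c p) < r])
    (fun q => complex.Re (Psi (coord c q))).
Proof.
move=> Ac cp dPsi; have oU := coord_ball_open p r Ac; split=> // c' A'.
apply: harmonic_local_Re; first exact: coord_image_open.
move=> _ [q [[cq qr] c'q] <-].
have [s s0 Hs] := transition_ball A' Ac c'q cq.
exists (fun w => Psi (coord c (param c' w))).
have dtr : cdiff (fun w => coord c (param c' w)) (coord c' q).
  by have [|_ _ _] := Hs (coord c' q); rewrite ?subrr ?cabs0.
have r'0 : 0 < r - cabs (coord c q - coord c p) by rewrite subr_gt0.
have [t t0 Ht] := near_close r'0 dtr.
exists (Num.min s t); first by rewrite lt_min s0.
split=> // w; rewrite lt_min => /andP[ws wt]; have [_ _ _ dw] := Hs w ws.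
apply: (@cdiff_comp _ (fun x => coord c (param c' x)) Psi) => //.
apply: dPsi; have := Ht w wt; rewrite chart_paramK// => h.
by have := cabs_tri (coord c (param c' w)) (coord c q) (coord c p); move: h; lra.
Qed.

End Charts.

Section CurveGreen.
Context {R : realType} {X : topologicalType}.
Local Notation dom := chart_dom.
Local Notation coord := chart_coord.
Local Notation param := chart_param.
Variables (A : set (chart R X)) (sigma : X -> 'rV[R[i]]_3).
Hypotheses (hA : is_atlas A) (hsigma : holomorphic_to_P2 A sigma).
Implicit Types (c : chart R X) (p q t : X).
Let a := afun sigma.
Let b := bfun sigma.

Lemma holo_at_near (f g : R[i] -> R[i]) z (r : R) : 0 < r ->
  (forall w, cabs (w - z) < r -> f w = g w) -> holo_at g z -> holo_at f z.
Proof.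
move=> r0 fg [s s0 dg]; exists (Num.min r s); first by rewrite lt_min r0.
move=> w; rewrite lt_min => /andP[wr ws]; apply: (@cdiff_near _ _ g); last exact: dg.
apply/nearC; exists (r - cabs (w - z)); first by rewrite subr_gt0.
by move=> x xw; apply: fg; have := cabs_tri x w z; move: xw; lra.
Qed.

Lemma pnear_holo_at (f : R[i] -> R[i]) z : pnear z (cdiff f) -> pnear z (holo_at f).
Proof.
move=> [r r0 H]; exists r => // w wz wr.
exists (Num.min (r - cabs (w - z)) (cabs (w - z))).
  by rewrite lt_min subr_gt0 wr cabs_gt0 subr_eq0.
move=> x; rewrite lt_min => /andP[h1 h2]; apply: H.
  by apply: contraTneq h2 => ->; rewrite cabsB ltxx.
by have := cabs_tri x w z; move: h1; lra.
Qed.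

Lemma quotient_order (f g h : R[i] -> R[i]) z (m : nat) : holo_at g z -> holo_at h z ->
  h z != 0 -> pnear z (fun w => f w = g w / ((w - z) ^+ m * h w)) ->
  mero f z /\ (g z != 0 -> has_cord f z (- m%:Z)).
Proof.
move=> dg dh hz fE.
have dq := holo_at_div dg dh hz.
split=> [|gz].
  exists m, (fun w => g w / h w); split=> //.
  by apply: pnearS fE => w _ ->; rewrite invfM; ring.
exists (fun w => g w / h w); split=> //; first by rewrite mulf_neq0 ?invr_eq0.
by apply: pnearS fE => w _ ->; rewrite invfM -exprnN; ring.
Qed.

Lemma holo_or_pole c p : A c -> dom c p ->
  (holo_at (a \o param c) (coord c p) /\
   holo_at (b \o param c) (coord c p)) \/
  [/\ mero (a \o param c) (coord c p),
      mero (b \o param c) (coord c p) &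
      exists2 m : nat, (0 < m)%N &
        has_cord (a \o param c) (coord c p) (- m%:Z) \/
        has_cord (b \o param c) (coord c p) (- m%:Z)].
Proof.
move=> Ac cp; have [F [hF Fp /(near_chart hA _ Ac cp)[r r0 Fs]]] := hsigma p.
set z := coord c p.
pose G i w := F (param c w) ord0 i.
have dG i : holo_at (G i) z by exact: (holomorphic_chart hA (hF i) Ac cp).
have quot i w : cabs (w - z) < r ->
    sigma (param c w) ord0 i / sigma (param c w) ord0 0 = G i w / G 0 w.
  move=> /Fs[l l0 E]; rewrite /G E !mxE invfM mulrACA divff ?mul1r//.
have aE w : cabs (w - z) < r -> (a \o param c) w = G 1 w / G 0 w by exact: quot.
have bE w : cabs (w - z) < r -> (b \o param c) w = G 2 w / G 0 w by exact: quot.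
have [G0|G0] := eqVneq (G 0 z) 0; last first.
  left; split; first exact: holo_at_near r0 aE (holo_at_div (dG 1) (dG 0) G0).
  exact: holo_at_near r0 bE (holo_at_div (dG 2) (dG 0) G0).
have [s s0 dG0] := dG 0; have [[t t0 H]|[m [g [dg gz gE]]]] := holo_zero s0 dG0.
  left; have rt0 : 0 < Num.min r t by rewrite lt_min r0.
  have d0 : holo_at (fun=> 0 : R[i]) z by apply: holo_at_all => w; exact: cdiff_cst.
  by split; apply: (holo_at_near rt0 _ d0) => w; rewrite lt_min => /andP[wr wt];
    rewrite ?aE ?bE// H// invr0 mulr0.
right; have m0 : (0 < m)%N.
  rewrite lt0n; apply: contraTneq gz => m0; rewrite negbK.
  by rewrite -G0 gE m0 expr0 mul1r.
have dg' : holo_at g z by exists s.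
have paE : pnear z (fun w => (a \o param c) w = G 1 w / ((w - z) ^+ m * g w)).
  by exists r => // w _ wr; rewrite aE// -gE.
have pbE : pnear z (fun w => (b \o param c) w = G 2 w / ((w - z) ^+ m * g w)).
  by exists r => // w _ wr; rewrite bE// -gE.
have [ma pa] := quotient_order (dG 1) dg' gz paE.
have [mb pb] := quotient_order (dG 2) dg' gz pbE.
split=> //; exists m => //.
have Gz i : G i z = F p ord0 i by rewrite /G /z (chart_paramK hA).
case/(@rV0Pn _ _ (F p)): Fp => i; rewrite -Gz.
have [->|] := eqVneq i 0; first by rewrite G0 eqxx.
have [->|] := eqVneq i 1; first by move=> _ /pa; left.
have [->|] := eqVneq i 2; first by move=> _ _ /pb; right.
by case: i => -[|[|[|i]]].
Qed.

Lemma mero_ab c p : A c -> dom c p ->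
  mero (a \o param c) (coord c p) /\
  mero (b \o param c) (coord c p).
Proof.
by move=> Ac cp; have [[da db]|[]//] := holo_or_pole Ac cp; split; exact: mero_holo.
Qed.

Lemma mero_c n c p : A c -> dom c p ->
  mero ((fun q => orbit_a n (a q) (b q)) \o param c) (coord c p).
Proof. by move=> Ac cp; have [ma mb] := mero_ab Ac cp; exact: mero_orbit. Qed.

Lemma Splus_holo c p : A c -> dom c p ->
  holo_at (a \o param c) (coord c p) ->
  holo_at (b \o param c) (coord c p) -> ~ Splus A sigma p.
Proof.
move=> Ac cp /(ord_holo_ge0 hA Ac cp) oa /(ord_holo_ge0 hA Ac cp) ob.
rewrite /Splus /= /gamma_max /gamma_a /gamma_b lt_max => /orP[|].
  by rewrite ltNge mule_ge0_le0// ?lee_fin// oppe_le0.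
by rewrite ltNge oppe_le0 ob.
Qed.

Lemma not_Splus_holo c p : A c -> dom c p -> ~ Splus A sigma p ->
  holo_at (a \o param c) (coord c p) /\
  holo_at (b \o param c) (coord c p).
Proof.
move=> Ac cp nS; have [//|[_ _ [m m0 ab]]] := holo_or_pole Ac cp.
case: nS; rewrite /Splus /= /gamma_max /gamma_a /gamma_b lt_max.
case: ab => /(has_ord_chart hA _ _ Ac cp)/(ordE hA) ->; apply/orP; [left|right].
  by rewrite -EFinN -EFinM lte_fin opprK mulr_gt0.
by rewrite -EFinN lte_fin opprK.
Qed.

Lemma not_Splus_punctured c p : A c -> dom c p ->
  pnear (coord c p) (fun w => ~ Splus A sigma (param c w)).
Proof.
move=> Ac cp; have [ma mb] := mero_ab Ac cp; have [r r0 Hr] := chart_ball hA Ac cp.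
apply: pnearS (pnearI (pnear_holo_at (mero_cdiff ma))
  (pnearI (pnear_holo_at (mero_cdiff mb)) (pnear_ball _ r0))).
move=> w wz [da [db /Hr[h1 h2]]].
by apply: (Splus_holo Ac h1); rewrite h2.
Qed.

Lemma not_Splus_near c p : A c -> dom c p -> ~ Splus A sigma p ->
  exists2 r : R, 0 < r & forall w, cabs (w - coord c p) < r ->
    ~ Splus A sigma (param c w).
Proof.
move=> Ac cp nS; have [r r0 H] := not_Splus_punctured Ac cp; exists r => // w wr.
have [->|wz] := eqVneq w (coord c p); last exact: H.
by rewrite (chart_paramK hA).
Qed.

Lemma S0plus_sub p : S0plus A sigma p -> Splus A sigma p.
Proof.
move=> S0; apply/not_notP => nS; have [_ cov _] := hA; have [c Ac cp] := cov p.
have [da db] := not_Splus_holo Ac cp nS.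
have [n _ Hn] := S0 1; have := Hn n (leqnn n); rewrite /gamma leNgt.
suff -> : (- ord A (fun q => orbit_a n (a q) (b q)) p < 1%:E)%E by [].
apply: (@le_lt_trans _ _ 0%:E); last by rewrite lte_fin.
rewrite oppe_le0; apply: (ord_holo_ge0 hA Ac cp).
by apply: (holo_at2 _ da db) => w; exact: cdiff_orbit.
Qed.

Lemma escape_S0plus c p N (k : nat) : A c -> dom c p -> (0 < k)%N ->
  has_cord ((fun q => orbit_a N (a q) (b q)) \o param c) (coord c p) (- k%:Z) ->
  big_pow (a \o param c) (coord c p) (1 - k%:Z) ->
  big_pow (b \o param c) (coord c p) (1 - 3 * k%:Z) ->
  S0plus A sigma p.
Proof.
move=> Ac cp k0 cN ak bk M; have [ma mb] := mero_ab Ac cp.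
exists (N + `|M|)%N => // n /= hn; rewrite /gamma.
have nE : n = (N + (n - N))%N by rewrite subnKC// (leq_trans (leq_addr _ _) hn).
have jM : (`|M| <= n - N)%N by rewrite leq_subRL ?(leq_trans (leq_addr _ _) hn).
rewrite nE; move: (n - N)%N jM => j jM.
have := escape_orders ma mb k0 cN ak bk j.
move=> /(has_ord_chart hA (fun q => orbit_a (N + j) (a q) (b q)) _ Ac cp)/(ordE hA) ->.
rewrite -EFinN lee_fin opprK (le_trans (ler_norm M))// -abszE lez_nat.
rewrite (leq_trans jM)// (leq_trans (ltnW (ltn_expl j (isT : 1 < 3)%N)))//.
by rewrite leq_pmull.
Qed.

Lemma nonescape_pole c p : A c -> dom c p ->
  Splus A sigma p -> ~ S0plus A sigma p -> forall d : R, 0 < d ->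
  pnear (coord c p) (fun w => Gcurve sigma (param c w) <= d).
Proof.
move=> Ac cp Sp nS0 d d0; have [ma mb] := mero_ab Ac cp.
set z := coord c p; pose a1 := a \o param c; pose b1 := b \o param c.
have noesc N (k : nat) : (0 < k)%N ->
    has_cord (fun w => orbit_a N (a1 w) (b1 w)) z (- k%:Z) ->
    big_pow a1 z (1 - k%:Z) -> big_pow b1 z (1 - 3 * k%:Z) -> False.
  by move=> k0 h1 h2 h3; apply: nS0; exact: escape_S0plus Ac cp k0 h1 h2 h3.
have no_b (l : nat) : (0 < l)%N -> has_cord b1 z (- l%:Z) ->
    ~ (pnear z (fun w => a1 w = 0) \/
       exists2 ka : int, - l%:Z < 3 * ka & has_cord a1 z ka).
  move=> l0 ob oa; apply: (noesc 1%N l l0); last 2 first.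
  - case: oa => [|[ka hka oa]]; first exact: big_pow0.
    by apply: big_pow_cord oa; move: l0 hka; lia.
  - by apply: big_pow_cord ob; move: l0; lia.
  have c1E w : orbit_a 1 (a1 w) (b1 w) = b1 w + (- 2 * a1 w) * (a1 w * a1 w).
    by rewrite /orbit_a /= /cubic; move: (a1 w) (b1 w) => x y; ring.
  case: oa => [a0|[ka hka oa]].
    by apply: has_cord_pnear ob; apply: pnearS a0 => w _ E; rewrite c1E E !mulr0 addr0.
  apply: (@has_cord_pnear _ _ (fun w => b1 w + (- 2 * a1 w) * (a1 w * a1 w))).
    by apply: pnearT => w _; exact: c1E.
  apply: (has_cord_addl (l := 3 * ka)) => //.
  have o2 : has_cord (fun=> - 2 : R[i]) z 0.
    apply: has_cord_holo0; first by apply: holo_at_all => w; exact: cdiff_cst.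
    by rewrite oppr_eq0 pnatr_eq0.
  have -> : 3 * ka = (0 + ka) + (ka + ka) by ring.
  by apply: has_cordM; apply: has_cordM.
have pole_a (m : nat) : (0 < m)%N -> has_cord a1 z (- m%:Z) ->
    (forall l : int, l <= - 3 * m%:Z -> big_pow b1 z l) ->
    pnear z (fun w => Gplus (a1 w) (b1 w) <= d).
  move=> m0 oa ob; apply: (nonescape_orders m0 oa mb) => // n.
  have [n0|[k hk]] := mero_cord (mero_orbit n ma mb); first exact: big_pow0.
  have [mk|km] := lerP (- m%:Z) k; first exact: big_pow_cord hk.
  have kE : k = - (`|k|%N)%:Z by move: km; lia.
  exfalso; apply: (noesc n `|k|%N); first by move: km; lia.
  - by rewrite -kE.
  - by apply: big_pow_cord oa; move: km; lia.
  - by apply: ob; move: km; lia.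
have splitneg (k : int) : k < 0 -> exists2 m : nat, (0 < m)%N & k = - m%:Z.
  by move=> k0; exists `|k|%N; move: k0; lia.
have [[oa a0]|[ka oa hka]] := ord_cases hA Ac cp ma;
    have [[ob b0]|[kb ob hkb]] := ord_cases hA Ac cp mb.
- move: Sp; rewrite /Splus /= /gamma_max /gamma_a /gamma_b -/a -/b oa ob /=.
  by rewrite lt_max gt0_muleNy ?lte_fin.
- have kb0 : kb < 0.
    move: Sp; rewrite /Splus /= /gamma_max /gamma_a /gamma_b -/a -/b oa ob /=.
    by rewrite lt_max gt0_muleNy ?lte_fin //= oppr_gt0.
  have [l l0 lE] := splitneg kb kb0; rewrite lE in hkb.
  by exfalso; apply: (no_b l l0 hkb); left.
- have ka0 : ka < 0.
    move: Sp; rewrite /Splus /= /gamma_max /gamma_a /gamma_b -/a -/b oa ob /=.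
    by rewrite lt_max -EFinM => /orP[|//]; rewrite lte_fin; lia.
  have [m m0 mE] := splitneg ka ka0; rewrite mE in hka.
  by apply: (pole_a m m0 hka) => l _; exact: big_pow0.
- have kab0 : 0 < - ka * 3 \/ 0 < - kb.
    move: Sp; rewrite /Splus /= /gamma_max /gamma_a /gamma_b -/a -/b oa ob /=.
    by rewrite lt_max -EFinM !lte_fin => /orP[]; [left; lia|right].
  have [bka|kab] := ltrP kb (3 * ka).
    have kb0 : kb < 0 by move: kab0 bka; lia.
    have [l l0 lE] := splitneg kb kb0; rewrite lE in hkb.
    by exfalso; apply: (no_b l l0 hkb); right; exists ka => //; rewrite -lE.
  have ka0 : ka < 0 by move: kab0 kab; lia.
  have [m m0 mE] := splitneg ka ka0; rewrite mE in hka.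
  apply: (pole_a m m0 hka) => l hl; apply: big_pow_cord hkb.
  by move: kab hl; rewrite mE; lia.
Qed.

End CurveGreen.

Section GreenExtension.
Context {R : realType} {X : topologicalType}.
Local Notation dom := chart_dom.
Local Notation coord := chart_coord.
Local Notation param := chart_param.
Variables (A : set (chart R X)) (sigma : X -> 'rV[R[i]]_3).
Hypotheses (hA : is_atlas A) (hsigma : holomorphic_to_P2 A sigma).
Implicit Types (c : chart R X) (p q t : X).
Let a := afun sigma.
Let b := bfun sigma.

Definition Gextension p : R := if `[< Splus A sigma p >] then 0 else Gcurve sigma p.

Lemma Gextension_reg p : ~ Splus A sigma p -> Gextension p = Gcurve sigma p.
Proof. by move=> nS; rewrite /Gextension; case: asboolP. Qed.

Lemma Gextension_pole p : Splus A sigma p -> Gextension p = 0.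
Proof. by move=> S; rewrite /Gextension; case: asboolP. Qed.

Lemma Gextension_ge0 p : 0 <= Gextension p.
Proof. by rewrite /Gextension; case: asboolP => // _; exact: Gplus_ge0. Qed.

Lemma Gextension_cont p : ~ S0plus A sigma p -> continuous_at p Gextension.
Proof.
move=> nS0; have [_ cov _] := hA; have [c Ac cp] := cov p; have parK := chart_paramK hA Ac cp.
apply/cont_atRP => e e0; apply/(near_chart hA _ Ac cp).
have [Sp|nS] := pselect (Splus A sigma p).
  rewrite (Gextension_pole Sp); have e20 : 0 < e / 2 by rewrite divr_gt0.
  have [r r0 H] := pnearI (nonescape_pole hA hsigma Ac cp Sp nS0 e20)
    (not_Splus_punctured hA hsigma Ac cp).
  exists r => // w wr; rewrite subr0 ger0_norm ?Gextension_ge0//.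
  have [->|wz] := eqVneq w (coord c p); first by rewrite parK// Gextension_pole.
  by have [h1 h2] := H w wz wr; rewrite Gextension_reg//; move: e0 h1; lra.
have [r r0 H] := not_Splus_near hA hsigma Ac cp nS.
have [da db] := not_Splus_holo hA hsigma Ac cp nS.
have := cont_Gplus (cdiff_cont (holo_at_cdiff da)) (cdiff_cont (holo_at_cdiff db)).
move=> /cont_atRP /(_ _ e0) /nearC [s s0 Hs].
exists (Num.min r s); first by rewrite lt_min r0.
move=> w; rewrite lt_min => /andP[/H nw /Hs]; rewrite (Gextension_reg nw) (Gextension_reg nS).
by rewrite /= parK.
Qed.

Lemma S0plus_closed : open (~` S0plus A sigma).
Proof.
rewrite openE => p /= nS0; have [_ cov _] := hA; have [c Ac cp] := cov p.
apply/(near_chart hA _ Ac cp).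
have [r r0 H] := not_Splus_punctured hA hsigma Ac cp; exists r => // w wr /=.
have [->|wz] := eqVneq w (coord c p); first by rewrite (chart_paramK hA).
by move=> /(S0plus_sub hA hsigma); exact: H.
Qed.

Lemma Gextension_subharmonic :
  surface_subharmonic_on A (~` S0plus A sigma) (EFin \o Gextension).
Proof.
split=> [|c Ac]; first exact: S0plus_closed.
have parK p := chart_paramK hA Ac (p := p).
split.
- by apply: (coord_image_open hA Ac); exact: S0plus_closed.
- by move=> w _; rewrite /= ltry.
- move=> _ m [p [nS0 cp] <-] /=; rewrite parK// lte_fin => Hm.
  have m0 : 0 < m - Gextension p by rewrite subr_gt0.
  have /cont_atRP /(_ _ m0) /(near_chart hA _ Ac cp) [r r0 H] := Gextension_cont nS0.
  apply/nearC; exists r => // w /H; rewrite lte_fin ltr_norml => /andP[_].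
  by rewrite ltrBlDr subrK.
move=> _ [p [nS0 cp] <-]; rewrite /= parK//.
have [H0|H0] := eqVneq (Gextension p) 0.
  exists 1 => // r _; rewrite H0; apply: mule_ge0.
    by rewrite lee_fin invr_ge0 mulr_ge0 ?pi_ge0.
  by apply: integral_ge0 => t _; rewrite lee_fin Gextension_ge0.
have nS : ~ Splus A sigma p by move=> S; rewrite Gextension_pole ?eqxx in H0.
have G0 : 0 < Gplus (a p) (b p).
  by rewrite -[Gplus _ _]/(Gcurve sigma p) -Gextension_reg// lt_neqAle eq_sym H0 Gextension_ge0.
have [da db] := not_Splus_holo hA hsigma Ac cp nS.
have [|Phi [r r0 [dPhi E]]] := green_local_Re da db; first by rewrite /= parK.
have [s s0 Hs] := not_Splus_near hA hsigma Ac cp nS.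
have lR : local_Re (Gextension \o param c) (coord c p) Phi.
  exists (Num.min r s); first by rewrite lt_min r0.
  split=> w; rewrite lt_min => /andP[wr /Hs nw]; first exact: dPhi.
  by rewrite -E//= Gextension_reg.
have [rho rho0 Hrho] := local_Re_mean lR; exists rho => // t /Hrho /=.
by rewrite parK// => Emean; rewrite [leLHS]Emean.
Qed.

Lemma Gcurve_harmonic t0 (u : X -> R[i]) : S0plus A sigma t0 -> ord A u t0 = 1%:E ->
  \forall n \near \oo, exists (U : set X) (h : X -> R),
    [/\ U t0, surface_harmonic_on A U h & forall p, U p -> p <> t0 ->
      [/\ ~ Splus A sigma p, u p != 0 & h p = Gcurve sigma p
         + (fine (gamma A sigma n t0))%:~R / 3 ^+ n * ln (cabs (u p))]].
Proof.
move=> S0 u1; have [_ cov _] := hA; have [c Ac ct] := cov t0.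
have parK q := chart_paramK hA Ac (p := q); have [ma mb] := mero_ab hA hsigma Ac ct.
set z := coord c t0.
have low f : mero (f \o param c) z -> exists M : nat, forall l : int,
    l <= - M%:Z -> big_pow (f \o param c) z l.
  move=> /(mero_cord)[f0|[k fk]]; first by exists 0%N => l _; exact: big_pow0.
  by exists `|k|%N => l lk; apply: big_pow_cord fk; move: lk; lia.
have [Ma Ha] := low a ma; have [Mb Hb] := low b mb.
have [n0 _ Hn0] := S0 (1 + Ma%:Z + Mb%:Z).
exists n0 => // n /= /Hn0; rewrite /gamma.
have [[-> _]//|[kn -> cn]] := ord_cases hA Ac ct (mero_c hA hsigma n Ac ct).
rewrite -EFinN lee_fin => hk.
have [k [k0 kE]] : exists k : nat, (0 < k)%N /\ kn = - k%:Z.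
  by exists `|kn|%N; move: hk; lia.
rewrite kE opprK in hk cn *.
have [Psi [[r r0 dPsi] PsiE]] : exists Psi, holo_at Psi z /\ pnear z (fun w =>
    (u \o param c) w != 0 /\ complex.Re (Psi w) =
    Gplus ((a \o param c) w) ((b \o param c) w) +
    k%:R / 3 ^+ n * ln (cabs ((u \o param c) w))).
  apply: (escape_local_Re ma mb k0 cn); last exact: (ord1_has_cord hA Ac ct u1).
    by apply: Ha; move: hk; lia.
  by apply: Hb; move: hk; lia.
have [s s0 H] := pnearI PsiE (not_Splus_punctured hA hsigma Ac ct).
pose rs := Num.min r s.
exists (dom c `&` [set q | cabs (coord c q - coord c t0) < rs]).
exists (fun q => complex.Re (Psi (coord c q))); split.
- by split=> //=; rewrite subrr cabs0 lt_min r0.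
- by apply: (surface_harmonic_Re hA Ac ct) => w; rewrite lt_min => /andP[wr _]; exact: dPsi.
move=> p [cp /=]; rewrite lt_min => /andP[_ ps] pt.
have pz : coord c p != z.
  by apply/eqP => /(congr1 (param c)); rewrite !parK.
by have [[]] := H _ pz ps; rewrite /= parK.
Qed.

End GreenExtension.

Theorem theorem3p1 (R : realType) (C : set (R[i] * R[i]))
    (X : topologicalType) (A : set (chart R X)) (sigma : X -> 'rV[R[i]]_3)
    (hC : irreducible_plane_curve C) (hX : is_normalization C A sigma) :
  (exists H : X -> R,
     [/\ forall p, ~ Splus A sigma p -> H p = Gcurve sigma p,
         forall p, ~ S0plus A sigma p -> continuous_at p H,
         surface_subharmonic_on A (~` S0plus A sigma) (EFin \o H) &
         forall t0, Splus A sigma t0 -> ~ S0plus A sigma t0 -> H t0 = 0]) /\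
  (forall (t0 : X) (u : X -> R[i]),
     S0plus A sigma t0 -> uniformizer A sigma C t0 u ->
     \forall n \near \oo,
       exists (U : set X) (h : X -> R),
         [/\ U t0, surface_harmonic_on A U h &
             forall p, U p -> p <> t0 ->
               [/\ ~ Splus A sigma p, u p != 0 &
                   h p = Gcurve sigma p
                         + (fine (gamma A sigma n t0))%:~R / 3 ^+ n
                           * ln (cabs (u p))]]).
Proof.
have [[_ _ _ hA] hsigma _ _ _] := hX; split; last first.
  by move=> t0 u S0 [_ u1]; exact: Gcurve_harmonic.
exists (Gextension A sigma); split.
- exact: Gextension_reg.
- exact: Gextension_cont.
- exact: Gextension_subharmonic.
- by move=> t0 S _; exact: Gextension_pole.
Qed.
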